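(* Let $S:\mathbb{T}^1\to\mathbb{T}^1$, $g:\mathbb{T}^1\to(0,\infty)$, $h:[0,a]\to[0,\infty)$ satisfy the standing assumptions (H1), (H2), (H3) listed in the context, let $\varphi_\infty:\mathbb{T}^1\to[0,a]$ be the associated invariant graph, and let $s_*>0$ be the unique positive zero of the pressure function $\psi$. For $\epsilon>0$ put $$\Xi_\epsilon:=\frac1\epsilon\int_{\mathbb{T}^1}\min\{\varphi_\infty(t),\epsilon\}\,dt,\qquad\text{so that}\qquad 1-\Xi_\epsilon=\frac1\epsilon\int_{\mathbb{T}^1}(\epsilon-\varphi_\infty(t))^+\,dt.$$ Then $$\lim_{\epsilon\to0^+}\frac{\log\Xi_\epsilon}{\log\epsilon}=0\qquad\text{and}\qquad\lim_{\epsilon\to0^+}\frac{\log(1-\Xi_\epsilon)}{\log\epsilon}=s_*.$$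
   Context: Conventions: $\mathbb{T}^1=\mathbb{R}/\mathbb{Z}$, $m$ (also $dt$) is Lebesgue measure on $\mathbb{T}^1$, $|U|$ is the length of an interval $U$; $C^{1+}$ means $C^1$ with Hölder continuous derivative (unspecified exponent); $y^+=\max\{y,0\}$. Fibre function: $a>0$, $I=[0,a]$, $h:I\to[0,\infty)$ is strictly increasing, concave, $C^{1+}$, with $h(0)=0$, $h'(0)=1$. The function $g:\mathbb{T}^1\to(0,\infty)$ is measurable and $g(v)h(a)\le a$ for all $v$, so that $x\mapsto g(v)h(x)$ maps $I$ into $I$. (H1) $S:\mathbb{T}^1\to\mathbb{T}^1$ is a piecewise expanding, piecewise $C^{1+}$, mixing Markov map with finitely many branches: there is a finite partition of $\mathbb{T}^1$ into intervals (the monotonicity intervals) on each of which $S$ is a $C^{1+}$ diffeomorphism onto its image (up to the endpoints), each image is a union of partition intervals (up to endpoints), the resulting Markov chain is mixing, and there are $c>0,\lambda>1$ with $|(S^n)'|\ge c\lambda^n$ for all $n\ge1$. $\mu_{\rm ac}$ denotes the unique $S$-invariant probability measure absolutely continuous with respect to $m$. (H2) Put $g_n=\prod_{i=1}^n g\circ S^i$. For $v\in\mathbb{T}^1$ let $\mathcal{U}_n(v)$ be the family of all interval neighbourhoods $U$ of $v$ such that $S^n|_U:U\to S^nU$ is a diffeomorphism. There is $D>0$ such that for all $n\ge1$, $v\in\mathbb{T}^1$, $U\in\mathcal{U}_n(v)$, $\tilde v\in U$: $D^{-1}\le g_n(\tilde v)/g_n(v)\le D$. (H3) There is an $S$-invariant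 probability measure $\mu_-$ with $\int\log g\,d\mu_-<0<\int\log g\,d\mu_{\rm ac}$. Invariant graph: for $v\in\mathbb{T}^1$ let $f_{0,v}=\mathrm{id}_I$, $f_{1,v}(x)=g(Sv)h(x)$ and $f_{n,v}(x)=f_{1,v}(f_{n-1,Sv}(x))$. Put $\varphi_n(v)=f_{n,v}(a)$, which is non-increasing in $n$, and $\varphi_\infty(v)=\lim_{n\to\infty}\varphi_n(v)$. (If $\hat S:\Theta\to\Theta$ is a bimeasurable bijection and $\Pi:\Theta\to\mathbb{T}^1$ is measurable with $S\circ\Pi=\Pi\circ\hat S^{-1}$, then $\varphi_\infty\circ\Pi$ is the maximal invariant graph of the skew product $(\theta,x)\mapsto(\hat S\theta,g(\Pi\theta)h(x))$.) Pressure: for $s\in\mathbb{R}$, $\psi(s)$ is the topological pressure of the potential $-\log|S'|-s\log g$ for (the topological Markov chain coding) $S$, i.e. $$\psi(s)=\lim_{n\to\infty}\frac1n\log\sum_{Z}\sup_{v\in Z}\frac{\prod_{i=0}^{n-1}g(S^iv)^{-s}}{|(S^n)'(v)|},$$ the sum running over all non-empty open $n$-cylinders $Z$, i.e. sets $\bigcap_{i=0}^{n-1}S^{-i}J_{k_i}^{\circ}$ with $J_{k}$ the monotonicity intervals. It is convex with $\psi(0)=0$, $\psi'(0)=-\int\log g\,d\mu_{\rm ac}<0$, $\psi(s)\to\infty$ as $s\to\infty$, and $s_*$ denotes its unique zero in $(0,\infty)$. *)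

(* Defs.v *)
From HB Require Import structures.
From mathcomp Require Import all_boot all_order all_algebra.
From mathcomp Require Import all_classical all_reals all_analysis.
From mathcomp Require Import measurable_realfun.

Set Implicit Arguments.
Unset Strict Implicit.
Unset Printing Implicit Defensive.

Import Order.TTheory GRing.Theory Num.Theory.
Import numFieldNormedType.Exports.

Local Open Scope classical_set_scope.
Local Open Scope ring_scope.

Section circle.
Variable R : realType.

Definition eq_mod1 (x y : R) : bool := x - y \is a Num.int.

Lemma eq_mod1_refl : reflexive eq_mod1.
Proof. by move=> x; rewrite /eq_mod1 subrr. Qed.

Lemma eq_mod1_sym : symmetric eq_mod1.
Proof. by move=> x y; rewrite /eq_mod1 -opprB rpredN. Qed.

Lemma eq_mod1_trans : transitive eq_mod1.
Proof.
by move=> y x z xy yz; rewrite /eq_mod1 -(subrKA y); exact: rpredD.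
Qed.

Canonical eq_mod1_equiv :=
  EquivRel eq_mod1 eq_mod1_refl eq_mod1_sym eq_mod1_trans.

(* The circle R/Z with its quotient topology and its Borel sigma-algebra. *)
Definition T1 : Type := quotient_topology {eq_quot eq_mod1_equiv}%qT.

HB.instance Definition _ := Quotient.on T1.
HB.instance Definition _ := Choice.on T1.
HB.instance Definition _ := PointedTopological.on T1.

Definition T1_borel : set (set T1) := <<s @open T1 >>.

HB.instance Definition _ :=
  @isMeasurable.Build (sigma_display (@open T1)) T1 T1_borel
    (@sigma_algebra0 _ setT (@open T1)) (@sigma_algebraC _ (@open T1))
    (@sigma_algebra_bigcup _ setT (@open T1)).

Definition circ (x : R) : T1 := \pi_T1%qT x.

Lemma measurable_circ : measurable_fun setT circ.
Proof.
apply: (measurability (@open T1)) => // _ [B oB <-].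
by rewrite setTI; exact: open_measurable.
Qed.

(* [0, 1[ is a fundamental domain of the projection [circ]. *)
Definition lebesgueT : set T1 -> \bar R :=
  pushforward (mrestr (@lebesgue_measure R) (measurable_itv `[0, 1[)) circ.

Let lebesgueT0 : lebesgueT set0 = 0%E.
Proof. by rewrite /lebesgueT /pushforward preimage_set0 measure0. Qed.

Let lebesgueT_ge0 A : (0 <= lebesgueT A)%E.
Proof. by rewrite /lebesgueT /pushforward /mrestr; exact: measure_ge0. Qed.

Let lebesgueT_sigma_additive : semi_sigma_additive lebesgueT.
Proof.
exact: (@measure_semi_sigma_additive _ _ _
  (measure_function_pushforward__canonical__measure_function_Measure
     (mrestr (@lebesgue_measure R) (measurable_itv `[0, 1[)) measurable_circ)).
Qed.

HB.instance Definition _ := isMeasure.Build _ _ _ lebesgueT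
  lebesgueT0 lebesgueT_ge0 lebesgueT_sigma_additive.

End circle.

Arguments circ {R} x.
Arguments lebesgueT {R}.

Section regularity.
Variable R : realType.

(* One-sided at the endpoints of [D]. *)
Definition has_deriv_within (D : set R) (f : R -> R) (x l : R) : Prop :=
  (f y - f x) / (y - x) @[y --> within D x^'] --> l.

Definition holder_on (D : set R) (f : R -> R) : Prop :=
  exists alpha C : R, [/\ 0 < alpha <= 1, 0 <= C &
    forall x y, D x -> D y -> `|f x - f y| <= C * `|x - y| `^ alpha].

(* [circ] restricts to a homeomorphism from [V] onto an interval of the circle;
   the last condition excludes half-open intervals of length 1. *)
Definition arc_chart (V : set R) : Prop :=
  [/\ is_interval V, {in V &, injective circ} & circ @` V != setT].

Definition arc (U : set (T1 R)) : Prop :=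
  exists2 V, arc_chart V & U = circ @` V.

(* [F], with derivative [dF], represents [f] in the charts [circ] of the arcs
   [circ @` V] and [circ @` (F @` V)]. *)
Definition diffeo_lift (f : T1 R -> T1 R) (V : set R) (F dF : R -> R) : Prop :=
  [/\ arc_chart V, arc_chart (F @` V),
      forall x, V x -> f (circ x) = circ (F x) &
      forall x, V x -> has_deriv_within V F x (dF x) /\ dF x != 0].

Definition C1_diffeo_on (f : T1 R -> T1 R) (U : set (T1 R)) : Prop :=
  exists V F dF, [/\ U = circ @` V, diffeo_lift f V F dF &
    {within V, continuous dF}].

(* As [V] is bounded, a Hoelder derivative extends to the closure of [V]. *)
Definition C1plus_diffeo_on (f : T1 R -> T1 R) (U : set (T1 R)) : Prop :=
  exists V F dF, [/\ U = circ @` V, diffeo_lift f V F dF & holder_on V dF].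

(* The derivative of a circle map, read off any local lift; 0 where there is
   none. *)
Definition circ_deriv (f : T1 R -> T1 R) (v : T1 R) : R :=
  xget 0 [set l | exists x F, [/\ v = circ x,
    \forall y \near x, f (circ y) = circ (F y) & is_derive x 1 F l]].

End regularity.

Section Markov.
Variables (R : realType) (S : T1 R -> T1 R) (N : nat) (J : 'I_N -> set (T1 R)).

Definition interval_partition : Prop :=
  [/\ forall k, arc (J k) /\ (J k)° !=set0,
      trivIset setT J & \bigcup_k J k = setT].

Definition transition (k l : 'I_N) : Prop := (J l)° `<=` S @` (J k)°.

(* The complement of the union of the (J l)° is the finite set of endpoints:
   up to endpoints, each image is a union of partition intervals. *)
Definition Markov_partition : Prop :=
  forall k, S @` (J k)° `&` \bigcup_l (J l)°
    = \bigcup_(l in transition k) (J l)°.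

Definition mixing_chain : Prop :=
  exists n0, forall n, (n0 <= n)%N -> forall k l, exists w : nat -> 'I_N,
    [/\ w 0%N = k, w n = l &
      forall i, (i < n)%N -> transition (w i) (w i.+1)].

Definition open_cylinder (n : nat) (w : n.-tuple 'I_N) : set (T1 R) :=
  [set v | forall i : 'I_n, (J (tnth w i))° (iter i S v)].

Definition expanding : Prop :=
  exists c lambda : R, [/\ 0 < c, 1 < lambda &
    forall n (w : n.-tuple 'I_N) v, (0 < n)%N -> open_cylinder w v ->
      c * lambda ^+ n <= `|circ_deriv (iter n S) v|].

Definition mixing_Markov_map : Prop :=
  [/\ interval_partition, forall k, C1plus_diffeo_on S (J k)°,
      Markov_partition, mixing_chain & expanding].

Variable g : T1 R -> R.

(* Distinct words have disjoint open cylinders, so summing over the words with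
   non-empty cylinder is summing over the non-empty cylinders. *)
Definition pressure_sum (s : R) (n : nat) : R :=
  \sum_(w : n.-tuple 'I_N | `[< open_cylinder w !=set0 >])
    sup [set (\prod_(i < n) g (iter i S v) `^ (- s))
               / `|circ_deriv (iter n S) v| | v in open_cylinder w].

Definition pressure (s : R) : R :=
  lim (n%:R^-1 * ln (pressure_sum s n) @[n --> \oo]).

End Markov.

Section skew_product.
Variables (R : realType) (S : T1 R -> T1 R) (g : T1 R -> R).

Definition birkhoff_prod (n : nat) (v : T1 R) : R :=
  \prod_(1 <= i < n.+1) g (iter i S v).

Definition bounded_distortion : Prop :=
  exists2 D : R, 0 < D & forall n v U, (0 < n)%N ->
    nbhs v U -> C1_diffeo_on (iter n S) U -> forall v', U v' ->
    D^-1 <= birkhoff_prod n v' / birkhoff_prod n v <= D.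

Definition invariant_measure (mu : set (T1 R) -> \bar R) : Prop :=
  forall A, measurable A -> mu (S @^-1` A) = mu A.

Definition concave_on (D : set R) (f : R -> R) : Prop :=
  convex_function (D : set R^o) (fun x => - f x).

Definition fibre_function (a : R) (h : R -> R) : Prop :=
  [/\ {in `[0, a] &, {homo h : x y / x < y}}, concave_on `[0, a] h, h 0 = 0 &
    exists dh : R -> R,
      [/\ forall x, x \in `[0, a] -> has_deriv_within `[0, a] h x (dh x),
          holder_on `[0, a] dh & dh 0 = 1]].

Variables (a : R) (h : R -> R).

Fixpoint fibre_iter (n : nat) (v : T1 R) (x : R) : R :=
  if n is n'.+1 then g (S v) * h (fibre_iter n' (S v) x) else x.

Definition phi_infty (v : T1 R) : R := lim (fibre_iter n v a @[n --> \oo]).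

Definition Xi (eps : R) : R :=
  eps^-1 * \int[lebesgueT]_t Num.min (phi_infty t) eps.

End skew_product.

(* Main.v *)
(* Cylinders of the Markov map form a quasi-Bernoulli system: by bounded distortion
   the mass of a concatenated word is, up to constants, the product of the masses,
   and log g_n is additive up to a constant.  Hence the logarithms of the partition
   sums P_n(t) = sum_w exp(- t log g_n(w)) m(w) are quasi-additive, the limit
   defining the pressure exists, and psi(s) = 0 means that P_n(s) stays between two
   positive constants.

   The exponent of mu_ac makes P_n(t) decay exponentially for 0 < t < s.  Otherwise
   log g_n is bounded above with probability bounded below, uniformly in n; by
   quasi-independence almost every orbit then has times at which the average of
   log g is arbitrarily small, and a stopping time argument for mu_ac gives
   int log g dmu_ac <= 0.

   Since h(x) <= x, phi_infty <= a inf g_n; since h(x) >= x (1 - C x^al), phi_infty is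
   at least eps as soon as g_n >= A eps exp(theta n) for all n.  The union bound and
   the decay of P_n(t) give m(phi_infty < eps) = O(eps^t) for t < s.  Conversely
   P_n(s) >= c together with the decay of P_n(t) forces, for sig > s, a word w with
   log g_n(w) <= - l and probability much larger than exp(- sig l); concatenating such
   words gives m(phi_infty <= eps) >= c eps^sig for all small eps. *)

(* The weights are Lebesgue masses, which need not be shift invariant, and the base has memory; the
   substitute for independence is a pair of inequalities: [p (w ++ u)] is at most a constant times
   [p w * p u], and at least a constant times it once a suitable word of the fixed length [q] is
   inserted, since [w ++ u] itself may be forbidden. The critical exponent [s] gives no decay, so
   each tail is estimated with an exponent off [s], and the logarithmic scale of the statement
   absorbs the difference. For the upper bound on the deficit the decay rate of [P_n(t)] is spent
   twice: one half makes the union bound over [n] summable, the other half buys the factor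
   [exp (theta * n)] that keeps the accumulated nonlinearity of [h] under control. For the lower
   bound, decay at one exponent [t < s] prevents the mass of [P_n(s)] from sitting on words where
   [G] is bounded below. *)
Require Import Defs.
From mathcomp Require Import all_boot all_order all_algebra.
From mathcomp Require Import all_classical all_reals all_analysis.
From mathcomp Require Import measurable_realfun.
From mathcomp Require Import ring lra.

Set Implicit Arguments.
Unset Strict Implicit.
Unset Printing Implicit Defensive.

Import Order.TTheory GRing.Theory Num.Theory.
Import numFieldNormedType.Exports.

Local Open Scope classical_set_scope.
Local Open Scope ring_scope.

(** * Sums over words *)
Section word_sums.
Variables (R : realType) (I : finType).
Implicit Types (Phi : seq I -> R).

Lemma sum_word0 Phi : \sum_(w : 0.-tuple I) Phi w = Phi [::].
Proof.
rewrite (big_pred1 [tuple]) // => w.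
by apply/esym/eqP; rewrite [LHS]tuple0.
Qed.

Lemma sum_wordS n Phi :
  \sum_(w : n.+1.-tuple I) Phi w
    = \sum_(k : I) \sum_(w : n.-tuple I) Phi (k :: w).
Proof.
rewrite pair_big_dep /=.
rewrite (reindex (fun x : I * n.-tuple I => cons_tuple x.1 x.2)) //=.
exists (fun w : n.+1.-tuple I => (thead w, behead_tuple w)) => [[k w] _|w _].
- by rewrite theadE /=; congr (_, _); apply: val_inj.
- by rewrite /= [RHS]tuple_eta; apply: val_inj.
Qed.

Lemma sum_word_cat n m Phi :
  \sum_(w : (n + m).-tuple I) Phi w
    = \sum_(w : n.-tuple I) \sum_(u : m.-tuple I) Phi (w ++ u).
Proof.
elim: n Phi => [|n IHn] Phi.
  by rewrite (sum_word0 (fun w => \sum_(u : m.-tuple I) Phi (w ++ u))).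
rewrite addSn sum_wordS.
rewrite (sum_wordS n (fun w => \sum_(u : m.-tuple I) Phi (w ++ u))).
by apply: eq_bigr => k _; rewrite (IHn (fun w => Phi (k :: w))).
Qed.

Lemma sum_word_ge n Phi (w : seq I) : (forall w, 0 <= Phi w) -> size w = n ->
  Phi w <= \sum_(w : n.-tuple I) Phi w.
Proof.
move=> Phi0 /eqP wn; rewrite (bigD1 (Tuple wn)) //= lerDl.
exact: sumr_ge0.
Qed.

End word_sums.

(** * Quasi-additive sequences *)
(** A two-sided Fekete argument: cutting [m * n] into [m] blocks of length [n] or [n] blocks of
    length [m] compares [m * u n] with [n * u m], so [u n / n] is Cauchy. Letting [m] tend to
    infinity with [n] fixed leaves the error [Q], uniform in [n]; this uniformity later turns zero
    pressure into two-sided bounds. *)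
Lemma quasi_additive_cvg (R : realType) (u : nat -> R) (Q : R) :
  (forall n m, `|u (n + m)%N - u n - u m| <= Q) ->
  exists l : R, n%:R^-1 * u n @[n --> \oo] --> l /\
    forall n, `|u n - n%:R * l| <= Q.
Proof.
move=> uQ.
have Q0 : 0 <= Q by apply: le_trans (uQ 0%N 0%N).
have uM n m : `|u (m * n)%N - m%:R * u n| <= (m%:R + 1) * Q.
  elim: m => [|m IHm].
    rewrite !mul0n mul0r subr0 add0r mul1r.
    by have := uQ 0%N 0%N; rewrite addn0 subrr sub0r normrN.
  have := uQ n (m * n)%N; rewrite -mulSn => uQn.
  have -> : u (m.+1 * n)%N - m.+1%:R * u n =
    (u (m.+1 * n)%N - u n - u (m * n)%N) + (u (m * n)%N - m%:R * u n).
    by rewrite -natr1; ring.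
  by apply: le_trans (ler_normD _ _) _; rewrite -natr1; lra.
have uE n m : `|m%:R * u n - n%:R * u m| <= (n%:R + m%:R + 2) * Q.
  have := uM n m; have := uM m n; rewrite mulnC => h1 h2.
  have -> : m%:R * u n - n%:R * u m =
    (u (m * n)%N - n%:R * u m) - (u (m * n)%N - m%:R * u n) by ring.
  by apply: le_trans (ler_normB _ _) _; lra.
have uE1 n m : `|u n.+1 / n.+1%:R - u m.+1 / m.+1%:R| <=
    (n.+1%:R^-1 + m.+1%:R^-1) * (3 * Q).
  have n0 : 0 < n.+1%:R :> R by [].
  have m0 : 0 < m.+1%:R :> R by [].
  have n1 : 1 <= n.+1%:R :> R by rewrite ler1n.
  have m1 : 1 <= m.+1%:R :> R by rewrite ler1n.
  have -> : u n.+1 / n.+1%:R - u m.+1 / m.+1%:R =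
    (m.+1%:R * u n.+1 - n.+1%:R * u m.+1) / (n.+1%:R * m.+1%:R).
    by field; rewrite !gt_eqF.
  have -> : (n.+1%:R^-1 + m.+1%:R^-1) * (3 * Q) =
    (n.+1%:R + m.+1%:R) * (3 * Q) / (n.+1%:R * m.+1%:R).
    by field; rewrite !gt_eqF.
  rewrite normrM [X in _ * X]gtr0_norm ?invr_gt0 ?mulr_gt0//.
  rewrite ler_wpM2r ?invr_ge0 ?mulr_ge0 ?(ltW n0) ?(ltW m0)//.
  apply: le_trans (uE _ _) _; nra.
have ucvg : cvgn (fun n => u n.+1 / n.+1%:R).
  apply/cauchy_cvgP/cauchy_exP => e e0.
  have e6 : 0 < e / (6 * Q + 1) by rewrite divr_gt0//; lra.
  have [m _ mP] := near_infty_natSinv_lt (PosNum e6).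
  exists (u m.+1 / m.+1%:R); exists m => // n /= mn.
  rewrite /ball /= distrC.
  apply: le_lt_trans (uE1 n m) _.
  have h1 : n.+1%:R^-1 < e / (6 * Q + 1) by apply: mP => /=.
  have h2 : m.+1%:R^-1 < e / (6 * Q + 1) by apply: mP => /=.
  apply: (@le_lt_trans _ _ ((e / (6 * Q + 1) + e / (6 * Q + 1)) * (3 * Q))).
    by rewrite ler_wpM2r ?mulr_ge0//; apply: lerD; apply: ltW.
  have -> : (e / (6 * Q + 1) + e / (6 * Q + 1)) * (3 * Q) =
    e * (6 * Q) / (6 * Q + 1) by field; rewrite gt_eqF//; lra.
  rewrite ltr_pdivrMr; last lra.
  by rewrite mulrDr mulr1 ltrDl.
have [l ul] : exists l : R, u n.+1 / n.+1%:R @[n --> \oo] --> l.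
  by exists (limn (fun n => u n.+1 / n.+1%:R)).
exists l; split.
  rewrite -(cvg_shiftS (fun n => n%:R^-1 * u n)) /=.
  by under eq_fun do rewrite mulrC.
have uQ1 n : `|u n.+1 - n.+1%:R * l| <= Q.
  have h m : `|u n.+1 - n.+1%:R * (u m.+1 / m.+1%:R)| <=
      Q + m.+1%:R^-1 * ((n.+1%:R + 2) * Q).
    have m0 : 0 < m.+1%:R :> R by [].
    have -> : u n.+1 - n.+1%:R * (u m.+1 / m.+1%:R) =
      (m.+1%:R * u n.+1 - n.+1%:R * u m.+1) / m.+1%:R.
      by field; rewrite gt_eqF.
    have -> : Q + m.+1%:R^-1 * ((n.+1%:R + 2) * Q) =
      (n.+1%:R + m.+1%:R + 2) * Q / m.+1%:R by field; rewrite gt_eqF.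
    rewrite normrM [X in _ * X]gtr0_norm ?invr_gt0//.
    by rewrite ler_wpM2r ?invr_ge0 ?(ltW m0).
  have c1 : `|u n.+1 - n.+1%:R * (u m.+1 / m.+1%:R)| @[m --> \oo] -->
      `|u n.+1 - n.+1%:R * l|.
    apply: cvg_norm; apply: cvgB; first exact: cvg_cst.
    exact: cvgMr.
  have c2 : Q + m.+1%:R^-1 * ((n.+1%:R + 2) * Q) @[m --> \oo] -->
      Q + 0 * ((n.+1%:R + 2) * Q).
    apply: cvgD; first exact: cvg_cst.
    by apply: cvgMl; exact: cvg_harmonic.
  rewrite mul0r addr0 in c2.
  have -> : Q = lim (Q + m.+1%:R^-1 * ((n.+1%:R + 2) * Q) @[m --> \oo]).
    by rewrite (cvg_lim _ c2).
  rewrite -(cvg_lim _ c1)//; apply: ler_lim.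
  - by apply/cvg_ex; eexists; exact: c1.
  - by apply/cvg_ex; eexists; exact: c2.
  - by near=> m; exact: h.
case=> [|n]; last exact: uQ1.
by rewrite mul0r subr0; have := uQ 0%N 0%N; rewrite addn0 subrr sub0r normrN.
Unshelve. all: by end_near. Qed.

Lemma expR_decay (R : realType) (a b : R) : 0 < a -> 0 < b ->
  exists2 x0, 0 <= x0 & forall x, x0 <= x -> expR (- (a * x)) <= b.
Proof.
move=> a0 b0; exists (Num.max 0 (- ln b / a)); first by rewrite le_max lexx.
move=> x; rewrite ge_max => /andP[_ bx].
rewrite -[leRHS]lnK// ler_expR lerNl mulrC -ler_pdivrMr//.
Qed.

(** * Quasi-Bernoulli weights on words *)
Section quasi_Bernoulli.
Variables (R : realType) (I : finType).
Implicit Types (s t d eta del : R).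

(* [p w] stands for the mass of the cylinder [w] and [G w] for the value of the
   Birkhoff sum of [log g] on it, known up to [K]. *)
Record quasi_Bernoulli (p G : seq I -> R) (C K B c : R) (q : nat) : Prop := {
  qb_ge0 : forall w, 0 <= p w;
  qb_nil : p [::] = 1;
  qb_marginal : forall w m, \sum_(u : m.-tuple I) p (w ++ u) = p w;
  qb_le : forall w u, p (w ++ u) <= C * (p w * p u);
  qb_gt0 : 0 < c;
  qb_connect : forall w u, 0 < p w -> 0 < p u ->
    exists2 x, size x = q & c * (p w * p u) <= p (w ++ x ++ u);
  qb_cat : forall w u, 0 < p (w ++ u) -> `|G (w ++ u) - (G w + G u)| <= K;
  qb_bound : forall w, 0 < p w -> `|G w| <= B * (size w)%:R }.

Variables (p G : seq I -> R) (C K B c : R) (q : nat).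
Hypothesis qb : quasi_Bernoulli p G C K B c q.

Let p_ge0 := qb_ge0 qb.
Let p_nil := qb_nil qb.
Let c_gt0 := qb_gt0 qb.

Definition partition_sum (t : R) (n : nat) : R :=
  \sum_(w : n.-tuple I) expR (- (t * G w)) * p w.

Definition word_prob (n : nat) (A : pred (seq I)) : R :=
  \sum_(w : n.-tuple I) (A w)%:R * p w.

(** Error in [G] caused by a connecting word of length [q]: two concatenations and the bound on [G]
    of that word. *)
Let gap : R := K + K + B * q%:R.

Lemma qb_const_ge1 : 1 <= C.
Proof. by have := qb_le qb [::] [::]; rewrite /= p_nil !mulr1. Qed.

Lemma qb_cat_gt0 w u : 0 < p (w ++ u) -> 0 < p w /\ 0 < p u.
Proof.
have C0 : 0 < C by rewrite (lt_le_trans ltr01)// qb_const_ge1.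
move=> /lt_le_trans/(_ (qb_le qb w u)); rewrite pmulr_rgt0//.
have := p_ge0 w; rewrite le_eqVlt => /predU1P[<-|w0]; first by rewrite mul0r ltxx.
by rewrite pmulr_rgt0.
Qed.

Lemma qb_nil0 : G [::] = 0.
Proof.
apply/eqP; rewrite -normr_le0; have := qb_bound qb (w := [::]).
by rewrite p_nil => /(_ ltr01); rewrite mulr0.
Qed.

Lemma qb_cat3 w x u : size x = q -> 0 < p (w ++ x ++ u) ->
  `|G (w ++ x ++ u) - (G w + G u)| <= gap.
Proof.
move=> xq p0; have [w0 xu0] := qb_cat_gt0 p0; have [x0 u0] := qb_cat_gt0 xu0.
have h1 := qb_cat qb p0; have h2 := qb_cat qb xu0; have h3 := qb_bound qb x0.
rewrite xq in h3; rewrite /gap; move: h1 h2 h3; rewrite !ler_norml; lra.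
Qed.

Lemma sum_p n : \sum_(w : n.-tuple I) p w = 1.
Proof. by have := qb_marginal qb [::] n; rewrite p_nil. Qed.

Lemma word_prob_ge0 n A : 0 <= word_prob n A.
Proof. by apply: sumr_ge0 => w _; rewrite mulr_ge0. Qed.

Lemma le_word_prob n (A A' : pred (seq I)) :
  (forall w, size w = n -> 0 < p w -> A w -> A' w) ->
  word_prob n A <= word_prob n A'.
Proof.
move=> AA'; apply: ler_sum => w _.
have := p_ge0 w; rewrite le_eqVlt => /predU1P[<-|w0]; first by rewrite !mulr0.
rewrite ler_wpM2r// ler_nat; case Aw: (A w) => //.
by rewrite AA' ?size_tuple.
Qed.

Lemma partition_sum_gt0 t n : 0 < partition_sum t n.
Proof.
have [w w0] : exists w : n.-tuple I, 0 < p w.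
  apply/not_existsP => h.
  have := sum_p n; rewrite big1 => [/esym/eqP|w _]; first by rewrite oner_eq0.
  by apply/eqP; rewrite eq_le p_ge0 leNgt andbT; apply/negP/h.
rewrite /partition_sum (bigD1 w)//= ltr_wpDr ?mulr_gt0 ?expR_gt0//.
by apply: sumr_ge0 => i _; rewrite mulr_ge0 ?expR_ge0.
Qed.

Lemma partition_sum_submul t n m : 0 <= t ->
  partition_sum t (n + m) <=
    C * expR (t * K) * (partition_sum t n * partition_sum t m).
Proof.
move=> t0; rewrite /partition_sum.
rewrite (sum_word_cat n m (fun w => expR (- (t * G w)) * p w)).
rewrite mulr_suml mulr_sumr; apply: ler_sum => w _.
rewrite !mulr_sumr; apply: ler_sum => u _.
have := p_ge0 (w ++ u); rewrite le_eqVlt => /predU1P[<-|w0].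
  by rewrite mulr0 !mulr_ge0 ?expR_ge0 ?p_ge0// (le_trans ler01)// qb_const_ge1.
have -> : C * expR (t * K) * (expR (- (t * G w)) * p w *
    (expR (- (t * G u)) * p u)) =
  expR (t * K - t * G w - t * G u) * (C * (p w * p u)).
  by rewrite !expRD; ring.
rewrite ler_pM ?expR_ge0 ?p_ge0 ?(qb_le qb)// ler_expR.
rewrite -!mulrBr -mulrN ler_wpM2l//.
have := qb_cat qb w0; rewrite ler_norml; lra.
Qed.

(* Connecting words turn [sum_w sum_u] of product weights into a sum over longer
   words at the price of the factor [c]. *)
Lemma sum_connect n m (Phi : seq I -> seq I -> R) :
  (forall w u, 0 <= Phi w u) ->
  c * \sum_(w : n.-tuple I) \sum_(u : m.-tuple I) Phi w u * (p w * p u) <=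
  \sum_(w : n.-tuple I) \sum_(x : q.-tuple I) \sum_(u : m.-tuple I)
    Phi w u * p (w ++ x ++ u).
Proof.
move=> Phi0; rewrite mulr_sumr; apply: ler_sum => w _.
rewrite exchange_big/= mulr_sumr; apply: ler_sum => u _.
rewrite mulrCA -mulr_sumr ler_wpM2l//.
have s0 : 0 <= \sum_(x : q.-tuple I) p (w ++ x ++ u) by apply: sumr_ge0.
have := p_ge0 w; rewrite le_eqVlt => /predU1P[<-|w0]; first by rewrite mul0r mulr0.
have := p_ge0 u; rewrite le_eqVlt => /predU1P[<-|u0]; first by rewrite !mulr0.
have [x xq xp] := qb_connect qb w0 u0; apply: le_trans xp _.
exact: (@sum_word_ge _ _ q (fun x => p (w ++ x ++ u))).
Qed.

Lemma sum_word_cat3 n m (Phi : seq I -> R) :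
  \sum_(w : (n + (q + m)).-tuple I) Phi w =
  \sum_(w : n.-tuple I) \sum_(x : q.-tuple I) \sum_(u : m.-tuple I)
    Phi (w ++ x ++ u).
Proof.
rewrite sum_word_cat; apply: eq_bigr => w _.
by rewrite (sum_word_cat q m (fun u => Phi (w ++ u))).
Qed.

Lemma partition_sum_supermul t n m : 0 <= t ->
  c * expR (- (t * gap)) * (partition_sum t n * partition_sum t m) <=
    partition_sum t (n + (q + m)).
Proof.
move=> t0; rewrite /partition_sum.
rewrite (sum_word_cat3 n m (fun w => expR (- (t * G w)) * p w)).
rewrite mulrAC -mulrA.
set Phi := fun w u => expR (- (t * gap)) * expR (- (t * G w)) * expR (- (t * G u)).
apply: le_trans (le_trans (sum_connect n m (Phi := Phi) _) _).
- rewrite ler_wpM2l ?(ltW c_gt0)// mulr_suml mulr_suml le_eqVlt; apply/orP; left.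
  apply/eqP; apply: eq_bigr => w _; rewrite mulr_sumr mulr_suml.
  by apply: eq_bigr => u _; rewrite /Phi; ring.
- by move=> w u; rewrite /Phi !mulr_ge0 ?expR_ge0.
- apply: ler_sum => w _; apply: ler_sum => x _; apply: ler_sum => u _.
  have := p_ge0 (w ++ x ++ u); rewrite le_eqVlt => /predU1P[<-|w0].
    by rewrite !mulr0.
  rewrite ler_wpM2r// /Phi -!expRD ler_expR -!mulrN -!mulrDr ler_wpM2l//.
  have := qb_cat3 _ w0; rewrite size_tuple => /(_ erefl); rewrite ler_norml; lra.
Qed.

(** Supermultiplicativity holds only with [q] extra letters; submultiplicativity splits them off
    again, at the price of the constant [ln (partition_sum t q)]. *)
Lemma ln_partition_sum_quasi_additive t : 0 <= t -> exists Q : R, forall n m,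
  `|ln (partition_sum t (n + m)) - ln (partition_sum t n)
    - ln (partition_sum t m)| <= Q.
Proof.
move=> t0.
have [D D0 DP] : exists2 D : R, 0 < D & forall n m, partition_sum t (n + m) <=
    D * (partition_sum t n * partition_sum t m).
  exists (C * expR (t * K)) => [|n m]; last exact: partition_sum_submul.
  by rewrite mulr_gt0 ?expR_gt0// (lt_le_trans ltr01)// qb_const_ge1.
have [E E0 EP] : exists2 E : R, 0 < E & forall n m,
    E * (partition_sum t n * partition_sum t m) <= partition_sum t (n + (q + m)).
  exists (c * expR (- (t * gap))) => [|n m]; last exact: partition_sum_supermul.
  by rewrite mulr_gt0 ?expR_gt0.
have P0 n : 0 < partition_sum t n by exact: partition_sum_gt0.
exists (`|ln D| + `|ln E| + `|ln (partition_sum t q)|) => n m.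
have h1 : ln (partition_sum t (n + m)) <=
    ln D + (ln (partition_sum t n) + ln (partition_sum t m)).
  by rewrite -!lnM ?ler_ln ?posrE ?mulr_gt0.
have h2 : ln E + (ln (partition_sum t n) + ln (partition_sum t m)) <=
    ln D + (ln (partition_sum t (n + m)) + ln (partition_sum t q)).
  rewrite -!lnM ?ler_ln ?posrE ?mulr_gt0//.
  by apply: le_trans (EP n m) _; rewrite (addnC q) addnA.
have := ler_norm (ln D); have := ler_norm (ln E).
have := ler_norm (ln (partition_sum t q)).
have := ler_norm (- ln D); have := ler_norm (- ln E).
have := ler_norm (- ln (partition_sum t q)).
by rewrite !normrN => *; rewrite ler_norml; lra.
Qed.

Lemma word_prob_chernoff t n (x : R) : 0 <= t ->
  word_prob n (fun w => G w <= x) <= expR (t * x) * partition_sum t n.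
Proof.
move=> t0; rewrite mulr_sumr; apply: ler_sum => w _; rewrite mulrA.
rewrite ler_wpM2r// -expRD; case: (leP (G w) x) => [Gx|_] /=; last by rewrite expR_ge0.
by rewrite -[leLHS]expR0 ler_expR -mulrN -mulrDr mulr_ge0// subr_ge0.
Qed.

(* Tilting between the exponents [0] and [s]: if the partition sum at [t] does not
   decay, its mass sits where [G] is bounded, and there the weights are not tilted. *)
Lemma partition_sum_decay_or_tight t s C1 : 0 < t -> t < s ->
  (forall n, partition_sum s n <= C1) ->
  (exists eta C2 : R, 0 < eta /\
     forall n, partition_sum t n <= C2 * expR (- (eta * n%:R))) \/
  (exists x d : R, 0 < d /\ forall n, d <= word_prob n (fun w => G w <= x)).
Proof.
move=> t0 ts PC1.
have [Q Qq] := ln_partition_sum_quasi_additive (ltW t0).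
have [l [_ lQ]] := quasi_additive_cvg Qq.
(* The dichotomy is the sign of the growth rate at [t]: a negative rate is the decay, and otherwise
   the partition sums at [t] stay above [expR (- Q)]. *)
have [l0|l0] := ltP l 0; [left|right].
  exists (- l), (expR Q); split; first by rewrite oppr_gt0.
  move=> n; rewrite -expRD -[leLHS]lnK ?posrE ?partition_sum_gt0// ler_expR.
  by have := lQ n; rewrite ler_norml mulrC; lra.
have PQ n : expR (- Q) <= partition_sum t n.
  rewrite -[leRHS]lnK ?posrE ?partition_sum_gt0// ler_expR.
  have := lQ n; rewrite ler_norml.
  have := mulr_ge0 (ler0n R n) l0; lra.
have C10 : 0 < C1 by apply: lt_le_trans (PC1 0%N); exact: partition_sum_gt0.
have Q4 : 0 < expR (- Q) / 4 by rewrite divr_gt0 ?expR_gt0.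
have [x1 x10 x1P] := expR_decay t0 Q4.
have st : 0 < s - t by rewrite subr_gt0.
have [x2 x20 x2P] := expR_decay st (divr_gt0 Q4 C10).
(* Where [G > x] the weight is at most [expR (- (t * x))]; where [G < - x] it is at most
   [expR (- ((s - t) * x))] times the weight at [s]. This [x] makes each of the two parts at most
   [expR (- Q) / 4], so half of the lower bound remains for [- x <= G <= x]. *)
set x := Num.max x1 x2.
have {}x1P : expR (- (t * x)) <= expR (- Q) / 4 by apply: x1P; rewrite le_max lexx.
have {}x2P : expR (- ((s - t) * x)) <= expR (- Q) / 4 / C1.
  by apply: x2P; rewrite le_max lexx orbT.
exists x, (expR (- (t * x)) * (expR (- Q) / 2)); split.
  by rewrite mulr_gt0 ?expR_gt0 ?divr_gt0 ?expR_gt0.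
move=> n.
have : partition_sum t n <= expR (t * x) * word_prob n (fun w => G w <= x) +
    (expR (- (t * x)) + expR (- ((s - t) * x)) * partition_sum s n).
  rewrite -[X in _ + (X + _)]mulr1 -[X in _ + (_ * X + _)](sum_p n).
  rewrite !mulr_sumr -!big_split/=.
  apply: ler_sum => w _; rewrite !mulrA -!mulrDl ler_wpM2r//.
  case: (leP (G w) x) => Gx; rewrite ?mulr1 ?mulr0 ?add0r.
    have [xG|Gx'] := leP (- x) (G w).
      apply: ler_wpDr; first by rewrite addr_ge0 ?mulr_ge0 ?expR_ge0.
      by rewrite ler_expR -mulrN ler_pM2l//; lra.
    rewrite addrA; apply: ler_wpDl; first by rewrite addr_ge0 ?expR_ge0.
    rewrite -expRD ler_expR; have := ltr_pM2l st (G w) (- x); rewrite Gx'; lra.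
  apply: ler_wpDr; first by rewrite ?mulr_ge0 ?expR_ge0.
  by rewrite ler_expR lerN2 ler_pM2l// ltW.
have x2Pn : expR (- ((s - t) * x)) * partition_sum s n <= expR (- Q) / 4.
  apply: (@le_trans _ _ (expR (- ((s - t) * x)) * C1)).
    by rewrite ler_wpM2l ?expR_ge0.
  by rewrite -ler_pdivlMr.
move=> h; have h3 : expR (- Q) / 2 <=
  expR (t * x) * word_prob n (fun w => G w <= x) by have := PQ n; lra.
by rewrite -ler_pdivlMl ?expR_gt0// -expRN opprK.
Qed.

(** The slack [e] will bound the distance between [G] and a Birkhoff sum along an orbit, so that
    failure of this predicate yields a genuine stopping time for the orbit. *)
Definition positive_drift (e eta : R) (n : nat) : pred (seq I) :=
  fun w => all (fun i => eta * i%:R < G (take i w) + e) (iota 1 n).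

(* Along a sparse sequence of lengths, whatever happened before, a block with small
   [G] occurs with conditional probability at least [c * d] and resets the average. *)
Lemma positive_drift_rare (e x : R) d eta del :
  0 < d -> (forall n, d <= word_prob n (fun w => G w <= x)) ->
  0 < eta -> 0 < del ->
  exists M, word_prob M (positive_drift e eta M) <= del.
Proof.
move=> d0 dP eta0 del0.
(* Each reset attempt multiplies the probability by at most [1 - c * d <= expR (- (c * d))]. *)
suff step J : exists M, word_prob M (positive_drift e eta M) <=
    expR (- (c * d * J%:R)).
  have [x0 _ x0P] := expR_decay (mulr_gt0 c_gt0 d0) del0.
  have [M MP] := step (Num.truncn x0).+1; exists M; apply: le_trans MP (x0P _ _).
  by rewrite ltW// truncnS_gt.
elim: J => [|J [n IHJ]].
  exists 0%N; rewrite mulr0 oppr0 expR0 /word_prob.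
  by rewrite (sum_word0 (fun w => (positive_drift e eta 0 w)%:R * p w)) p_nil mulr1.
(* The block must be so long that [eta * k] exceeds everything that the first [n] letters, the
   connecting word and a block with [G <= x] can add up to, including the slack [e]. *)
have [k kP k0] : exists2 k, B * n%:R + x + gap + e <= eta * k%:R & (0 < k)%N.
  exists (Num.truncn ((B * n%:R + x + gap + e) / eta)).+1 => //.
  by rewrite [leRHS]mulrC -ler_pdivrMr// ltW// truncnS_gt.
exists (n + (q + k))%N.
set b := word_prob n _ in IHJ.
suff : word_prob (n + (q + k)) (positive_drift e eta (n + (q + k))) <=
    b - c * (b * d).
  move=> /le_trans; apply; rewrite mulrCA -[X in X - _]mulr1 -mulrBr.
  rewrite (_ : - (c * d * J.+1%:R) = - (c * d * J%:R) + - (c * d)); last first.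
    by rewrite -natr1; ring.
  rewrite expRD ler_pM ?word_prob_ge0//.
    rewrite subr_ge0; apply: le_trans (_ : c * word_prob k (fun w => G w <= x) <= _).
      by rewrite ler_pM2l.
    (* [sum_connect] with the empty left word gives [c * d <= 1]. *)
    have := @sum_connect 0 k (fun _ u => (G u <= x)%R%:R) (fun _ _ => ler0n _ _).
    rewrite (sum_word0 (fun w => \sum_(u : k.-tuple I) (G u <= x)%R%:R * (p w * p u))).
    rewrite (sum_word0 (fun w => \sum_(x0 : q.-tuple I) \sum_(u : k.-tuple I)
      (G u <= x)%R%:R * p (w ++ x0 ++ u))) p_nil.
    under eq_bigr do rewrite mul1r.
    move=> /le_trans; apply; rewrite -[leRHS](sum_p (q + k)) (sum_word_cat q k p).
    apply: ler_sum => y _; apply: ler_sum => u _ /=.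
    by rewrite ler_piMl// lern1 leq_b1.
  exact: expR_ge1Dx.
have h1 : c * (b * d) <= \sum_(w : n.-tuple I) \sum_(y : q.-tuple I)
    \sum_(u : k.-tuple I) ((positive_drift e eta n w)%:R * (G u <= x)%R%:R) *
      p (w ++ y ++ u).
  have := @sum_connect n k
    (fun w u => (positive_drift e eta n w)%:R * (G u <= x)%R%:R).
  move=> /(_ (fun _ _ => mulr_ge0 (ler0n _ _) (ler0n _ _))); apply: le_trans.
  rewrite ler_pM2l// (le_trans (_ : _ <= b * word_prob k (fun w => G w <= x)))//.
    by rewrite ler_wpM2l ?word_prob_ge0.
  rewrite mulr_suml ler_sum// => w _; rewrite mulr_sumr ler_sum// => u _.
  by rewrite mulrACA.
have h2 : b = \sum_(w : n.-tuple I) \sum_(y : q.-tuple I)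
    \sum_(u : k.-tuple I) (positive_drift e eta n w)%:R * p (w ++ y ++ u).
  apply: eq_bigr => w _; under eq_bigr do rewrite -mulr_sumr.
  rewrite -mulr_sumr; congr (_ * _).
  by rewrite -(sum_word_cat q k (fun v => p (w ++ v))) (qb_marginal qb).
(* Among the words whose first [n] letters drift, those that drift to the end and those whose last
   block has [G <= x] are disjoint; the latter have mass at least [c * (b * d)]. *)
rewrite {1}h2 lerBrDr -lerBrDl; apply: le_trans h1 _.
rewrite lerBrDl /word_prob.
rewrite (sum_word_cat3 n k (fun w => (positive_drift e eta (n + (q + k)) w)%:R * p w)).
rewrite -!big_split/= ler_sum// => w _; rewrite -!big_split/= ler_sum// => y _.
rewrite -!big_split/= ler_sum// => u _; rewrite -mulrDl.
have := p_ge0 (w ++ y ++ u); rewrite le_eqVlt => /predU1P[<-|p0].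
  by rewrite !mulr0.
rewrite ler_wpM2r// -natrM -natrD ler_nat.
case wd: (positive_drift e eta n w); last first.
  rewrite mul0n addn0 leqn0 eqb0; apply: contraFN wd => /allP h.
  apply/allP => i; rewrite mem_iota add1n ltnS => /andP[i1 ni].
  have := h i; rewrite mem_iota i1 add1n ltnS (leq_trans ni (leq_addr _ _)).
  move=> /(_ isT); rewrite takel_cat// size_tuple//.
rewrite mul1n; case: (leP (G u) x) => Gu; last by rewrite addn0 leq_b1.
rewrite addn1 ltnS leqn0 eqb0; apply/negP => /allP/(_ (n + (q + k))%N).
rewrite mem_iota add1n ltnS leqnn andbT addnA (leq_trans k0) ?leq_addl//.
move=> /(_ isT); rewrite take_oversize ?size_cat ?size_tuple ?addnA//.
move=> /lt_geF/negP; apply.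
have [w0 _] := qb_cat_gt0 p0.
have := qb_bound qb w0; rewrite size_tuple.
have := qb_cat3 _ p0; rewrite size_tuple => /(_ erefl); rewrite !ler_norml.
move=> h3 h4; apply: (@le_trans _ _ (eta * k%:R)); first by lra.
by rewrite ler_pM2l// ler_nat leq_addl.
Qed.

End quasi_Bernoulli.

(** * Lower bounds for the probability of very negative [G] *)

Section lower_tail.
Variables (R : realType) (I : finType) (p G : seq I -> R) (C K B c : R) (q : nat).
Hypothesis qb : quasi_Bernoulli p G C K B c q.

Local Notation P := (partition_sum p G).
Local Notation prob := (word_prob p).
Let p_ge0 := qb_ge0 qb.
Let c_gt0 := qb_gt0 qb.
Let gap : R := K + K + B * q%:R.

Lemma word_prob_connect n m (x y : R) :
  c * (prob n (fun w => G w <= x) * prob m (fun w => G w <= y)) <=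
    prob (n + (q + m)) (fun w => G w <= x + y + gap).
Proof.
pose Phi w u : R := (G w <= x)%R%:R * (G u <= y)%R%:R.
have Phi0 w u : 0 <= Phi w u by rewrite mulr_ge0.
have := @sum_connect _ _ _ _ _ _ _ _ _ qb n m Phi Phi0.
move=> h; apply: le_trans (le_trans h _).
  rewrite ler_pM2l// mulr_suml ler_sum// => w _; rewrite mulr_sumr ler_sum// => u _.
  by rewrite mulrACA.
rewrite /word_prob (sum_word_cat3 q n m
  (fun w => (G w <= x + y + gap)%R%:R * p w)).
apply: ler_sum => w _; apply: ler_sum => z _; apply: ler_sum => u _.
have := p_ge0 (w ++ z ++ u); rewrite le_eqVlt => /predU1P[<-|w0].
  by rewrite !mulr0.
rewrite ler_wpM2r// /Phi -natrM mulnb ler_nat.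
case: andP => // -[Gw Gu]; rewrite lt0b.
have := qb_cat3 qb _ w0; rewrite size_tuple => /(_ erefl).
rewrite -/gap ler_norml; lra.
Qed.

(** By contradiction. If all tails beyond [L] were below [D * expR (- (sig * x))], slicing by the
    integer part of [- G] would bound the part of [P s n] with [G < - X] by a geometric series of
    ratio [r], at most [c1 / 4] for large [X] and all [n]. The part with [G >= - X] is at most
    [expR ((s - t) * X) * P t n], which is made at most [c1 / 4] by choosing [n] after [X]. Together
    they fall short of [c1]. *)
Lemma word_prob_heavy_tail (t s sig c1 L D : R) :
  t < s -> 0 < s -> s < sig -> 0 < c1 -> (forall n, c1 <= P s n) ->
  0 < D -> (forall e : R, 0 < e -> exists n, P t n <= e) ->
  exists n (x : R), L <= x /\ D * expR (- (sig * x)) <= prob n (fun w => G w <= - x).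
Proof.
move=> ts s0 ssig c10 Ps D0 Pt.
apply: contrapT => /forallNP h.
have {}h n x : L <= x -> prob n (fun w => G w <= - x) <= D * expR (- (sig * x)).
  move=> Lx; have /forallNP/(_ x)/not_andP[//|/negP] := h n.
  by rewrite -ltNge => /ltW.
pose r := expR (- (sig - s)).
have r01 : 0 < r < 1 by rewrite expR_gt0 expR_lt1 oppr_lt0 subr_gt0.
have e0 : 0 < c1 / 4 * ((1 - r) / (D * expR s)).
  by rewrite mulr_gt0 ?divr_gt0 ?mulr_gt0 ?expR_gt0//; lra.
have ss0 : 0 < sig - s by rewrite subr_gt0.
have [x0 x00 x0P] := expR_decay ss0 e0.
pose X := (Num.truncn (Num.max x0 (Num.max 0 L))).+1.
have : Num.max x0 (Num.max 0 L) <= X%:R by rewrite ltW// truncnS_gt.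
rewrite !ge_max => /and3P[x0X _ LX].
have {x0P}x0P := x0P _ x0X.
have eX : 0 < c1 / 4 / expR ((s - t) * X%:R) by rewrite !divr_gt0 ?expR_gt0.
have [n nP] := Pt _ eX.
(* [- G w < M] for every word of length [n] and positive mass, so finitely many slices suffice. *)
pose M := (Num.truncn (`|B| * n%:R)).+1.
have MP : `|B| * n%:R <= M%:R by rewrite ltW// truncnS_gt.
have : P s n <= expR ((s - t) * X%:R) * P t n +
    \sum_(X <= j < M) expR (s * j.+1%:R) * prob n (fun w => G w <= - j%:R).
  have -> : \sum_(X <= j < M) expR (s * j.+1%:R) * prob n (fun w => G w <= - j%:R) =
    \sum_(w : n.-tuple I) \sum_(X <= j < M) expR (s * j.+1%:R) *
      ((G w <= - j%:R)%R%:R * p w).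
    by rewrite exchange_big/=; apply: eq_bigr => j _; rewrite mulr_sumr.
  rewrite mulr_sumr -big_split/=; apply: ler_sum => w _.
  have := p_ge0 w; rewrite le_eqVlt => /predU1P[<-|w0].
    rewrite !mulr0 add0r sumr_ge0// => j _; by rewrite !mulr0.
  have [XG|GX] := leP (- X%:R) (G w).
    rewrite ler_wpDr//.
      by rewrite sumr_ge0// => j _; rewrite mulr_ge0 ?expR_ge0 ?mulr_ge0.
    rewrite mulrA ler_wpM2r// -expRD ler_expR.
    have := ler_wpM2l (ltW (_ : 0 < s - t)) XG; rewrite subr_gt0 => /(_ ts); lra.
  rewrite ler_wpDl ?mulr_ge0 ?expR_ge0//.
  pose j := Num.truncn (- G w).
  have G0 : 0 <= - G w by rewrite (le_trans (ler0n _ X))// lerNr ltW.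
  have /andP[j1 j2] := truncn_itv G0.
  have Xj : (X <= j)%N by rewrite truncn_ge_nat// lerNr ltW.
  have jM : (j < M)%N.
    rewrite ltnS le_truncn//.
    have := qb_bound qb w0; rewrite size_tuple => Gb.
    apply: le_trans (_ : `|G w| <= _); first by rewrite -normrN ler_norm.
    by apply: le_trans Gb _; rewrite ler_wpM2r// ler_norm.
  rewrite (bigD1_seq j) ?mem_index_iota ?Xj ?iota_uniq//=.
  rewrite ler_wpDr//.
    by rewrite sumr_ge0// => i _; rewrite mulr_ge0 ?expR_ge0 ?mulr_ge0.
  rewrite mulrA ler_wpM2r// lerNr j1 mulr1 ler_expR -mulrN.
  by rewrite ler_wpM2l ?(ltW s0)// ltW.
rewrite leNgt => /negP; apply.
apply: lt_le_trans (Ps n).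
have h1 : expR ((s - t) * X%:R) * P t n <= c1 / 4.
  by rewrite mulrC -ler_pdivlMr ?expR_gt0.
suff h2 : \sum_(X <= j < M) expR (s * j.+1%:R) * prob n (fun w => G w <= - j%:R)
    <= c1 / 4 by lra.
have h3 j : (X <= j)%N -> expR (s * j.+1%:R) * prob n (fun w => G w <= - j%:R) <=
   D * expR s * expR (- ((sig - s) * X%:R)) * r ^+ (j - X).
  move=> Xj; have Lj : L <= j%:R by rewrite (le_trans LX)// ler_nat.
  apply: le_trans (ler_wpM2l (expR_ge0 _) (h n _ Lj)) _.
  rewrite /r -expRM_natr mulrCA -!mulrA ler_pM2l// -!expRD ler_expR natrB//.
  by rewrite -natr1; lra.
apply: (@le_trans _ _ (\sum_(X <= j < M)
    D * expR s * expR (- ((sig - s) * X%:R)) * r ^+ (j - X))).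
  by rewrite big_nat [leRHS]big_nat ler_sum// => j /andP[Xj _]; exact: h3.
rewrite -mulr_sumr.
have -> : \sum_(X <= j < M) r ^+ (j - X) = \sum_(0 <= j < M - X) r ^+ j.
  have := big_addn 0 M X xpredT (fun j => r ^+ (j - X)); rewrite add0n => ->.
  by under eq_bigr do rewrite addnK.
have geo m : \sum_(0 <= j < m) r ^+ j <= (1 - r)^-1.
  rewrite -[leRHS]mul1r ler_pdivlMr ?subr_gt0; last by case/andP: r01.
  rewrite big_mkord mulrC -opprB mulNr -subrX1 opprB lerBlDr lerDl.
  by rewrite exprn_ge0// ltW//; case/andP: r01.
apply: le_trans (ler_wpM2l _ (geo _)) _.
  by rewrite !mulr_ge0 ?expR_ge0// ltW.
rewrite ler_pdivrMr; last lra.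
rewrite mulrC -ler_pdivlMr ?mulr_gt0 ?expR_gt0//.
by rewrite -mulrA.
Qed.

(* One block whose probability beats [exp (- sig * x)] by a large factor is
   concatenated with itself until the level is reached. *)
Lemma word_prob_lower_tail (t s sig c1 : R) :
  t < s -> 0 < s -> s < sig -> 0 < c1 -> (forall n, c1 <= P s n) ->
  (forall e : R, 0 < e -> exists n, P t n <= e) ->
  exists2 d : R, 0 < d & forall x : R, 0 <= x -> exists n,
    d * expR (- (sig * x)) <= prob n (fun w => G w <= - x).
Proof.
move=> ts s0 ssig c10 Ps Pt.
(* This factor pays for each concatenation: [c] for the connecting word in probability and [gap] in
   level, whence the net gain [y = z - gap] per block. *)
have D0 : 0 < expR (sig * gap) / c by rewrite divr_gt0 ?expR_gt0.
have [n [z [zP nP]]] := word_prob_heavy_tail (gap + 1) ts s0 ssig c10 Ps D0 Pt.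
pose y := z - gap.
have y0 : 0 < y by rewrite /y; lra.
have yP : c^-1 * expR (- (sig * y)) <= prob n (fun w => G w <= - (y + gap)).
  rewrite /y subrK; apply: le_trans nP; rewrite (mulrC _ c^-1) -mulrA -expRD.
  by rewrite ler_pM2l ?invr_gt0// ler_expR; lra.
have step k : exists m, expR (- (sig * (k%:R * y))) <=
    prob m (fun w => G w <= - (k%:R * y)).
  elim: k => [|k [m IHk]].
    exists 0%N; rewrite mul0r mulr0 oppr0 expR0 /word_prob.
    rewrite (sum_word0 (fun w => (G w <= 0)%R%:R * p w)) (qb_nil qb).
    by rewrite (qb_nil0 qb) lexx mulr1.
  exists (m + (q + n))%N.
  have -> : - (k.+1%:R * y) = - (k%:R * y) + - (y + gap) + gap.
    by rewrite -natr1; ring.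
  apply: le_trans (word_prob_connect _ _ _ _).
  have -> : expR (- (sig * (k.+1%:R * y))) = c * (expR (- (sig * (k%:R * y)))
      * (c^-1 * expR (- (sig * y)))).
    rewrite -natr1 mulrDl mul1r mulrDr opprD expRD; field.
    by rewrite gt_eqF.
  rewrite ler_pM2l// ler_pM ?expR_ge0// mulr_ge0 ?expR_ge0// invr_ge0 ltW//.
exists (expR (- (sig * y))); first exact: expR_gt0.
move=> x x0; pose k := (Num.truncn (x / y)).+1.
have xk : x <= k%:R * y by rewrite -ler_pdivrMr// ltW// truncnS_gt.
have kx : k%:R * y <= x + y.
  rewrite /k -natr1 mulrDl mul1r lerD2r -ler_pdivlMr// truncn_le.
  by rewrite divr_ge0// ltW.
have [m mP] := step k; exists m; apply: le_trans (le_trans mP _).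
  by rewrite -expRD ler_expR; have := ler_wpM2l (ltW (lt_trans s0 ssig)) kx; lra.
by apply: (le_word_prob qb) => w _ _ /le_trans; apply; rewrite lerN2.
Qed.

End lower_tail.

(** * The fibre function *)
Lemma has_deriv_within_approx (R : realType) (D : set R) (f : R -> R) (x l e : R) :
  has_deriv_within D f x l -> 0 < e -> exists2 d : R, 0 < d &
    forall y, D y -> `|y - x| < d -> `|f y - f x - l * (y - x)| <= e * `|y - x|.
Proof.
move=> fl e0; move: fl => /cvgrPdist_le/(_ _ e0)[d /= d0 dP]; exists d => // y Dy yx.
have [->|yx0] := eqVneq y x; first by rewrite !subrr mulr0 subrr !normr0 mulr0.
have := dP y; rewrite /ball /= distrC => /(_ yx yx0 Dy).
have xy : y - x != 0 by rewrite subr_eq0.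
rewrite -(ler_pM2r (_ : 0 < `|y - x|)) ?normr_gt0// -normrM mulrBl divfK//.
by rewrite distrC.
Qed.

Section fibre.
Variables (R : realType) (a : R) (h : R -> R).
Hypotheses (a0 : 0 < a) (ah : fibre_function a h).

Lemma fibre0 : h 0 = 0. Proof. by case: ah. Qed.

Lemma fibre_le_homo x y : 0 <= x -> x <= y -> y <= a -> h x <= h y.
Proof.
move=> x0 xy ya; have [hmono _ _ _] := ah.
move: xy; rewrite le_eqVlt => /predU1P[->//|xy]; apply/ltW/hmono => //.
  by rewrite in_itv/= x0 (le_trans (ltW xy)).
by rewrite in_itv/= ya (le_trans x0 (ltW xy)).
Qed.

Lemma fibre_ge0 x : 0 <= x -> x <= a -> 0 <= h x.
Proof. by move=> x0 xa; rewrite -fibre0 fibre_le_homo. Qed.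

Lemma fibre_scale t x : 0 <= t -> t <= 1 -> 0 <= x -> x <= a ->
  t * h x <= h (t * x).
Proof.
move=> t0 t1 x0 xa; have [_ hconc h00 _] := ah.
have x_in : x \in [set` `[0, a]%R] by rewrite inE /= in_itv/= x0.
have z_in : 0 \in [set` `[0, a]%R] by rewrite inE /= in_itv/= lexx ltW.
have := hconc (Itv01 t0 t1) x 0 x_in z_in.
rewrite convRE /= /conv/= h00 oppr0 mulr0 addr0 mulrN lerN2.
by rewrite /GRing.scale/= mulr0 addr0.
Qed.

(** Concavity and [h 0 = 0] make [h x / x] non-increasing, and its limit at [0] is [h'(0) = 1]; the
    quotient is compared with the one at [t * x] for a small [t]. *)
Lemma fibre_le x : 0 <= x -> x <= a -> h x <= x.
Proof.
move=> x0 xa; have [_ _ h00 [dh [dhP _ dh0]]] := ah.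
move: x0; rewrite le_eqVlt => /predU1P[<-|x0]; first by rewrite h00.
apply/ler_addgt0Pr => e e0.
have z_in : (0 : R) \in `[0, a] by rewrite in_itv/= lexx ltW.
have [d d0 dP] := has_deriv_within_approx (dhP _ z_in) (divr_gt0 e0 x0).
pose t := Num.min 1 (d / 2 / x).
have t0 : 0 < t by rewrite lt_min ltr01 !divr_gt0.
have t1 : t <= 1 by rewrite ge_min lexx.
have tx : t * x < d.
  apply: (@le_lt_trans _ _ (d / 2)); last by rewrite ltr_pdivrMr// ltr_pMr// ltr1n.
  by rewrite -ler_pdivlMr// ge_min lexx orbT.
have tx0 : 0 < t * x by rewrite mulr_gt0.
have := dP (t * x); rewrite /= in_itv/= (ltW tx0) subr0 (gtr0_norm tx0).
rewrite (le_trans _ xa) ?ler_piMl// ?(ltW x0)// => /(_ isT tx).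
rewrite h00 dh0 subr0 mul1r ler_distl => /andP[_ htx].
have := le_trans (fibre_scale (ltW t0) t1 (ltW x0) xa) htx.
rewrite (_ : e / x * (t * x) = t * e); last by field; rewrite gt_eqF.
by rewrite -mulrDr ler_pM2l.
Qed.

(** The tangent at [x] lies above the graph at [0], so [x * h'(x) <= h x]; the Hoelder bound on [h']
    together with [h'(0) = 1] does the rest. The tangent is approached by chords from [x] to
    [(1 - t) * x]. *)
Lemma fibre_ge : exists al C : R, [/\ 0 < al, 0 <= C &
  forall x, 0 < x -> x <= a -> x * (1 - C * x `^ al) <= h x].
Proof.
have [_ _ h00 [dh [dhP [al [C [/andP[al0 _] C0 dhC]]] dh0]]] := ah.
exists al, C; split=> // x x0 xa; apply/ler_addgt0Pr => e e0.
have x_in : x \in `[0, a] by rewrite in_itv/= (ltW x0).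
have [d d0 dP] := has_deriv_within_approx (dhP _ x_in) (divr_gt0 e0 x0).
pose t := Num.min 1 (d / 2 / x).
have t0 : 0 < t by rewrite lt_min ltr01 !divr_gt0.
have t1 : t <= 1 by rewrite ge_min lexx.
have tx : t * x < d.
  apply: (@le_lt_trans _ _ (d / 2)); last by rewrite ltr_pdivrMr// ltr_pMr// ltr1n.
  by rewrite -ler_pdivlMr// ge_min lexx orbT.
have tx0 : 0 < t * x by rewrite mulr_gt0.
have x1 : (1 - t) * x - x = - (t * x) by ring.
have := dP ((1 - t) * x); rewrite /= in_itv/= x1 normrN (gtr0_norm tx0).
have -> : 0 <= (1 - t) * x <= a.
  by rewrite mulr_ge0 ?subr_ge0 ?(ltW x0)//= (le_trans _ xa)// ler_piMl ?(ltW x0)//; lra.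
move=> /(_ isT tx).
have t10 : 0 <= 1 - t by lra.
have t11 : 1 - t <= 1 by lra.
have := fibre_scale t10 t11 (ltW x0) xa.
rewrite (_ : e / x * (t * x) = t * e); last by field; rewrite gt_eqF.
move=> h1; rewrite ler_distl => /andP[h2 h3].
have h4 : t * (dh x * x) <= t * (h x + e) by lra.
rewrite ler_pM2l// in h4; apply: le_trans h4; rewrite mulrC ler_pM2r//.
have := dhC 0 x; rewrite sub0r normrN (gtr0_norm x0) /= !in_itv/= lexx (ltW x0) xa (ltW a0).
by move=> /(_ isT isT); rewrite dh0 ler_distl; lra.
Qed.

Variables (S : T1 R -> T1 R) (g : T1 R -> R).
Hypotheses (g0 : forall v, 0 < g v) (ga : forall v, g v * h a <= a).

Local Notation phi := (fibre_iter S g h).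
Local Notation gprod := (birkhoff_prod S g).

Lemma fibre_iter_itv n v x : 0 <= x -> x <= a -> 0 <= phi n v x <= a.
Proof.
move=> x0 xa; elim: n v => [|n IHn] v /=; first by rewrite x0.
have /andP[h0 h1] := IHn (S v).
rewrite mulr_ge0 ?fibre_ge0 ?(ltW (g0 _))//=; apply: le_trans (ga (S v)).
by rewrite ler_pM2l// fibre_le_homo.
Qed.

Lemma fibre_iter_nonincreasing v : nonincreasing_seq (fun n => phi n v a).
Proof.
apply/nonincreasing_seqP => n; elim: n v => [|n IHn] v; first exact: ga.
have /andP[h0 _] := fibre_iter_itv n.+1 (S v) (ltW a0) (lexx a).
have /andP[_ h1] := fibre_iter_itv n (S v) (ltW a0) (lexx a).
apply: (@le_trans _ _ (g (S v) * h (phi n.+1 (S v) a))) => //.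
by rewrite [leRHS]/= ler_pM2l// fibre_le_homo.
Qed.

Lemma fibre_iter_cvg v : cvgn (fun n => phi n v a).
Proof.
apply: nonincreasing_is_cvgn; first exact: fibre_iter_nonincreasing.
exists 0 => _ [n _ <-].
by have /andP[] := fibre_iter_itv n v (ltW a0) (lexx a).
Qed.

Lemma phi_infty_le n v : phi_infty S g a h v <= phi n v a.
Proof.
apply: (nonincreasing_cvgn_ge (fibre_iter_nonincreasing v)).
exact: fibre_iter_cvg.
Qed.

Lemma phi_infty_ge0 v : 0 <= phi_infty S g a h v.
Proof.
apply: limr_ge; first exact: fibre_iter_cvg.
by apply: nearW => n; have /andP[] := fibre_iter_itv n v (ltW a0) (lexx a).
Qed.

Lemma birkhoff_prodS n v : gprod n.+1 v = gprod n v * g (iter n.+1 S v).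
Proof. by rewrite /birkhoff_prod big_nat_recr. Qed.

Lemma birkhoff_prod_recl n v : gprod n.+1 v = g (S v) * gprod n (S v).
Proof.
rewrite /birkhoff_prod big_nat_recl//=; congr (_ * _).
by apply: eq_bigr => i _; rewrite -iterS iterSr.
Qed.

Lemma birkhoff_prod_gt0 n v : 0 < gprod n v.
Proof. by apply: prodr_gt0. Qed.

Lemma fibre_iter_le n v : phi n v a <= a * gprod n v.
Proof.
elim: n v => [|n IHn] v /=.
  by rewrite /birkhoff_prod big_geq// mulr1.
rewrite birkhoff_prod_recl mulrCA ler_pM2l//.
have /andP[h0 h1] := fibre_iter_itv n (S v) (ltW a0) (lexx a).
exact: le_trans (fibre_le h0 h1) _.
Qed.

(* [x_k = eps * (2 - b ^ k) / g_k] is a subsolution along the orbit of [v]: the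
   growth of the middle factor pays for the nonlinearity of [h]. *)
Lemma phi_infty_ge theta : 0 < theta -> exists2 A : R, 0 < A &
  forall eps v, 0 < eps ->
  (forall k, (0 < k)%N -> eps * A * expR (theta * k%:R) <= gprod k v) ->
  eps <= phi_infty S g a h v.
Proof.
move=> th0; have [al [C [al0 C0 hge]]] := fibre_ge.
pose b := expR (- (theta * al)).
have b01 : 0 < b < 1 by rewrite expR_gt0 expR_lt1 oppr_lt0 mulr_gt0.
have [b0 b1] := andP b01.
have k0 : 0 < (1 - b) / (2 * C + 1) by rewrite divr_gt0//; lra.
(* [kap] is chosen so that the nonlinear loss at step [j], at most [2 * C * kap ^ al * b ^ j], is
   covered by the growth [c (j+1) - c j = b ^ j * (1 - b)]. The value [A = 2 / kap] below then
   forces [x k <= kap * expR (- (theta * k))], because [c k <= 2]. *)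
pose kap := Num.min a (((1 - b) / (2 * C + 1)) `^ al^-1).
have kap0 : 0 < kap by rewrite lt_min a0 powR_gt0.
have kapa : kap <= a by rewrite ge_min lexx.
have kapP : 2 * C * kap `^ al <= 1 - b.
  apply: (@le_trans _ _ (2 * C * ((1 - b) / (2 * C + 1)))).
    rewrite ler_wpM2l ?mulr_ge0//.
    have e : (1 - b) / (2 * C + 1) = (((1 - b) / (2 * C + 1)) `^ al^-1) `^ al.
      by rewrite -powRrM mulVf ?lt0r_neq0// powRr1 ?ltW.
    rewrite [leRHS]e ge0_ler_powR ?nnegrE ?powR_ge0 ?(ltW al0) ?(ltW kap0)//.
    by rewrite ge_min lexx orbT.
  rewrite mulrCA ler_piMr ?subr_ge0 ?(ltW b1)// ler_pdivrMr ?mul1r; lra.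
exists (2 / kap); first by rewrite divr_gt0.
move=> eps v eps0 gk.
pose c k : R := 2 - b ^+ k.
have c1 k : 1 <= c k.
  have : b ^+ k <= 1 by rewrite exprn_ile1 ?ltW.
  by rewrite /c; lra.
have c2 k : c k <= 2 by rewrite /c lerBlDr lerDl exprn_ge0 ?ltW.
pose x k := eps * c k / gprod k v.
have x0 k : 0 < x k.
  by rewrite divr_gt0 ?birkhoff_prod_gt0// mulr_gt0// (lt_le_trans ltr01).
have xk k : (0 < k)%N -> x k <= kap * expR (- (theta * k%:R)).
  move=> /gk gk0; rewrite /x ler_pdivrMr ?birkhoff_prod_gt0//.
  apply: le_trans (ler_wpM2l _ gk0); last by rewrite mulr_ge0 ?expR_ge0 ?(ltW kap0).
  rewrite [leRHS](_ : _ = eps * 2 * (expR (- (theta * k%:R)) * expR (theta * k%:R))).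
    by rewrite -expRD addNr expR0 mulr1 ler_pM2l.
  by field; rewrite gt_eqF.
have xa k : (0 < k)%N -> x k <= a.
  move=> /xk /le_trans; apply; apply: le_trans kapa.
  by rewrite ler_piMr ?(ltW kap0)// -expR0 ler_expR oppr_le0 mulr_ge0// ltW.
have xh j : x j <= g (iter j.+1 S v) * h (x j.+1).
  apply: le_trans (ler_wpM2l (ltW (g0 _)) (hge _ (x0 _) (xa j.+1 isT))).
  rewrite {1}/x ler_pdivrMr ?birkhoff_prod_gt0//.
  have -> : g (iter j.+1 S v) * (x j.+1 * (1 - C * x j.+1 `^ al)) * gprod j v =
      eps * (c j.+1 * (1 - C * x j.+1 `^ al)).
    rewrite {1}/x birkhoff_prodS; field.
    by rewrite !gt_eqF ?birkhoff_prod_gt0.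
  rewrite ler_pM2l// mulrBr mulr1 lerBrDl -lerBrDr.
  have -> : c j.+1 - c j = b ^+ j * (1 - b) by rewrite /c exprS; ring.
  have xal : x j.+1 `^ al <= kap `^ al * b ^+ j.
    apply: (@le_trans _ _ ((kap * expR (- (theta * j.+1%:R))) `^ al)).
      apply: (ge0_ler_powR (ltW al0)); last exact: xk.
        by rewrite nnegrE ltW.
      by rewrite nnegrE mulr_ge0 ?expR_ge0 ?(ltW kap0).
    rewrite powRM ?expR_ge0 ?(ltW kap0)// ler_wpM2l ?powR_ge0//.
    rewrite -expRM /b -expRM_natr ler_expR -natr1.
    have := mulr_gt0 th0 al0; lra.
  apply: (@le_trans _ _ (2 * (C * (kap `^ al * b ^+ j)))).
    apply: ler_pM => //; last by rewrite ler_wpM2l.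
      by rewrite (le_trans ler01).
    by rewrite mulr_ge0 ?powR_ge0.
  by rewrite !mulrA mulrC ler_wpM2l ?exprn_ge0 ?(ltW b0).
(* At [n = 0] the claim is [x j <= a], which is available only for [0 < j]; hence the condition
   [0 < j + n]. *)
have xphi n j : (0 < j + n)%N -> x j <= phi n (iter j S v) a.
  elim: n j => [|n IHn] j /=; first by rewrite addn0 => /xa.
  move=> _; apply: le_trans (xh j) _; rewrite -iterS ler_pM2l//.
  have /andP[h0 h1] := fibre_iter_itv n (iter j.+1 S v) (ltW a0) (lexx a).
  by rewrite fibre_le_homo ?(ltW (x0 _)) ?IHn.
have -> : eps = x 0%N.
  by rewrite /x /c /birkhoff_prod big_geq// expr0 divr1; ring.
apply: limr_ge; first exact: fibre_iter_cvg.
by exists 1%N => // n /= n1; rewrite (xphi n 0%N).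
Qed.

End fibre.

(** * The circle *)
Section circle_topology.
Variable R : realType.
Implicit Types (x y z p q : R) (V : set R).

(** This and the next lemma sharpen strict inequalities between integers into a form usable by
    linear real arithmetic. *)
Lemma int_lt1 (i : int) : (i%:~R < 1 :> R) = (i%:~R <= 0 :> R).
Proof. by rewrite ltrz1 lerz0 -ltzD1 add0r. Qed.

Lemma int_gt0 (i : int) : (0 < i%:~R :> R) = (1 <= i%:~R :> R).
Proof. by rewrite ltr0z ler1z gtz0_ge1. Qed.

Lemma circ_eqP x y : circ x = circ y <-> exists i : int, x = y + i%:~R.
Proof.
split=> [/eqquotP /= /intrP[i xy]|[i ->]].
  by exists i; rewrite -xy addrC subrK.
by apply/eqquotP; rewrite /= /eq_mod1 addrC addKr intr_int.
Qed.

Lemma circD_int x (i : int) : circ (x + i%:~R) = circ x.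
Proof. by apply/circ_eqP; exists i. Qed.

Lemma circ_surj (v : T1 R) : exists x, v = circ x.
Proof. by exists (repr v); rewrite /circ reprK. Qed.

Lemma circ_surj_itv (v : T1 R) z : exists2 x, z <= x < z + 1 & v = circ x.
Proof.
have [x ->] := circ_surj v; exists (x - (Num.floor (x - z))%:~R).
  by have := floor_itv (x - z); rewrite intrD; lra.
by apply/circ_eqP; exists (Num.floor (x - z)); rewrite subrK.
Qed.

Lemma open_circP (U : set (T1 R)) : open U <-> open (circ @^-1` U).
Proof. by []. Qed.

Lemma circ_continuous : continuous (@circ R).
Proof. exact: pi_continuous. Qed.

Lemma open_circ_image V : open V -> open (circ @` V).
Proof.
move=> oV; apply/open_circP.
have -> : circ @^-1` (circ @` V) =
    \bigcup_(i in [set: int]) ((fun x => x + i%:~R) @^-1` V).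
  apply/seteqP; split=> [x /= [y Vy /circ_eqP[i yx]]|x [i _ Vx]].
    by exists i => //=; rewrite -yx.
  by exists (x + i%:~R) => //; rewrite circD_int.
apply: bigcup_open => i _; apply: open_comp => // x _.
by apply: cvgD; [exact: cvg_id|exact: cvg_cst].
Qed.

Lemma open_circ_compl1 x : open (~` [set circ x]).
Proof.
apply/open_circP; rewrite openE => y /= yx.
have [//|i0] := pselect (exists i : int, y = x + i%:~R).
  by move/circ_eqP.
pose f := Num.floor (y - x).
have := floor_itv (y - x); rewrite -/f => /andP[f1 f2].
have f3 : f%:~R < y - x.
  rewrite lt_neqAle f1 andbT; apply/eqP => f3; apply: i0; exists f.
  by rewrite f3 addrC subrK.
pose e := Num.min (y - x - f%:~R) ((f + 1)%:~R - (y - x)).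
have e0 : 0 < e by rewrite lt_min !subr_gt0 f3.
exists e => //= z; rewrite /ball /= => yz /circ_eqP[i zi].
move: yz; rewrite lt_min zi => /andP[h1 h2].
have h3 : f%:~R < i%:~R :> R by move: h1; rewrite ltr_distlC; lra.
have h4 : i%:~R < (f + 1)%:~R :> R by move: h2; rewrite ltr_distlC; lra.
by move: h3 h4; rewrite !ltr_int ltzD1 => /lt_geF ->.
Qed.

Lemma measurable_open_T1 (U : set (T1 R)) : open U -> measurable U.
Proof. exact: sub_sigma_algebra. Qed.

Lemma measurable_T1_1 (v : T1 R) : measurable [set v].
Proof.
have [x ->] := circ_surj v; rewrite -[[set _]]setCK; apply: measurableC.
by apply: measurable_open_T1; exact: open_circ_compl1.
Qed.

Lemma measurable_T1_finite (A : set (T1 R)) : finite_set A -> measurable A.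
Proof.
move=> fA; apply: countable_measurable => [v|]; first exact: measurable_T1_1.
exact: finite_set_countable.
Qed.

Lemma lebesgueT_setT : lebesgueT [set: T1 R] = 1%:E.
Proof.
rewrite /lebesgueT /pushforward /mrestr preimage_setT setTI.
by rewrite lebesgue_measure_itv/= lte_fin ltr01 oppr0 adde0.
Qed.

Lemma lebesgueT_set1 (v : T1 R) : lebesgueT [set v] = 0%E.
Proof.
have [x /andP[x0 x1] ->] := circ_surj_itv v 0.
rewrite add0r in x1.
rewrite /lebesgueT /pushforward /mrestr -(lebesgue_measure_set1 x).
congr (lebesgue_measure _); apply/seteqP; split=> [y|y ->] /=; last first.
  by split => //; rewrite in_itv/= x0.
move=> [/circ_eqP[i yx]]; rewrite in_itv/= => /andP[y0 y1].
have i0 : i%:~R <= 0 :> R by rewrite -int_lt1; lra.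
have i1 : (- i)%:~R <= 0 :> R by rewrite -int_lt1 intrN; lra.
by move: i1; rewrite intrN yx; lra.
Qed.

Lemma lebesgueT_finite (A : set (T1 R)) : finite_set A -> lebesgueT A = 0%E.
Proof.
move=> fA; rewrite -[A]image_id -bigcup_imset1 measure_fin_bigcup//.
- by rewrite fsbig1// => v _; exact: lebesgueT_set1.
- by move=> u v _ _ [w [-> ->]].
- by move=> v _; exact: measurable_T1_1.
Qed.

Lemma lebesgueT_arc p q : p < q -> q <= p + 1 ->
  lebesgueT (circ @` `]p, q[) = (q - p)%:E.
Proof.
wlog /andP[p0 p1] : p q / 0 <= p < 1.
  move=> wl pq qp1; have /andP[f1 f2] := floor_itv p.
  rewrite intrD in f2.
  have -> : q - p = (q - (Num.floor p)%:~R) - (p - (Num.floor p)%:~R) by ring.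
  rewrite -wl; [|lra..].
  congr lebesgueT; apply/seteqP; split=> _ [y yI <-] /=.
    exists (y - (Num.floor p)%:~R); last by rewrite -intrN circD_int.
    by move: yI; rewrite /= !in_itv/=; lra.
  exists (y + (Num.floor p)%:~R); last by rewrite circD_int.
  by move: yI; rewrite /= !in_itv/=; lra.
move=> pq qp1.
rewrite /lebesgueT /pushforward /mrestr.
have [q1|q1] := leP q 1.
  have -> : circ @^-1` (circ @` `]p, q[) `&` `[0, 1[ = `]p, q[%classic.
    apply/seteqP; split=> [y [/= [x xI /circ_eqP[i xy]]]|y /= yI].
      move: xI; rewrite /= !in_itv/= => /andP[px xq] /andP[y0 y1].
      have i0 : i%:~R <= 0 :> R by rewrite -int_lt1; lra.
      have i1 : (- i)%:~R <= 0 :> R by rewrite -int_lt1 intrN; lra.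
      by move: i1; rewrite intrN; lra.
    split; first by exists y.
    by move: yI; rewrite /= !in_itv/=; lra.
  by rewrite lebesgue_measure_itv/= lte_fin pq -EFinB.
(* For [1 < q] the arc wraps around [circ 0] and meets the fundamental domain in two intervals. *)
have -> : circ @^-1` (circ @` `]p, q[) `&` `[0, 1[ =
    `]p, 1[%classic `|` `[0, q - 1[%classic.
  apply/seteqP; split=> [y [/= [x xI /circ_eqP[i xy]]]|y /= yI].
    move: xI; rewrite /= !in_itv/= => /andP[px xq] /andP[y0 y1].
    have [i1|] := ltP i 1; last first.
      by rewrite -(ler_int R) => i1; right; rewrite /= ?in_itv/= y0; lra.
    left; rewrite /= ?in_itv/= y1 andbT.
    have i0 : i%:~R <= 0 :> R by rewrite -int_lt1 -[1]/(1%:~R) ltr_int.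
    by lra.
  split; last by case: yI; rewrite /= !in_itv/=; lra.
  case: yI => yI; [exists y => //|exists (y + 1%:~R); last by rewrite circD_int].
    by move: yI; rewrite /= !in_itv/=; lra.
  by move: yI; rewrite /= !in_itv/=; lra.
rewrite measureU//=; last first.
  by apply/seteqP; split=> // y [] /=; rewrite !in_itv/=; lra.
rewrite !lebesgue_measure_itv/= !lte_fin p1 subr_gt0 q1 -!EFinB -EFinD.
by congr EFin; ring.
Qed.

Lemma itv_open_shape V : is_interval V -> V !=set0 ->
  (forall x, V x -> exists2 y, V y & x < y) ->
  (forall x, V x -> exists2 y, V y & y < x) ->
  (forall x y, V x -> V y -> y < x + 1) ->
  exists p q, [/\ p < q, q <= p + 1 & V = `]p, q[%classic].
Proof.
move=> Vi [x0 Vx0] Vup Vlow V1.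
have ub : has_ubound V by exists (x0 + 1) => y Vy; apply/ltW/V1.
have lb : has_lbound V.
  by exists (x0 - 1) => y Vy; rewrite lerBlDr; apply/ltW/V1.
have hs : has_sup V by split => //; exists x0.
have hi : has_inf V by split => //; exists x0.
exists (inf V), (sup V).
have VE : V = `]inf V, sup V[%classic.
  apply/seteqP; split=> [x Vx|x] /=; rewrite in_itv/=.
    have [y Vy xy] := Vup _ Vx; have [z Vz zx] := Vlow _ Vx.
    rewrite (lt_le_trans xy) ?ub_le_sup// andbT.
    by rewrite (le_lt_trans _ zx) ?ge_inf.
  move=> /andP[ix xs].
  have [y Vy yx] := inf_lt hi.1 ix; have [z Vz xz] := sup_gt hs.1 xs.
  by apply: (Vi y z) => //; rewrite (ltW yx) (ltW xz).
split => //; first by move: Vx0; rewrite {1}VE /= in_itv/= => /andP[]; exact: lt_trans.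
apply: ge_sup; first by exists x0.
move=> y Vy; rewrite -lerBlDr; apply: lb_le_inf; first by exists x0.
by move=> z Vz; rewrite lerBlDr ltW// V1.
Qed.

Lemma arc_chart_lt1 V x y : arc_chart V -> V x -> V y -> y < x + 1.
Proof.
move=> [Vi Vinj _] Vx Vy; rewrite ltNge; apply/negP => xy.
have Vx1 : V (x + 1) by apply: (Vi x y) => //; rewrite lerDl ler01.
have := Vinj x (x + 1); rewrite !inE => /(_ Vx Vx1).
by rewrite (circD_int x 1) => /(_ erefl); lra.
Qed.

(** If [x] were the maximum, openness would place points just to the right of [x], modulo 1, inside
    [V], hence at least one unit further left. So [V] would reach down arbitrarily close to [x - 1]
    and cover the whole circle, which [arc_chart] forbids. *)
Lemma arc_chart_nomax V x : arc_chart V -> open (circ @` V) -> V x ->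
  exists2 y, V y & x < y.
Proof.
move=> [Vi Vinj VT] oV Vx; apply: contrapT => nV.
have {nV}xmax y : V y -> y <= x.
  by move=> Vy; rewrite leNgt; apply/negP => xy; apply: nV; exists y.
have /open_circP := oV; rewrite openE => /(_ x)[]; first by exists x.
move=> e /= e0 eV; suff : circ @` V = setT by apply/eqP.
rewrite -subTset => v _.
have [t /andP[t1 t2] ->] := circ_surj_itv v (x - 1).
have {t2}t2 : t < x by lra.
have [->|tx] := eqVneq t (x - 1).
  by exists x => //; apply/circ_eqP; exists 1; rewrite subrK.
exists t => //.
pose z := Num.min (t + 1) (x + e / 2).
have z1 : z <= t + 1 by rewrite ge_min lexx.
have z2 : z <= x + e / 2 by rewrite ge_min lexx orbT.
have z3 : x < z.
  by rewrite lt_min; move: (lt_neqAle (x - 1) t); rewrite eq_sym tx t1; lra.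
have [|y Vy /circ_eqP[i yz]] := eV z; first by rewrite /ball/= ltr_distlC; lra.
have := xmax y Vy; rewrite yz => zi.
have i0 : i%:~R <= (-1)%:~R :> R.
  rewrite ler_int -ltzD1 addNr -(ltr_int R); lra.
apply: (Vi y x) => //; rewrite (ltW t2) andbT yz.
by move: i0; rewrite intrN; lra.
Qed.

Lemma arc_chart_nomin V x : arc_chart V -> open (circ @` V) -> V x ->
  exists2 y, V y & y < x.
Proof.
move=> [Vi Vinj VT] oV Vx; apply: contrapT => nV.
have {nV}xmin y : V y -> x <= y.
  by move=> Vy; rewrite leNgt; apply/negP => xy; apply: nV; exists y.
have /open_circP := oV; rewrite openE => /(_ x)[]; first by exists x.
move=> e /= e0 eV; suff : circ @` V = setT by apply/eqP.
rewrite -subTset => v _.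
have [t /andP[t1 t2] ->] := circ_surj_itv v x.
exists t => //.
pose z := Num.max (t - 1) (x - e / 2).
have z1 : t - 1 <= z by rewrite le_max lexx.
have z2 : x - e / 2 <= z by rewrite le_max lexx orbT.
have z3 : z < x by rewrite gt_max; lra.
have [|y Vy /circ_eqP[i yz]] := eV z; first by rewrite /ball/= ltr_distlC; lra.
have := xmin y Vy; rewrite yz => zi.
have i0 : 1 <= i%:~R :> R by rewrite -int_gt0; lra.
by apply: (Vi x y) => //; rewrite t1 /= yz; lra.
Qed.

Lemma arc_chart_open_shape V : arc_chart V -> V !=set0 -> open (circ @` V) ->
  exists p q, [/\ p < q, q <= p + 1 & V = `]p, q[%classic].
Proof.
move=> cV V0 oV; apply: itv_open_shape => //; first by case: cV.
- by move=> x; exact: arc_chart_nomax.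
- by move=> x; exact: arc_chart_nomin.
- by move=> x y; exact: arc_chart_lt1.
Qed.

(** Two local lifts differ by a continuous integer-valued function, hence by a constant near [x]; so
    the choice made by [xget] does not matter. *)
Lemma circ_deriv_eq (f : T1 R -> T1 R) (F : R -> R) x l :
  (\forall y \near x, f (circ y) = circ (F y)) -> is_derive x 1 F l ->
  circ_deriv f (circ x) = l.
Proof.
move=> fF dF; rewrite /circ_deriv; case: xgetP => [l' _|/(_ l)]; last first.
  by case; exists x, F.
move=> [x' [F' [/circ_eqP[i xx'] fF' dF']]].
pose H : R -> R := F' \o (fun y => y - i%:~R).
have dH : is_derive x 1 H l'.
  rewrite -[l']mulr1; apply: is_derive1_comp; first by rewrite xx' addrK.
  by apply: is_derive_eq; rewrite subr0.
have Hint : \forall y \near x, exists j : int, H y = F y + j%:~R.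
  have fF'x : \forall y \near x, f (circ (y - i%:~R)) = circ (H y).
    have : y - i%:~R @[y --> x] --> x'.
      rewrite -(addrK i%:~R x') -xx'.
      by apply: cvgB; [exact: cvg_id|exact: cvg_cst].
    by move=> /(_ _ fF').
  near=> y; apply/circ_eqP.
  have <- : f (circ (y - i%:~R)) = circ (H y) by near: y.
  have <- : f (circ y) = circ (F y) by near: y.
  by rewrite -intrN circD_int.
have cHF : {for x, continuous (fun y => H y - F y)}.
  by apply: continuousB; apply: differentiable_continuous; apply/derivable1_diffP.
have HF : \forall y \near x, F y + (H x - F x) = H y.
  have hx : exists j : int, H x = F x + j%:~R by exact: nbhs_singleton Hint.
  move/cvgrPdist_lt : cHF => /(_ _ ltr01) cHF.
  near=> y.
  have [j Hj] := hx.
  have [k Hk] : exists k : int, H y = F y + k%:~R by near: y.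
  (* Two integers at distance less than 1 coincide. *)
  have : `|H x - F x - (H y - F y)| < 1 by near: y.
  rewrite Hj Hk [F x + _]addrC [F y + k%:~R]addrC !addrK -intrB -intr_norm.
  rewrite -[X in _ < X]/(1%:~R) ltr_int -[1]add0r ltzD1 normr_le0 subr_eq0.
  by move=> /eqP ->; rewrite addrC.
have dH' : is_derive x 1 H l.
  apply: near_eq_is_derive HF _.
  by apply: is_derive_eq; rewrite addr0.
by rewrite -(@derive_val _ _ _ _ _ _ _ dH) (@derive_val _ _ _ _ _ _ _ dH').
Unshelve. all: by end_near. Qed.

End circle_topology.

(** * Interval diffeomorphisms *)
Section interval_diffeo.
Variable R : realType.
Implicit Types (x y z p q l : R) (V : set R) (F dF : R -> R).

Lemma is_deriveP F x l : is_derive x 1 F l <->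
  h^-1 * (F (h + x) - F x) @[h --> 0^'] --> l.
Proof.
split=> [dF|dF].
  have := @ex_derive _ _ _ _ _ _ _ dF => /cvg_ex[l' l'P].
  have -> : l = l'.
    by rewrite -(@derive_val _ _ _ _ _ _ _ dF); apply: cvg_lim.
  apply: cvg_trans l'P; apply: near_eq_cvg; near=> h.
  by rewrite /= /GRing.scale/= mulr1.
have dF' : (fun h => h^-1 *: ((F \o shift x) (h *: 1) - F x)) @ 0^' --> l.
  apply: cvg_trans dF; apply: near_eq_cvg; near=> h.
  by rewrite /= /GRing.scale/= mulr1.
split; first by apply/cvg_ex; exists l.
exact: cvg_lim dF'.
Unshelve. all: by end_near. Qed.

Lemma has_deriv_within_is_derive V F x l : nbhs x V ->
  has_deriv_within V F x l -> is_derive x 1 F l.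
Proof.
move=> Vx Fl; apply/is_deriveP/cvgrPdist_le => e e0.
have [d d0 dP] := has_deriv_within_approx Fl e0.
have [d' /= d'0 d'P] := Vx.
near=> h.
have h0 : h != 0 by near: h; exact: nbhs_dnbhs_neq.
have hd : `|h| < d.
  near: h; apply: dnbhs0_lt d0.
have hd' : `|h| < d' by near: h; apply: dnbhs0_lt d'0.
have := dP (h + x); rewrite addrK => /(_ _ hd) hP.
rewrite -(ler_pM2r (_ : 0 < `|h|)) ?normr_gt0// -normrM.
rewrite (_ : (l - _) * h = l * h - (F (h + x) - F x)); last by field.
rewrite distrC; apply: hP; apply: d'P.
by rewrite /ball /= opprD addrCA subrr addr0 normrN.
Unshelve. all: by end_near. Qed.

Lemma is_derive_has_deriv_within V F x l :
  is_derive x 1 F l -> has_deriv_within V F x l.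
Proof.
move=> /is_deriveP/cvgrPdist_le dF; apply/cvgrPdist_le => e e0.
have [d /= d0 dP] := dF _ e0.
exists d => //= y; rewrite /ball/= => xy yx Vy.
have := dP (y - x); rewrite /ball/= sub0r normrN distrC subr_eq0 subrK.
by rewrite mulrC; apply.
Qed.

Lemma itv_len_le p q (M : R) : p < q ->
  (forall y z, p < y -> y < z -> z < q -> z - y <= M) -> q - p <= M.
Proof.
move=> pq h; rewrite leNgt; apply/negP => Mqp.
have M0 : 0 <= M.
  have := h (p + (q - p) / 3) (p + (q - p) * 2 / 3); lra.
pose d := (q - p - M) / 4.
have := h (p + d) (q - d); rewrite /d; lra.
Qed.

Variables (p q : R) (F dF : R -> R).
Hypothesis pq : p < q.
Local Notation V := (`]p, q[%classic : set R).
Hypothesis FdF : forall x, V x -> is_derive x 1 F (dF x).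
Hypothesis dF0 : forall x, V x -> dF x != 0.

Lemma itv_nbhs x : V x -> nbhs x V.
Proof.
by move=> Vx; apply: open_nbhs_nbhs; split => //; exact: interval_open.
Qed.

Lemma itv_derivable_continuous x : V x -> {for x, continuous F}.
Proof.
move=> /FdF dFx; apply: differentiable_continuous; apply/derivable1_diffP.
exact: (@ex_derive _ _ _ _ _ _ _ dFx).
Qed.

Lemma itv_MVT x y : V x -> V y -> x < y ->
  exists2 xi, V xi & F y - F x = dF xi * (y - x).
Proof.
move=> Vx Vy xy.
have xyV z : x <= z <= y -> V z.
  move=> /andP[xz zy]; move: Vx Vy; rewrite /= !in_itv/= => /andP[px _] /andP[_ yq].
  by rewrite (lt_le_trans px xz) (le_lt_trans zy yq).
have dFI z : z \in `]x, y[%R -> is_derive z 1 F (dF z).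
  by rewrite in_itv/= => /andP[xz zy]; apply: FdF; apply: xyV; rewrite !ltW.
have cFI : {within `[x, y], continuous F}.
  apply: derivable_within_continuous => z; rewrite in_itv/= => zI.
  exact: (@ex_derive _ _ _ _ _ _ _ (FdF (xyV z zI))).
have [c cI Fyx] := MVT xy dFI cFI.
exists c => //; apply: xyV; move: cI; rewrite in_itv/= => /andP[xc cy].
by rewrite !ltW.
Qed.

Lemma itv_diffeo_inj : {in V &, injective F}.
Proof.
suff h x y : V x -> V y -> x < y -> F x <> F y.
  move=> x y /set_mem Vx /set_mem Vy Fxy.
  by case: (ltgtP x y) => // xy; [case: (h x y)|case: (h y x)].
move=> Vx Vy xy Fxy; have [xi Vxi] := itv_MVT Vx Vy xy.
rewrite Fxy subrr => /esym/eqP; rewrite mulf_eq0 (negbTE (dF0 Vxi)) subr_eq0.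
by rewrite gt_eqF.
Qed.

Lemma itv_diffeo_between x y z : V x -> V z -> x < y -> y < z ->
  F x < F y < F z \/ F z < F y < F x.
Proof.
move=> Vx Vz xy yz.
have Vy : V y.
  move: Vx Vz; rewrite /= !in_itv/= => /andP[px _] /andP[_ zq].
  by rewrite (lt_trans px xy) (lt_trans yz zq).
have cF : {within V, continuous F}.
  by apply: derivable_within_continuous => u uV; exact: (@ex_derive _ _ _ _ _ _ _ (FdF uV)).
have Finj : {in `]p, q[ &, injective F}.
  by move=> u w uV wV; apply: itv_diffeo_inj; rewrite inE.
have [mF|mF] := itv_continuous_inj_mono cF Finj; [left|right].
  by rewrite !mF.
by rewrite !mF.
Qed.

Lemma itv_diffeo_is_interval (W : set R) : is_interval W ->
  is_interval [set x | V x /\ W (F x)].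
Proof.
move=> Wi x y [Vx Wx] [Vy Wy] z /andP[xz zy].
move: xz zy; rewrite le_eqVlt => /predU1P[<- //|xz].
rewrite le_eqVlt => /predU1P[-> //|zy]; split.
  move: Vx Vy; rewrite /= !in_itv/= => /andP[px _] /andP[_ yq].
  by rewrite (lt_trans px xz) (lt_trans zy yq).
have [/andP[/ltW h1 /ltW h2]|/andP[/ltW h1 /ltW h2]] := itv_diffeo_between Vx Vy xz zy.
  by apply: (Wi _ _ Wx Wy); rewrite h1.
by apply: (Wi _ _ Wy Wx); rewrite h1.
Qed.

Lemma itv_diffeo_image : arc_chart (F @` V) ->
  exists p' q', [/\ p' < q', q' <= p' + 1 & F @` V = `]p', q'[%classic].
Proof.
move=> FV.
have mid x : V x -> exists x1 x2, [/\ V x1, V x2 & x1 < x < x2].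
  rewrite /= in_itv/= => /andP[px xq].
  by exists ((p + x) / 2), ((x + q) / 2); rewrite !in_itv/=; split; lra.
apply: itv_open_shape.
- by case: FV.
- exists (F ((p + q) / 2)), ((p + q) / 2) => //=.
  by rewrite in_itv/=; apply/andP; split; move: pq; lra.
- move=> _ [x Vx <-]; have [x1 [x2 [V1 V2 /andP[h1 h2]]]] := mid _ Vx.
  have [/andP[_ h]|/andP[_ h]] := itv_diffeo_between V1 V2 h1 h2.
    by exists (F x2) => //; exists x2.
  by exists (F x1) => //; exists x1.
- move=> _ [x Vx <-]; have [x1 [x2 [V1 V2 /andP[h1 h2]]]] := mid _ Vx.
  have [/andP[h _]|/andP[h _]] := itv_diffeo_between V1 V2 h1 h2.
    by exists (F x1) => //; exists x1.
  by exists (F x2) => //; exists x2.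
- by move=> x y; exact: arc_chart_lt1.
Qed.

(* Bounded distortion makes the length of the image comparable with any value of
   the derivative. *)
Lemma itv_diffeo_length (D p' q' : R) : p' < q' -> F @` V = `]p', q'[%classic ->
  (forall x y, V x -> V y -> `|dF x| <= D * `|dF y|) ->
  forall x, V x -> q' - p' <= D * ((q - p) * `|dF x|) /\
    (q - p) * `|dF x| <= D * (q' - p').
Proof.
move=> pq' FV dFD x Vx.
have D0 : 0 < D.
  have := dFD x x Vx Vx; have : 0 < `|dF x| by rewrite normr_gt0 dF0.
  move=> h0 h1; rewrite -(pmulr_lgt0 _ h0); exact: lt_le_trans h1.
have FI y : V y -> p' < F y < q'.
  move=> Vy; have : (F @` V) (F y) by exists y.
  by rewrite FV /= in_itv.
split.
  apply: itv_len_le => // u w pu uw wq.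
  have [y Vy yu] : (F @` V) u by rewrite FV /= in_itv/= pu (lt_trans uw wq).
  have [z Vz zw] : (F @` V) w by rewrite FV /= in_itv/= wq (lt_trans pu uw).
  have len : `|z - y| <= q - p.
    by move: Vy Vz; rewrite /= !in_itv/= ler_norml; lra.
  have [xi Vxi e] : exists2 xi, V xi & `|w - u| = `|dF xi| * `|z - y|.
    case: (ltgtP y z) => yz.
    - have [xi Vxi e] := itv_MVT Vy Vz yz; exists xi => //.
      by rewrite -yu -zw e normrM.
    - have [xi Vxi e] := itv_MVT Vz Vy yz; exists xi => //.
      by rewrite -yu -zw distrC e normrM distrC.
    - by move: uw; rewrite -yu -zw yz ltxx.
  have -> : w - u = `|w - u| by rewrite gtr0_norm// subr_gt0.
  rewrite e (mulrC (q - p)) mulrA ler_pM//; exact: dFD.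
have dx : 0 < `|dF x| by rewrite normr_gt0 dF0.
rewrite -ler_pdivlMr//; apply: itv_len_le => // y z py yz zq.
have Vy : V y by rewrite /= in_itv/= py (lt_trans yz zq).
have Vz : V z by rewrite /= in_itv/= zq (lt_trans py yz).
have [xi Vxi e] := itv_MVT Vy Vz yz.
have := congr1 Num.norm e; rewrite normrM [X in _ = _ * X]gtr0_norm ?subr_gt0// => {}e.
rewrite ler_pdivlMr//.
apply: (@le_trans _ _ (D * `|F z - F y|)).
  rewrite e mulrA [leRHS]mulrC ler_wpM2l ?subr_ge0 ?(ltW yz)//.
  exact: dFD.
rewrite ler_pM2l//.
by have := FI _ Vy; have := FI _ Vz; rewrite ler_norml; lra.
Qed.

End interval_diffeo.

(** * Lifts of the branches and bounded distortion *)
Lemma holder_on_continuous (R : realType) (D : set R) (f : R -> R) x :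
  holder_on D f -> nbhs x D -> {for x, continuous f}.
Proof.
move=> [al [C [/andP[al0 _] C0 fC]]] Dx; apply/cvgrPdist_lt => e e0.
have d0 : 0 < (e / (C + 1)) `^ al^-1 by rewrite powR_gt0// divr_gt0//; lra.
have xD : D x by exact: nbhs_singleton.
near=> y.
have Dy : D y by near: y.
apply: le_lt_trans (fC _ _ xD Dy) _.
have xy : `|x - y| < (e / (C + 1)) `^ al^-1.
  by near: y; apply: (@cvgr_dist_lt _ _ _ (nbhs x) _ id) => //; exact: cvg_id.
have : `|x - y| `^ al < e / (C + 1).
  have -> : e / (C + 1) = ((e / (C + 1)) `^ al^-1) `^ al.
    by rewrite -powRrM mulVf ?lt0r_neq0// powRr1// divr_ge0 ?(ltW e0)//; lra.
  by apply: gt0_ltr_powR; rewrite ?nnegrE ?powR_ge0.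
have C1 : 0 < C + 1 by lra.
rewrite ltr_pdivlMr//; have := powR_ge0 `|x - y| al; set P := (X in X `^ _); nra.
Unshelve. all: by end_near. Qed.

Section words.
Variables (R : realType) (N : nat) (S : T1 R -> T1 R) (J : 'I_N -> set (T1 R)).

(** Cylinders are indexed by lists rather than tuples so that words concatenate without casts; the
    empty word gives the whole circle. *)
Fixpoint cyl (w : seq 'I_N) : set (T1 R) :=
  if w is k :: w' then (J k)° `&` S @^-1` (cyl w') else setT.

Lemma cyl_cat w u : cyl (w ++ u) = cyl w `&` iter (size w) S @^-1` cyl u.
Proof.
elim: w => [|k w IHw] /=; first by rewrite setTI.
rewrite IHw preimage_setI setIA; congr (_ `&` _).
by apply/funext => v; rewrite /preimage /= -iterS iterSr.
Qed.

Lemma open_cylinder_cyl n (w : n.-tuple 'I_N) : open_cylinder S J w = cyl w.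
Proof.
elim: n w => [|n IHn] w.
  by rewrite tuple0/=; apply/seteqP; split => // v _ [].
case/tupleP: w => k w; rewrite /= -IHn; apply/seteqP; split=> v /=.
  move=> h; split; first by have := h ord0; rewrite tnth0.
  by move=> i; have := h (lift ord0 i); rewrite tnthS -iterSr.
move=> [h1 h2] i; have [i' ->|->] := unliftP ord0 i; last by rewrite tnth0.
by rewrite tnthS; have := h2 i'; rewrite -iterSr.
Qed.

Variables (V : 'I_N -> set R) (F dF : 'I_N -> R -> R) (j : 'I_N -> 'I_N -> int).

Record Markov_charts : Prop := {
  mc_arc : forall k, (J k)° = circ @` V k;
  mc_neq0 : forall k, (J k)° !=set0;
  mc_lift : forall k, diffeo_lift S (V k) (F k) (dF k) }.

(* [x |-> F k x - j k l] represents [S] from [J k] to [J l] in the charts. *)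
Definition Markov_shift : Prop := forall k l, transition S J k l ->
  forall x, V l x -> exists2 y, V k y & F k y - (j k l)%:~R = x.

Hypothesis mc : Markov_charts.

(* [Vw k w], [Fw k w] and [dFw k w] lift the cylinder of the word [k :: w], the
   iterate of [S] defined on it and the derivative of that iterate. *)
Fixpoint Vw k (w : seq 'I_N) : set R :=
  if w is l :: w' then [set x | V k x /\ Vw l w' (F k x - (j k l)%:~R)] else V k.

Fixpoint Fw k (w : seq 'I_N) (x : R) : R :=
  if w is l :: w' then Fw l w' (F k x - (j k l)%:~R) else F k x.

Fixpoint dFw k (w : seq 'I_N) (x : R) : R :=
  if w is l :: w' then dF k x * dFw l w' (F k x - (j k l)%:~R) else dF k x.

Definition admissible k w := path (fun k l => `[< transition S J k l >]) k w.

Lemma V_shape k : exists p q, [/\ p < q, q <= p + 1 & V k = `]p, q[%classic].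
Proof.
have [cV _ _ _] := mc_lift mc k.
apply: arc_chart_open_shape => //.
  by have [v] := mc_neq0 mc k; rewrite (mc_arc mc) => -[x Vx _]; exists x.
by rewrite -(mc_arc mc); exact: open_interior.
Qed.

Lemma V_nbhs k x : V k x -> nbhs x (V k).
Proof. by have [p [q [_ _ ->]]] := V_shape k; exact: itv_nbhs. Qed.

Lemma F_derive k x : V k x -> is_derive x 1 (F k) (dF k x).
Proof.
move=> Vx; have [_ _ _ h] := mc_lift mc k; have [dx _] := h _ Vx.
exact: has_deriv_within_is_derive (V_nbhs Vx) dx.
Qed.

Lemma dF_neq0 k x : V k x -> dF k x != 0.
Proof. by move=> Vx; have [_ _ _ h] := mc_lift mc k; have [] := h _ Vx. Qed.

Lemma S_F k x : V k x -> S (circ x) = circ (F k x).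
Proof. by move=> Vx; have [_ _ h _] := mc_lift mc k; exact: h. Qed.

Lemma F_shape k : exists p q, [/\ p < q, q <= p + 1 & F k @` V k = `]p, q[%classic].
Proof.
have [_ cF _ _] := mc_lift mc k; have [p [q [pq _ VE]]] := V_shape k.
have h1 := @F_derive k; have h2 := @dF_neq0 k.
rewrite VE in h1 h2 cF *; exact: itv_diffeo_image pq h1 h2 cF.
Qed.

Lemma F_inj k : {in V k &, injective (F k)}.
Proof.
have [p [q [pq _ VE]]] := V_shape k.
have h1 := @F_derive k; have h2 := @dF_neq0 k.
rewrite VE in h1 h2 *; exact: itv_diffeo_inj h1 h2.
Qed.

Hypothesis shiftP : Markov_shift.

Lemma Vw_sub k w : Vw k w `<=` V k.
Proof. by case: w => [|l w] //= x []. Qed.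

(** By the Markov property each branch covers the next chart completely, so the image depends on the
    last letter only. Having finitely many images is what makes masses and inverse derivatives
    comparable. *)
Lemma Fw_image k w : admissible k w ->
  Fw k w @` Vw k w = F (last k w) @` V (last k w).
Proof.
elim: w k => [|l w IHw] k //= /andP[/asboolP kl lw]; rewrite -IHw//.
apply/seteqP; split=> [_ [x [Vx Vx'] <-]|_ [x Vx <-]].
  by exists (F k x - (j k l)%:~R).
have [y Vy yx] := shiftP kl (Vw_sub Vx).
by exists y => /=; rewrite yx; last by []; split.
Qed.

Lemma Vw_shape k w : admissible k w ->
  exists p q, [/\ p < q, q <= p + 1 & Vw k w = `]p, q[%classic].
Proof.
elim: w k => [|l w IHw] k; first by move=> _; exact: V_shape.
move=> /= /andP[/asboolP kl lw]; have [p' [q' [pq' _ WE]]] := IHw _ lw.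
have [p [q [pq qp1 VE]]] := V_shape k.
have h1 := @F_derive k; have h2 := @dF_neq0 k; have sh := shiftP kl.
have sub : Vw l w `<=` V l by exact: Vw_sub.
rewrite WE in sub *; rewrite VE in h1 h2 sh *.
pose W : set R := [set y | p' < y - (j k l)%:~R < q'].
have -> : [set x | `]p, q[%classic x /\ `]p', q'[%classic (F k x - (j k l)%:~R)] =
    [set x | `]p, q[%classic x /\ W (F k x)].
  by apply/seteqP; split=> x [px Wx]; split => //; move: Wx; rewrite /W /= in_itv.
have Wi : is_interval W.
  by move=> x y; rewrite /W /= => Wx Wy z; lra.
have ii := itv_diffeo_is_interval h1 h2 Wi.
have nb x : `]p, q[%classic x /\ W (F k x) ->
    nbhs x [set x | `]p, q[%classic x /\ W (F k x)].
  move=> [px Wx]; near=> y; split; near: y; first exact: itv_nbhs.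
  have oW : nbhs (F k x) W.
    have -> : W = `](p' + (j k l)%:~R), (q' + (j k l)%:~R)[%classic.
      by apply/seteqP; split=> y; rewrite /W /= in_itv/=; lra.
    apply: itv_nbhs; move: Wx; rewrite /W /= in_itv/=; lra.
  by apply: (itv_derivable_continuous h1 px).
apply: itv_open_shape => //.
- have [|y Vy yx] := sh ((p' + q') / 2).
    by apply: sub; rewrite /= in_itv/=; apply/andP; split; lra.
  by exists y; split => //; rewrite /W /= yx; apply/andP; split; lra.
- move=> x /nb[e /= e0 eW]; exists (x + e / 2); last by lra.
  by apply: eW; rewrite /ball /= opprD addrA subrr sub0r normrN gtr0_norm; lra.
- move=> x /nb[e /= e0 eW]; exists (x - e / 2); last by lra.
  by apply: eW; rewrite /ball /= opprB addrCA subrr addr0 gtr0_norm; lra.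
- by move=> x y [+ _] [+ _]; rewrite /= !in_itv/=; lra.
Unshelve. all: by end_near. Qed.

Lemma Vw_nbhs k w x : admissible k w -> Vw k w x -> nbhs x (Vw k w).
Proof. by move=> /Vw_shape[p [q [_ _ ->]]]; exact: itv_nbhs. Qed.

Lemma Fw_derive k w x : Vw k w x -> is_derive x 1 (Fw k w) (dFw k w x).
Proof.
elim: w k x => [|l w IHw] k x /=; first exact: F_derive.
move=> [Vx Wx]; rewrite mulrC.
apply: (@is_derive1_comp _ (Fw l w) (fun x => F k x - (j k l)%:~R)).
  exact: IHw.
have dFx := F_derive Vx.
by apply: is_derive_eq; rewrite subr0.
Qed.

Lemma dFw_neq0 k w x : Vw k w x -> dFw k w x != 0.
Proof.
elim: w k x => [|l w IHw] k x /=; first exact: dF_neq0.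
by move=> [Vx Wx]; rewrite mulf_neq0 ?dF_neq0 ?IHw.
Qed.

Lemma dFw_continuous k w x : (forall k, holder_on (V k) (dF k)) ->
  Vw k w x -> {for x, continuous (dFw k w)}.
Proof.
move=> Vh; elim: w k x => [|l w IHw] k x /=.
  by move=> Vx; apply: holder_on_continuous (Vh k) (V_nbhs Vx).
move=> [Vx Wx]; apply: continuousM.
  by apply: holder_on_continuous (Vh k) (V_nbhs Vx).
apply: (@continuous_comp _ _ _ (fun x => F k x - (j k l)%:~R) (dFw l w)).
  apply: continuousB; last exact: cvg_cst.
  apply: differentiable_continuous; apply/derivable1_diffP.
  exact: (@ex_derive _ _ _ _ _ _ _ (F_derive Vx)).
exact: IHw.
Qed.

Lemma iter_S_Fw k w x : Vw k w x -> iter (size w).+1 S (circ x) = circ (Fw k w x).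
Proof.
elim: w k x => [|l w IHw] k x; first exact: S_F.
move=> /= [Vx Wx]; rewrite -iterS iterSr (S_F Vx).
by rewrite -(IHw _ _ Wx) -intrN circD_int.
Qed.

Lemma cyl_Vw k w : admissible k w -> cyl (k :: w) = circ @` Vw k w.
Proof.
elim: w k => [|l w IHw] k /=; first by rewrite preimage_setT setIT (mc_arc mc).
move=> /andP[/asboolP kl lw]; rewrite -/(cyl (l :: w)) IHw// (mc_arc mc).
apply/seteqP; split=> v.
  move=> [[x Vx <-]] /= [y Wy]; rewrite (S_F Vx) => /esym Fxy.
  have [x' Vx' x'y] := shiftP kl (Vw_sub Wy).
  have [_ [_ Finj _] _ _] := mc_lift mc k.
  exists x => //; split => //.
  (* [S (circ x)] determines [F k x] only modulo 1; injectivity of [circ] on the image chart removes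
     the ambiguity. *)
  suff -> : F k x = F k x' by rewrite x'y.
  apply: Finj; rewrite ?inE; [by exists x|by exists x'|].
  rewrite Fxy -x'y -intrN circD_int//.
move=> [x [Vx Wx] <-]; split; first by exists x.
exists (F k x - (j k l)%:~R) => //=; rewrite (S_F Vx) -intrN circD_int//.
Qed.

Lemma circ_deriv_Fw k w x : admissible k w -> Vw k w x ->
  circ_deriv (iter (size w).+1 S) (circ x) = dFw k w x.
Proof.
move=> kw Vx; apply: circ_deriv_eq (Fw_derive Vx).
by apply: filterS (Vw_nbhs kw Vx) => y; exact: iter_S_Fw.
Qed.

Lemma cyl_C1_diffeo k w : (forall k, holder_on (V k) (dF k)) -> admissible k w ->
  C1_diffeo_on (iter (size w).+1 S) (cyl (k :: w)).
Proof.
move=> Vh kw; exists (Vw k w), (Fw k w), (dFw k w); split.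
- exact: cyl_Vw.
- have [[Vi Vinj VT] _ _ _] := mc_lift mc k.
  have [_ cF _ _] := mc_lift mc (last k w).
  have [p [q [_ _ WE]]] := Vw_shape kw.
  split.
  + split; first by rewrite WE; exact: interval_is_interval.
      move=> x y /set_mem xV /set_mem yV; apply: Vinj; rewrite inE.
        exact: Vw_sub xV.
      exact: Vw_sub yV.
    apply: contra_neq VT => WT; apply/seteqP; split => // v _.
    have : [set: T1 R] v by []; rewrite -WT => -[x /Vw_sub Vx <-].
    by exists x.
  + by rewrite Fw_image.
  + by move=> x; exact: iter_S_Fw.
  + move=> x Vx; split; last exact: dFw_neq0.
    exact: is_derive_has_deriv_within (Fw_derive Vx).
- by apply: continuous_in_subspaceT => x /set_mem; exact: dFw_continuous.
Qed.

Lemma open_cyl k w : admissible k w -> open (cyl (k :: w)).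
Proof.
move=> kw; rewrite cyl_Vw//; apply: open_circ_image.
by have [p [q [_ _ ->]]] := Vw_shape kw; exact: interval_open.
Qed.

Lemma cyl_neq0 k w : admissible k w -> cyl (k :: w) !=set0.
Proof.
move=> kw; rewrite cyl_Vw//; have [p [q [pq _ ->]]] := Vw_shape kw.
exists (circ ((p + q) / 2)), ((p + q) / 2) => //=; rewrite in_itv/=.
by apply/andP; split; lra.
Qed.

End words.

(** The larger arc has length at most 1 and so contains neither [circ p'] nor [circ q']; hence the
    translate of []p, q[] that meets []p', q'[] cannot cross its end points. *)
Lemma arc_shift (R : realType) (p q p' q' : R) : p < q -> q' <= p' + 1 ->
  circ @` `]p, q[ `<=` circ @` `]p', q'[ ->
  exists i : int, forall x, p < x < q -> p' < x + i%:~R < q'.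
Proof.
move=> pq qp1' sub.
pose x0 := (p + q) / 2.
have x0P : p < x0 < q by rewrite /x0; apply/andP; split; lra.
have [|y yI /circ_eqP[i yx0]] := sub (circ x0); first by exists x0; rewrite //= in_itv.
move: yI; rewrite /= in_itv/= => yI.
have edge z : p < z < q -> ~ (exists i' : int, z + i'%:~R = p' \/ z + i'%:~R = q').
  move=> zI [i' zi'].
  have [|u uI /circ_eqP[m uz]] := sub (circ z); first by exists z; rewrite //= in_itv.
  move: uI; rewrite /= in_itv/= => uI.
  case: zi' => zi'.
    have : 0 < (m - i')%:~R :> R by rewrite intrB; lra.
    by rewrite int_gt0 intrB; lra.
  have : 0 < (i' - m)%:~R :> R by rewrite intrB; lra.
  by rewrite int_gt0 intrB; lra.
exists i => x xI; apply/andP; split; rewrite ltNge; apply/negP => h.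
  apply: (edge (p' - i%:~R)); first by apply/andP; split; lra.
  by exists i; left; rewrite subrK.
apply: (edge (q' - i%:~R)); first by apply/andP; split; lra.
by exists i; right; rewrite subrK.
Qed.

Lemma finite_preimage_in (T U : Type) (A : set T) (B : set U) (f : T -> U) :
  {in A &, injective f} -> finite_set B -> finite_set (A `&` f @^-1` B).
Proof.
move=> fI fB; pose f' x := if `[< A x >] then Some (f x) else None.
have -> : A `&` f @^-1` B = f' @^-1` (Some @` B).
  apply/seteqP; split=> x /=; rewrite /f'.
    by move=> [Ax Bx]; rewrite asboolT//; exists (f x).
  by case: asboolP => [Ax|_] [y By] // [<-].
apply: finite_preimage; last exact: finite_image.
move=> x y; rewrite !inE /f' /=.
case: asboolP => [Ax|_] [u _] // _; case: asboolP => [Ay|_] [w _] // _ [fxy].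
by apply: fI; rewrite ?inE.
Qed.

(** * Lifts, transitions and exceptional points of the Markov map *)

Section Markov_map.
Variables (R : realType) (N : nat) (S : T1 R -> T1 R) (J : 'I_N -> set (T1 R)).
Hypothesis mM : mixing_Markov_map S J.

Local Notation cyl := (cyl S J).

(** For an allowed transition the arc of [J l] lies in the image of the branch [k], and [arc_shift]
    supplies the integer [j k l]; forbidden pairs receive the dummy value 0. *)
Lemma Markov_lift_exists : exists V F dF j, [/\ Markov_charts S J V F dF,
  Markov_shift S J V F j & forall k, holder_on (V k) (dF k)].
Proof.
have [[arcJ _ _] C1 _ _ _] := mM.
have [V /choice[F /choice[dF VFP]]] := choice C1.
have mc : Markov_charts S J V F dF.
  split=> k.
  - by case: (VFP k).
  - exact: (arcJ k).2.
  - by case: (VFP k).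
have [j jP] : exists j : 'I_N -> 'I_N -> int, forall k l, transition S J k l ->
    forall x, V l x -> exists2 y, V k y & F k y - (j k l)%:~R = x.
  suff /choice[j jP] : forall k, exists j : 'I_N -> int, forall l, transition S J k l ->
      forall x, V l x -> exists2 y, V k y & F k y - (j l)%:~R = x by exists j.
  move=> k; suff /choice[j jP] : forall l, exists j : int, transition S J k l ->
      forall x, V l x -> exists2 y, V k y & F k y - j%:~R = x by exists j.
  move=> l; have [kl|nkl] := pselect (transition S J k l); last by exists 0.
  have [p [q [pq qp1 VE]]] := V_shape mc l.
  have [p' [q' [_ qp1' FE]]] := F_shape mc k.
  have [|i iP] := @arc_shift R p q p' q' pq qp1'.
    rewrite -VE -FE -(mc_arc mc); apply: subset_trans kl _.
    move=> _ [u + <-]; rewrite (mc_arc mc) => -[x Vx <-].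
    by exists (F k x); [exists x|rewrite (S_F mc Vx)].
  exists i => _ x; rewrite VE /= in_itv/= => /iP xi.
  have : (F k @` V k) (x + i%:~R) by rewrite FE /= in_itv.
  by move=> [y Vy yx]; exists y => //; rewrite yx addrK.
by exists V, F, dF, j; split => // k; have [] := VFP k.
Qed.

(** A single visit forces a full transition: the Markov condition puts [S v] into some fully covered
    [(J l')°], and disjointness gives [l' = l]. *)
Lemma transition_of_visit k l v : (J k)° v -> (J l)° (S v) -> transition S J k l.
Proof.
move=> kv lv; have [[_ trivJ _] _ MP _ _] := mM.
have : (S @` (J k)° `&` \bigcup_l (J l)°) (S v) by split; [exists v|exists l].
rewrite MP => -[l' kl' lv'].
by rewrite (trivJ l l')//; exists (S v); split; exact: interior_subset.
Qed.

Lemma admissible_of_cyl k w v : cyl (k :: w) v -> admissible S J k w.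
Proof.
elim: w k v => [|l w IHw] k v // [kv [lv wv]] /=; apply/andP; split.
  by apply/asboolP; exact: transition_of_visit kv lv.
by apply: (IHw l (S v)).
Qed.

Lemma connecting_words : exists q, forall k l, exists2 x, size x = q &
  admissible S J k (rcons x l).
Proof.
have [_ _ _ [n0 mix] _] := mM; exists n0 => k l.
(* A path of [n0.+1] steps has [n0] intermediate letters, which form the connecting word. *)
have [w [w0 wn wt]] := mix n0.+1 (leqnSn _) k l.
exists [seq w i | i <- iota 1 n0]; first by rewrite size_map size_iota.
have -> : rcons [seq w i | i <- iota 1 n0] l = [seq w i | i <- iota 1 n0.+1].
  by rewrite -[n0.+1]addn1 iotaD map_cat/= add1n wn cats1.
rewrite -w0 /admissible.
suff h m i : (i + m <= n0.+1)%N -> path (fun k l => `[< transition S J k l >]) (w i)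
    [seq w i | i <- iota i.+1 m] by apply: h; rewrite add0n.
elim: m i => // m IHm i im /=; apply/andP; split.
  by apply/asboolP/wt; apply: leq_trans im; rewrite addnS ltnS leq_addr.
by apply: IHm; rewrite addSn -addnS.
Qed.

Lemma endpoints_finite : finite_set (~` \bigcup_k (J k)°).
Proof.
have [[arcJ _ covJ] _ _ _ _] := mM.
apply: (@sub_finite_set _ _ (\bigcup_(k in [set: 'I_N]) (J k `\` (J k)°))).
  move=> v nv; have : [set: T1 R] v by []; rewrite -covJ => -[k _ kv].
  by exists k => //; split => // kv'; apply: nv; exists k.
apply: bigcup_finite => [|k _]; first exact: finite_finset.
have [[V [Vi Vinj VT] JV] _] := arcJ k.
have cV : arc_chart V by [].
apply: (@sub_finite_set _ _ (circ @` [set inf V; sup V])); last first.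
  exact/finite_image/finite_set2.
move=> v [+ nv]; rewrite JV => -[x Vx xv]; exists x => //.
apply: contrapT => /not_orP[xi xs]; apply: nv.
have ub : has_ubound V by exists (x + 1) => y Vy; apply/ltW/(arc_chart_lt1 cV).
have lb : has_lbound V.
  by exists (x - 1) => y Vy; rewrite lerBlDr; apply/ltW/(arc_chart_lt1 cV).
have xI : inf V < x < sup V.
  have h1 : inf V <= x by exact: ge_inf.
  have h2 : x <= sup V by exact: ub_le_sup.
  rewrite !lt_neqAle h1 h2 !andbT; apply/andP; split; apply/eqP => e; [apply: xi|apply: xs].
    by rewrite e.
  by rewrite e.
have oI : open (circ @` `]inf V, sup V[) by apply: open_circ_image; exact: interval_open.
have sub : circ @` `]inf V, sup V[ `<=` J k.
  rewrite JV => _ [y yI <-]; exists y => //.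
  move: yI; rewrite /= in_itv/= => /andP[h1 h2].
  have V0 : V !=set0 by exists x.
  have [z1 Vz1 z1y] := inf_lt V0 h1; have [z2 Vz2 z2y] := sup_gt V0 h2.
  by apply: (Vi z1 z2) => //; rewrite (ltW z1y) (ltW z2y).
by move: sub; rewrite open_subsetE// => sub; apply: sub; exists x; rewrite //= in_itv.
Qed.

Lemma S_branch_inj k : {in ((J k)° : set (T1 R)) &, injective S}.
Proof.
have [V [F [dF [j [mc _ _]]]]] := Markov_lift_exists.
move=> u v /set_mem + /set_mem; rewrite (mc_arc mc) => -[x Vx <-] [y Vy <-].
rewrite (S_F mc Vx) (S_F mc Vy).
have [_ [_ Finj _] _ _] := mc_lift mc k.
move/Finj; rewrite !inE => /(_ (ex_intro2 _ _ x Vx erefl) (ex_intro2 _ _ y Vy erefl)).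
by move/(F_inj mc); rewrite !inE => /(_ Vx Vy) ->.
Qed.

(** These are the points whose orbit meets the complement of the open branches before time [n].
    Preimages of finite sets stay finite because [S] is injective on each of the finitely many
    branches. Thus cylinders of a given length cover the circle up to a null set. *)
Lemma uncovered_finite n : finite_set [set v | ~ exists2 w, size w = n & cyl w v].
Proof.
elim: n => [|n IHn].
  by apply: (@sub_finite_set _ _ set0) => // v; apply; exists [::].
set A := [set v | ~ exists2 w, size w = n & cyl w v] in IHn.
apply: (@sub_finite_set _ _ (~` (\bigcup_k (J k)°) `|`
    \bigcup_(k in [set: 'I_N]) ((J k)° `&` S @^-1` A))).
  move=> v nv; have [[k _ kv]|] := pselect ((\bigcup_k (J k)°) v); last by left.
  right; exists k => //; split => //= -[w wn wv]; apply: nv.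
  by exists (k :: w); rewrite /= ?wn.
rewrite finite_setU; split; first exact: endpoints_finite.
apply: bigcup_finite => [|k _]; first exact: finite_finset.
exact: finite_preimage_in (@S_branch_inj k) IHn.
Qed.

Lemma measurable_S : measurable_fun setT S.
Proof.
apply: (measurability (@open (T1 R))) => // _ [B oB <-].
rewrite setTI.
have -> : S @^-1` B = (\bigcup_(k in [set: 'I_N]) ((J k)° `&` S @^-1` B)) `|`
    (~` (\bigcup_k (J k)°) `&` S @^-1` B).
  by rewrite -setI_bigcupl -setIUl setUv setTI.
have [V [F [dF [j [mc _ _]]]]] := Markov_lift_exists.
apply: measurableU.
  apply: fin_bigcup_measurable => [|k _]; first exact: finite_finset.
  apply: measurable_open_T1; rewrite (mc_arc mc).
  have -> : circ @` V k `&` S @^-1` B =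
      circ @` (V k `&` (fun x => circ (F k x)) @^-1` B).
    apply/seteqP; split=> v.
      by move=> [[x Vx <-]] /=; rewrite (S_F mc Vx) => Bx; exists x.
    by move=> [x [Vx Bx] <-]; split; [exists x|rewrite /= (S_F mc Vx)].
  apply: open_circ_image; rewrite openE => x [Vx Bx].
  apply: filterI; first exact: V_nbhs mc _ _ Vx.
  have cF : {for x, continuous (F k)}.
    apply: differentiable_continuous; apply/derivable1_diffP.
    exact: (@ex_derive _ _ _ _ _ _ _ (F_derive mc Vx)).
  have cc : {for F k x, continuous (@circ R)} by exact: circ_continuous.
  apply: (continuous_comp cF cc); exact: open_nbhs_nbhs.
apply: measurable_T1_finite; apply: sub_finite_set endpoints_finite.
exact: subIsetl.
Qed.

End Markov_map.

(** * Distortion of the iterated branches *)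

Lemma powR_exprn (R : realType) (x al : R) n : 0 <= x ->
  (x ^+ n) `^ al = (x `^ al) ^+ n.
Proof.
move=> x0; elim: n => [|n IHn]; first by rewrite !expr0 powR1.
by rewrite !exprS powRM ?exprn_ge0// IHn.
Qed.

Section distortion.
Variables (R : realType) (N : nat) (S : T1 R -> T1 R) (J : 'I_N -> set (T1 R)).
Hypothesis mM : mixing_Markov_map S J.
Variables (V : 'I_N -> set R) (F dF : 'I_N -> R -> R) (j : 'I_N -> 'I_N -> int).
Hypotheses (mc : Markov_charts S J V F dF) (sh : Markov_shift S J V F j).
Hypothesis hol : forall k, holder_on (V k) (dF k).

Local Notation cyl := (cyl S J).
Local Notation adm := (admissible S J).
Local Notation Vw := (Vw V F j).
Local Notation Fw := (Fw F j).
Local Notation dFw := (dFw F dF j).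

Lemma dFw_expanding : exists c lam : R, [/\ 0 < c, 1 < lam & forall k w x,
  adm k w -> Vw k w x -> c * lam ^+ (size w).+1 <= `|dFw k w x|].
Proof.
have [_ _ _ _ [c [lam [c0 lam1 ex]]]] := mM; exists c, lam; split => // k w x kw Vx.
rewrite -(circ_deriv_Fw mc sh kw Vx).
apply: (ex _ (in_tuple (k :: w)) (circ x)) => //.
by rewrite open_cylinder_cyl (cyl_Vw mc sh kw); exists x.
Qed.

(** Expansion bounds [dF] away from 0, so its Hoelder continuity passes to its logarithm. The
    product of the exponents, all at most 1, lies below each of them and serves every branch, since
    distances within a chart are at most 1. *)
Lemma dF_log_holder : exists H al : R, [/\ 0 <= H, 0 < al & forall k x y,
  V k x -> V k y -> `|dF k x| <= `|dF k y| * expR (H * `|x - y| `^ al)].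
Proof.
have [c [lam [c0 lam1 ex]]] := dFw_expanding.
have m0 : 0 < c * lam by rewrite mulr_gt0// (lt_trans ltr01).
have [al /choice[C alC]] := choice hol.
have al0 k : 0 < al k by have [/andP[]] := alC k.
have al1 k : al k <= 1 by have [/andP[]] := alC k.
have C0 k : 0 <= C k by have [] := alC k.
pose A := \prod_k al k; pose H := (\sum_k C k) / (c * lam).
have A0 : 0 < A by exact: prodr_gt0.
have Aal k : A <= al k.
  rewrite /A (bigD1 k)//= ler_piMr ?(ltW (al0 k))//.
  by apply: prodr_ile1 => i _; rewrite (ltW (al0 i)) al1.
have CH k : C k / (c * lam) <= H.
  rewrite ler_wpM2r ?invr_ge0 ?(ltW m0)// (bigD1 k)//= lerDl.
  by apply: sumr_ge0 => i _.
have H0 : 0 <= H by rewrite divr_ge0 ?(ltW m0)// sumr_ge0.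
exists H, A; split => // k x y Vx Vy.
have [->|xy] := eqVneq x y.
  by rewrite ler_peMr// -[leLHS]expR0 ler_expR mulr_ge0 ?powR_ge0.
have dy : c * lam <= `|dF k y| by have := ex k [::] y isT Vy; rewrite expr1.
have [_ _ /(_ x y Vx Vy) dxy] := alC k.
have xy0 : 0 < `|x - y| by rewrite normr_gt0 subr_eq0.
have xy1 : `|x - y| <= 1.
  have [p [q [pq qp1 VE]]] := V_shape mc k.
  by move: Vx Vy; rewrite VE /= !in_itv/= => Vx Vy; rewrite ler_norml; lra.
have pw : `|x - y| `^ al k <= `|x - y| `^ A by rewrite ger_powR// xy0.
have h1 : `|dF k x| <= `|dF k y| + C k * `|x - y| `^ A.
  have h2 : `|dF k x| <= `|dF k y| + `|dF k x - dF k y|.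
    by rewrite -[X in `|X| <= _](subrK (dF k y)) addrC ler_normD.
  apply: le_trans h2 _; rewrite lerD2l; apply: le_trans dxy _.
  by rewrite ler_wpM2l.
apply: le_trans h1 _.
apply: (@le_trans _ _ (`|dF k y| * (1 + H * `|x - y| `^ A))).
  rewrite mulrDr mulr1 lerD2l mulrA ler_wpM2r ?powR_ge0//.
  apply: (@le_trans _ _ (c * lam * H)); last by rewrite ler_wpM2r.
  by rewrite mulrC -ler_pdivrMr.
by rewrite ler_wpM2l// expR_ge1Dx.
Qed.

Lemma Vw_MVT k w x y : adm k w -> Vw k w x -> Vw k w y ->
  exists2 xi, Vw k w xi & `|Fw k w x - Fw k w y| = `|dFw k w xi| * `|x - y|.
Proof.
move=> kw Vx Vy; have [p [q [pq _ VE]]] := Vw_shape mc sh kw.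
have h1 z := @Fw_derive _ _ _ _ _ _ _ j mc k w z.
rewrite VE in Vx Vy h1 *.
case: (ltgtP x y) => xy.
- have [xi Vxi e] := itv_MVT h1 Vx Vy xy; exists xi => //.
  by rewrite distrC e normrM [X in _ * X]distrC.
- by have [xi Vxi e] := itv_MVT h1 Vy Vx xy; exists xi => //; rewrite e normrM.
- by exists x => //; rewrite xy !subrr !normr0 mulr0.
Qed.

(** The image of the chart has length at most 1, while the lift expands distances by at least
    [c * lam ^+ (size w).+1]. *)
Lemma Vw_diam (c lam : R) k w x y : 0 < c -> 1 < lam ->
  (forall x, Vw k w x -> c * lam ^+ (size w).+1 <= `|dFw k w x|) ->
  adm k w -> Vw k w x -> Vw k w y ->
  `|x - y| <= c^-1 * lam^-1 ^+ (size w).+1.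
Proof.
move=> c0 lam1 ex kw Vx Vy; have [xi Vxi e] := Vw_MVT kw Vx Vy.
have lam0 : 0 < lam ^+ (size w).+1 by rewrite exprn_gt0// (lt_trans ltr01).
rewrite exprVn -invfM -[leRHS]mul1r ler_pdivlMr ?mulr_gt0// mulrC.
apply: (@le_trans _ _ `|Fw k w x - Fw k w y|).
  by rewrite e ler_wpM2r// ex.
have [p [q [pq qp1 FE]]] := F_shape mc (last k w).
have FI z : Vw k w z -> p < Fw k w z < q.
  move=> Vz; have : (Fw k w @` Vw k w) (Fw k w z) by exists z.
  by rewrite (Fw_image sh kw) FE /= in_itv.
by have := FI _ Vx; have := FI _ Vy; rewrite ler_norml; lra.
Qed.

(* The summable distances along the branch enter as the telescoping sum
   [K (1 - b ^ n)]. *)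
Lemma dFw_distortion : exists2 D : R, 0 < D & forall k w x y,
  adm k w -> Vw k w x -> Vw k w y -> `|dFw k w x| <= D * `|dFw k w y|.
Proof.
have [c [lam [c0 lam1 ex]]] := dFw_expanding.
have [H [al [H0 al0 Hal]]] := dF_log_holder.
have lam0 : 0 < lam by rewrite (lt_trans ltr01).
have lV0 : 0 <= lam^-1 by rewrite invr_ge0 ltW.
pose b := (lam^-1) `^ al.
have b0 : 0 < b by rewrite powR_gt0// invr_gt0.
have b1 : b < 1.
  have : lam^-1 `^ al < 1 `^ al by apply: gt0_ltr_powR; rewrite ?nnegrE ?invf_lt1.
  by rewrite powR1.
(* [K] solves [K * (1 - b) = H * c^-1 ^ al * b], so that the contribution of a branch followed by
   [n] further letters is at most [K * (b ^ n - b ^ (n+1))]. *)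
pose K := H * (c^-1 `^ al) * b / (1 - b).
have K0 : 0 <= K by rewrite divr_ge0 ?subr_ge0 ?(ltW b1)// !mulr_ge0 ?powR_ge0 ?(ltW b0).
suff main w k x y : adm k w -> Vw k w x -> Vw k w y ->
    `|dFw k w x| <= `|dFw k w y| * expR (K * (1 - b ^+ (size w).+1)).
  exists (expR K) => [|k w x y kw Vx Vy]; first exact: expR_gt0.
  apply: le_trans (main w k x y kw Vx Vy) _; rewrite mulrC ler_wpM2r// ler_expR.
  by rewrite ler_piMr// gerBl exprn_ge0// ltW.
have Hxy k' w' x' y' : adm k' w' -> Vw k' w' x' -> Vw k' w' y' ->
    H * `|x' - y'| `^ al <= K * (1 - b) * b ^+ size w'.
  move=> kw Vx Vy; have := Vw_diam c0 lam1 (fun x Vx => ex _ _ x kw Vx) kw Vx Vy.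
  move=> xy; have e : K * (1 - b) * b ^+ size w' =
      H * (c^-1 `^ al * b ^+ (size w').+1).
    by rewrite /K exprS; field; rewrite subr_eq0 gt_eqF.
  rewrite e ler_wpM2l// /b -powR_exprn// -powRM ?invr_ge0 ?(ltW c0) ?exprn_ge0//.
  by apply: (ge0_ler_powR (ltW al0)); rewrite ?nnegrE ?mulr_ge0 ?invr_ge0 ?(ltW c0) ?exprn_ge0.
elim: w k x y => [|l w IHw] k x y kw.
  move=> Vx Vy; apply: le_trans (Hal _ _ _ Vx Vy) _.
  rewrite ler_wpM2l// ler_expR expr1.
  by have := Hxy k [::] x y kw Vx Vy; rewrite expr0 mulr1.
move=> /[dup] VVx [Vx Wx] /[dup] VVy [Vy Wy] /=.
have := kw; rewrite /admissible/= => /andP[_ lw].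
have h1 := Hal _ _ _ Vx Vy; have h2 := IHw _ _ _ lw Wx Wy.
have h3 := Hxy k (l :: w) x y kw VVx VVy.
rewrite !normrM; apply: le_trans (ler_pM _ _ h1 h2) _ => //.
rewrite mulrACA ler_wpM2l ?mulr_ge0// -expRD ler_expR.
apply: le_trans (lerD h3 (lexx _)) _ => /=.
by rewrite [b ^+ (size w).+2]exprS; lra.
Qed.

Lemma dFw_cat k w l u x : Vw k (w ++ l :: u) x ->
  exists y, [/\ Vw k w x, Vw l u y, circ y = iter (size w).+1 S (circ x) &
    dFw k (w ++ l :: u) x = dFw k w x * dFw l u y].
Proof.
elim: w k x => [|m w IHw] k x /= [Vx Wx].
  exists (F k x - (j k l)%:~R); split => //.
  by rewrite (S_F mc Vx) -intrN circD_int.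
have [y [W1 W2 yE dE]] := IHw _ _ Wx; exists y; split => //.
  by rewrite yE -!iterS !iterSr (S_F mc Vx) -intrN circD_int.
by rewrite dE mulrA.
Qed.

End distortion.

(** * Masses of cylinders against derivatives *)

Section cylinder_geometry.
Variables (R : realType) (N : nat) (S : T1 R -> T1 R) (J : 'I_N -> set (T1 R)).
Hypothesis mM : mixing_Markov_map S J.
Local Notation cyl := (cyl S J).

Lemma cylP k w v : cyl (k :: w) v -> admissible S J k w.
Proof. exact: (admissible_of_cyl mM). Qed.

Lemma open_cylT w : open (cyl w).
Proof.
case: w => [|k w]; first exact: openT.
have [V [F [dF [j [mc sh hol]]]]] := Markov_lift_exists mM.
have [[v vw]|n0] := pselect (cyl (k :: w) !=set0).
  exact: (open_cyl mc sh (cylP vw)).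
suff -> : cyl (k :: w) = set0 by exact: open0.
by apply/seteqP; split => // v vw; apply: n0; exists v.
Qed.

Lemma measurable_cyl w : measurable (cyl w).
Proof. by apply: measurable_open_T1; exact: open_cylT. Qed.

Definition cyl_mass w : R := fine (lebesgueT (cyl w)).

(** By distortion, mass times derivative is comparable to the length of the image of the cylinder.
    That image is one of finitely many arcs, with length at most 1 and inverse length at most
    [E]. *)
Lemma cyl_mass_deriv : exists2 D : R, 0 < D & forall k w v, cyl (k :: w) v ->
  D^-1 <= cyl_mass (k :: w) * `|circ_deriv (iter (size w).+1 S) v| <= D.
Proof.
have [V [F [dF [j [mc sh hol]]]]] := Markov_lift_exists mM.
have [D D0 dist] := dFw_distortion mM mc sh hol.
have [pF /choice[qF pqF]] := choice (F_shape mc).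
have len0 k : 0 < qF k - pF k by have [] := pqF k; rewrite subr_gt0.
pose E := \sum_k (qF k - pF k)^-1.
have E0 : 0 <= E by apply: sumr_ge0 => k _; rewrite invr_ge0 ltW.
have lenE k : (qF k - pF k)^-1 <= E.
  by rewrite /E (bigD1 k)//= lerDl sumr_ge0// => i _; rewrite invr_ge0 ltW.
have DE0 : 0 < D * (1 + E) by rewrite mulr_gt0//; lra.
exists (D * (1 + E)) => // k w v /[dup] kwv; move/cylP => kw.
move: kwv; rewrite (cyl_Vw mc sh kw) => -[x Vx <-].
rewrite (circ_deriv_Fw mc sh kw Vx).
have h1 z := @Fw_derive _ _ _ _ _ _ _ j mc k w z.
have h2 z := @dFw_neq0 _ _ _ _ _ _ _ j mc k w z.
have h3 y z := dist k w y z kw.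
have imE := Fw_image sh kw; have [pq1 qp1 FE] := pqF (last k w).
rewrite FE in imE.
have [p [q [pq qp1' VE]]] := Vw_shape mc sh kw.
have -> : cyl_mass (k :: w) = q - p.
  by rewrite /cyl_mass (cyl_Vw mc sh kw) VE lebesgueT_arc.
rewrite VE in Vx h1 h2 h3 imE.
have [g1 g2] := itv_diffeo_length pq h1 h2 pq1 imE h3 Vx.
set X := (q - p) * _ in g1 g2 *.
apply/andP; split.
  have lE := lenE (last k w); set L := qF (last k w) - pF (last k w) in g1 g2 lE.
  have L0 : 0 < L by exact: len0.
  have L1 : 1 <= E * L by rewrite -ler_pdivrMr// mul1r.
  rewrite -[leLHS]mul1r ler_pdivrMr//.
  have : 1 <= E * (D * X) by apply: le_trans L1 _; rewrite ler_wpM2l.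
  have : 0 < D * X by exact: lt_le_trans g1.
  by rewrite mulrC; lra.
apply: le_trans g2 _; rewrite ler_pM2l//; lra.
Qed.

Lemma cyl_mass_gt0 w v : cyl w v -> 0 < cyl_mass w.
Proof.
case: w => [|k w]; first by rewrite /cyl_mass lebesgueT_setT.
move=> /[dup] /cylP kw _.
have [V [F [dF [j [mc sh hol]]]]] := Markov_lift_exists mM.
have [p [q [pq qp1 VE]]] := Vw_shape mc sh kw.
by rewrite /cyl_mass (cyl_Vw mc sh kw) VE lebesgueT_arc//= subr_gt0.
Qed.

Lemma circ_deriv_cat k w l u v : cyl (k :: w ++ l :: u) v ->
  circ_deriv (iter (size (k :: w ++ l :: u)) S) v =
  circ_deriv (iter (size w).+1 S) v *
  circ_deriv (iter (size u).+1 S) (iter (size w).+1 S v).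
Proof.
have [V [F [dF [j [mc sh hol]]]]] := Markov_lift_exists mM.
move=> /[dup] kwv /cylP kwlu.
have : cyl ((k :: w) ++ l :: u) v by [].
rewrite cyl_cat => -[/cylP kw /cylP lu].
move: kwv; rewrite (cyl_Vw mc sh kwlu) => -[x Vx <-].
have [y [W1 W2 yE dE]] := dFw_cat mc Vx.
by rewrite (circ_deriv_Fw mc sh kwlu Vx) (circ_deriv_Fw mc sh kw W1) -yE
  (circ_deriv_Fw mc sh lu W2).
Qed.

Lemma cyl_diffeo k w v : cyl (k :: w) v ->
  C1_diffeo_on (iter (size w).+1 S) (cyl (k :: w)).
Proof.
have [V [F [dF [j [mc sh hol]]]]] := Markov_lift_exists mM.
by move=> kwv; exact: (cyl_C1_diffeo mc sh hol (cylP kwv)).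
Qed.

End cylinder_geometry.

(** * Masses of cylinders *)
Section cylinder_masses.
Variables (R : realType) (N : nat) (S : T1 R -> T1 R) (J : 'I_N -> set (T1 R)).
Hypothesis mM : mixing_Markov_map S J.
Local Notation cyl := (cyl S J).
Local Notation pm := (cyl_mass S J).

Lemma lebesgueT_le1 (A : set (T1 R)) : measurable A -> (lebesgueT A <= 1%:E)%E.
Proof.
by move=> mA; rewrite -(lebesgueT_setT R); apply: le_measure; rewrite ?inE.
Qed.

Lemma lebesgueT_fin_num (A : set (T1 R)) : measurable A -> lebesgueT A \is a fin_num.
Proof.
by move=> mA; rewrite ge0_fin_numE// (le_lt_trans (lebesgueT_le1 mA))// ltry.
Qed.

Lemma cyl_massE w : lebesgueT (cyl w) = (pm w)%:E.
Proof. by rewrite /cyl_mass fineK// lebesgueT_fin_num//; exact: (measurable_cyl mM). Qed.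

Lemma cyl_mass_ge0 w : 0 <= pm w.
Proof. by rewrite /cyl_mass fine_ge0. Qed.

Lemma cyl_mass_nonempty w : 0 < pm w -> exists v, cyl w v.
Proof.
move=> w0; apply: contrapT => /forallNP nw; move: w0.
have -> : pm w = 0; last by rewrite ltxx.
rewrite /cyl_mass (_ : cyl w = set0) ?measure0//.
by apply/seteqP; split => // v /nw.
Qed.

Lemma cyl_disjoint w w' v : size w = size w' -> cyl w v -> cyl w' v -> w = w'.
Proof.
have [[_ trivJ _] _ _ _ _] := mM.
elim: w w' v => [|k w IHw] [|k' w'] v //= [ww'] [kv wv] [kv' wv'].
rewrite (IHw _ _ ww' wv wv'); congr (_ :: _).
by apply: (trivJ k k') => //; exists v; split; exact: interior_subset.
Qed.

Definition words_set (w : seq 'I_N) n (A : pred (seq 'I_N)) : set (T1 R) :=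
  \bigcup_(u in [set u : n.-tuple 'I_N | A u]) cyl (w ++ u).

Lemma measurable_words_set w n A : measurable (words_set w n A).
Proof.
apply: fin_bigcup_measurable => [|u _]; first exact: finite_finset.
exact: (measurable_cyl mM).
Qed.

Lemma lebesgueT_words_set w n A : lebesgueT (words_set w n A) =
  (\sum_(u : n.-tuple 'I_N) (A u)%:R * pm (w ++ u))%:E.
Proof.
rewrite /words_set measure_fin_bigcup//; first last.
- by move=> u _; exact: (measurable_cyl mM).
- move=> u u' _ _ [v [uv uv']]; apply: val_inj => /=.
  have := cyl_disjoint _ uv uv'; rewrite !size_cat !size_tuple => /(_ erefl) /eqP.
  by rewrite eqseq_cat// eqxx => /eqP.
- exact: finite_finset.
rewrite -sumEFin.
transitivity (\sum_(u : n.-tuple 'I_N | A u) lebesgueT (cyl (w ++ u)))%E.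
  symmetry; apply: (@bigfs _ _ _ _ (index_enum _) (fun u : n.-tuple 'I_N => A u)).
    exact: index_enum_uniq.
  by move=> u; rewrite mem_index_enum.
rewrite big_mkcond; apply: eq_bigr => u _.
by case: ifP => _; rewrite ?cyl_massE ?mul1r ?mul0r.
Qed.

Lemma lebesgueT_almost (A B : set (T1 R)) : measurable A -> measurable B ->
  B `<=` A -> finite_set (A `\` B) -> lebesgueT A = lebesgueT B.
Proof.
move=> mA mB BA fAB; rewrite -(setDUK BA) measureU//; first last.
- by rewrite setDE setIC -setIA setICl setI0.
- exact: measurable_T1_finite.
by rewrite [X in (_ + X)%E](_ : _ = 0%E) ?adde0//; exact: lebesgueT_finite.
Qed.

(** The cylinders of the extended words fill [cyl w] up to finitely many uncovered points. *)
Lemma cyl_mass_marginal w m : \sum_(u : m.-tuple 'I_N) pm (w ++ u) = pm w.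
Proof.
apply: EFin_inj; rewrite -cyl_massE.
transitivity (lebesgueT (words_set w m predT)).
  by rewrite lebesgueT_words_set; congr EFin; apply: eq_bigr => u _; rewrite mul1r.
symmetry; apply: lebesgueT_almost.
- exact: (measurable_cyl mM).
- exact: measurable_words_set.
- by move=> v [u _]; rewrite cyl_cat => -[].
apply: sub_finite_set (uncovered_finite mM (size w + m)) => v [wv nv] [w' w'n w'v].
apply: nv; move: (w'v); rewrite -(cat_take_drop (size w) w') cyl_cat => -[tv _].
have wE : w = take (size w) w'.
  apply: cyl_disjoint wv tv.
  by rewrite size_takel// w'n leq_addr.
have dm : size (drop (size w) w') == m by rewrite size_drop w'n addKn.
by exists (Tuple dm) => //=; rewrite {1}wE cat_take_drop.
Qed.

(** Masses are inverse derivatives up to [D], and derivatives multiply along an orbit; three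
    comparisons give [D ^+ 3], and the added 1 serves the empty words. The lower bound is restricted
    to non-empty cylinders, because a forbidden concatenation has mass 0. *)
Lemma cyl_mass_cat : exists2 C : R, 1 <= C & forall w u,
  pm (w ++ u) <= C * (pm w * pm u) /\
  (cyl (w ++ u) !=set0 -> pm w * pm u <= C * pm (w ++ u)).
Proof.
have [D D0 DP] := cyl_mass_deriv mM.
have p0 : pm [::] = 1 by rewrite /cyl_mass lebesgueT_setT.
have D30 : 0 < D ^+ 3 by rewrite exprn_gt0.
exists (1 + D ^+ 3); first by lra.
move=> [|k w] u.
  rewrite p0 mul1r /=; split=> [|_]; rewrite ler_peMl ?cyl_mass_ge0//; lra.
case: u => [|l u].
  rewrite cats0 p0 mulr1; split=> [|_]; rewrite ler_peMl ?cyl_mass_ge0//; lra.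
suff main v : cyl ((k :: w) ++ l :: u) v ->
    pm ((k :: w) ++ l :: u) <= D ^+ 3 * (pm (k :: w) * pm (l :: u)) /\
    pm (k :: w) * pm (l :: u) <= D ^+ 3 * pm ((k :: w) ++ l :: u).
  have c0 := cyl_mass_ge0 ((k :: w) ++ l :: u).
  have d0 : 0 <= pm (k :: w) * pm (l :: u) by rewrite mulr_ge0// cyl_mass_ge0.
  split=> [|[v /main[_ h]]]; last by rewrite mulrDl mul1r; lra.
  have [z|nz] := eqVneq (pm ((k :: w) ++ l :: u)) 0.
    by rewrite z mulr_ge0//; lra.
  have [|v /main[h _]] := @cyl_mass_nonempty ((k :: w) ++ l :: u).
    by rewrite lt_neqAle eq_sym nz.
  by rewrite mulrDl mul1r; lra.
move=> vwu; have := vwu; rewrite cyl_cat => -[wv uv].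
have := DP _ _ _ vwu; rewrite (circ_deriv_cat mM vwu) normrM.
have := DP _ _ _ wv; have := DP _ _ _ uv.
set a := `|circ_deriv _ v|; set b := `|circ_deriv _ _|.
rewrite -[(k :: w) ++ _]/(k :: w ++ l :: u).
set x := pm _; set y := pm _; set z := pm (k :: w ++ _).
move=> /andP[y1 y2] /andP[x1 x2] /andP[z1 z2].
have DV : 0 < D^-1 by rewrite invr_gt0.
have x0 : 0 < y by apply: (cyl_mass_gt0 mM wv).
have y0 : 0 < x by apply: (cyl_mass_gt0 mM uv).
have z0 : 0 < z by apply: (cyl_mass_gt0 mM vwu).
have a0 : 0 < a by rewrite -(pmulr_rgt0 _ x0); exact: lt_le_trans x1.
have b0 : 0 < b by rewrite -(pmulr_rgt0 _ y0); exact: lt_le_trans y1.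
have ab0 : 0 < a * b by rewrite mulr_gt0.
have xx1 : 1 <= D * (y * a) by rewrite -ler_pdivrMl// mulr1.
have yy1 : 1 <= D * (x * b) by rewrite -ler_pdivrMl// mulr1.
have zz1 : 1 <= D * (z * (a * b)) by rewrite -ler_pdivrMl// mulr1.
split; rewrite -(ler_pM2r ab0).
  apply: le_trans z2 _.
  have -> : D ^+ 3 * (y * x) * (a * b) = D * ((D * (y * a)) * (D * (x * b))) by ring.
  by rewrite ler_peMr ?(ltW D0)// mulr_ege1.
have -> : D ^+ 3 * z * (a * b) = D * D * (D * (z * (a * b))) by ring.
apply: (@le_trans _ _ (D * D)); last by rewrite ler_peMr// mulr_ge0 ?ltW.
by rewrite mulrACA ler_pM// mulr_ge0 ?ltW.
Qed.

Lemma alphabet_inhabited : 'I_N.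
Proof.
have [[_ _ cov] _ _ _ _] := mM.
have : exists k : 'I_N, True.
  have : [set: T1 R] (circ 0) by [].
  by rewrite -cov => -[k _ _]; exists k.
by move=> /cid[k _].
Qed.

Lemma cyl_connect : exists q, forall w u, cyl w !=set0 -> cyl u !=set0 ->
  exists2 x, size x = q & cyl (w ++ x ++ u) !=set0.
Proof.
have [V [F [dF [j [mc sh hol]]]]] := Markov_lift_exists mM.
have [q qP] := connecting_words mM; exists q.
have cons_case k w l u : cyl (k :: w) !=set0 -> cyl (l :: u) !=set0 ->
    exists2 x, size x = q & cyl ((k :: w) ++ x ++ l :: u) !=set0.
  move=> [v /(cylP mM) kw] [v' /(cylP mM) lu].
  have [x xq xP] := qP (last k w) l; exists x => //.
  apply: (cyl_neq0 mc sh (w := w ++ x ++ l :: u)).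
  move: kw lu xP; rewrite /admissible => kw lu.
  by rewrite -cat_rcons !cat_path kw last_rcons lu andbT.
have cyl1 k : cyl [:: k] !=set0.
  by have [v kv] := mc_neq0 mc k; exists v.
(* An empty word is replaced by the letter [k], which is removed afterwards: a first letter by
   passing from [v] to [S v], a last letter by inclusion of cylinders. The length of the connecting
   word is unaffected. *)
have k := alphabet_inhabited.
move=> [|i w] [|l u] wn un.
- have [x xq [v p]] := cons_case k [::] k [::] (cyl1 k) (cyl1 k).
  exists x => //; exists (S v); rewrite cats0 /=.
  by move: p => /= [_]; rewrite cyl_cat => -[].
- have [x xq [v p]] := cons_case k [::] l u (cyl1 k) un.
  by exists x => //; exists (S v); case: p.
- have [x xq [v p]] := cons_case i w k [::] wn (cyl1 k).
  exists x => //; exists v; rewrite cats0.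
  by move: p; rewrite catA cyl_cat => -[].
- exact: cons_case.
Qed.

End cylinder_masses.

(** * Birkhoff sums of [ln g] on cylinders *)

Section cocycle.
Variables (R : realType) (N : nat) (S : T1 R -> T1 R) (J : 'I_N -> set (T1 R)).
Variable g : T1 R -> R.
Hypotheses (mM : mixing_Markov_map S J) (g0 : forall v, 0 < g v)
  (gd : bounded_distortion S g).
Local Notation cyl := (cyl S J).
Local Notation pm := (cyl_mass S J).

(* The sum starts at [i = 0], whereas [birkhoff_prod] starts at [i = 1]. *)
Definition log_cocycle n (v : T1 R) : R := \sum_(i < n) ln (g (iter i S v)).
Local Notation LG := log_cocycle.

Lemma log_cocycleD n m v : LG (n + m) v = LG n v + LG m (iter n S v).
Proof.
rewrite /LG big_split_ord/=; congr (_ + _); apply: eq_bigr => i _.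
by rewrite addnC iterD.
Qed.

Lemma log_cocycleSr n v : LG n.+1 v = LG n v + ln (g (iter n S v)).
Proof. by rewrite /LG big_ord_recr. Qed.

Lemma birkhoff_prod_exp n v :
  birkhoff_prod S g n v = expR (LG n.+1 v - ln (g v)).
Proof.
elim: n => [|n IHn].
  by rewrite /birkhoff_prod big_geq// /LG big_ord1 subrr expR0.
rewrite birkhoff_prodS IHn [LG n.+2 v]log_cocycleSr -[X in _ * X]lnK ?posrE// -expRD.
by congr expR; ring.
Qed.

(** This is the distortion hypothesis on a cylinder of length [n = (size w).+1]. It controls the
    times 1 to [n], hence reaches one step beyond the cylinder and omits time 0. *)
Lemma birkhoff_prod_distortion : exists2 d : R, 0 <= d & forall k w u v,
  cyl (k :: w) u -> cyl (k :: w) v ->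
  `|(LG (size w).+2 u - ln (g u)) - (LG (size w).+2 v - ln (g v))| <= d.
Proof.
have [D D0 DP] := gd; exists `|ln D| => // k w u v ku kv.
have nv : nbhs v (cyl (k :: w)).
  by apply: open_nbhs_nbhs; split => //; exact: (open_cylT mM).
have := DP _ _ _ (ltn0Sn (size w)) nv (cyl_diffeo mM ku) u ku.
rewrite !birkhoff_prod_exp -expRN -expRD => /andP[h1 h2].
have {h1} : ln D^-1 <= ln (expR (LG (size w).+2 u - ln (g u) -
    (LG (size w).+2 v - ln (g v)))) by rewrite ler_ln ?posrE ?invr_gt0 ?expR_gt0.
have {h2} : ln (expR (LG (size w).+2 u - ln (g u) -
    (LG (size w).+2 v - ln (g v)))) <= ln D by rewrite ler_ln ?posrE ?expR_gt0.
rewrite expRK lnV ?posrE// => h2 h1; rewrite ler_norml.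
have := ler_norm (ln D); have := ler_norm (- ln D); rewrite normrN; lra.
Qed.

Lemma predecessor k : exists l, transition S J l k.
Proof.
have [V [F [dF [j [mc sh hol]]]]] := Markov_lift_exists mM.
have cyl1 i : cyl [:: i] !=set0.
  by have [v iv] := mc_neq0 mc i; exists v.
have [q qP] := cyl_connect mM.
have [x xq [v]] := qP _ _ (cyl1 k) (cyl1 k).
(* The predecessor is the last connecting letter, or [k] itself if the connecting word is empty. *)
rewrite cat1s; case/lastP: x xq => [|x l] _.
  move=> /= [kv [kv' _]]; exists k; exact: (transition_of_visit mM kv kv').
rewrite cat_rcons -cat_cons cyl_cat => -[_ [lv [kv _]]]; exists l.
exact: (transition_of_visit mM lv kv).
Qed.

(** Distortion starts at time 1, so a point of [(J k)°] is viewed as the image of a point in a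
    preceding branch. There [ln g] is compared with its value at one reference point for each
    branch. *)
Lemma log_g_bound : exists2 B : R, 0 <= B & forall k v, (J k)° v -> `|ln (g v)| <= B.
Proof.
have [d d0 dP] := birkhoff_prod_distortion.
have [V [F [dF [j [mc sh hol]]]]] := Markov_lift_exists mM.
have [pt ptP] := choice (mc_neq0 mc).
exists (d + \sum_k `|ln (g (pt k))|); first by rewrite addr_ge0// sumr_ge0.
move=> k v kv; have [l lk] := predecessor k.
have [u lu uv] := lk _ kv; have [u' lu' upt] := lk _ (ptP k).
have lu1 : cyl [:: l] u by split.
have lu1' : cyl [:: l] u' by split.
have := dP l [::] u u' lu1 lu1'.
rewrite /LG !big_ord_recr !big_ord0/= uv upt => h.
have : `|ln (g (pt k))| <= \sum_k `|ln (g (pt k))|.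
  by rewrite (bigD1 k)//= lerDl sumr_ge0.
rewrite (_ : _ - _ = ln (g v) - ln (g (pt k))) in h; last by ring.
have := ler_normD (ln (g v) - ln (g (pt k))) (ln (g (pt k))).
rewrite subrK; lra.
Qed.

(* The base point is irrelevant up to a bounded error; on an empty cylinder it is
   the junk value [point]. *)
Definition word_log (w : seq 'I_N) : R := LG (size w) (xget point (cyl w)).

(** Distortion covers the times 1 to [n], the sum runs over the times 0 to [n - 1]. Time 0 costs [B]
    for each of the two points, and time [n] is removed by distortion on the one-letter cylinder of
    the last letter. *)
Lemma word_log_approx : exists2 K : R, 0 <= K & forall w v, cyl w v ->
  `|LG (size w) v - word_log w| <= K.
Proof.
have [d d0 dP] := birkhoff_prod_distortion.
have [B B0 BP] := log_g_bound.
exists (d + d + B + B); first by rewrite !addr_ge0.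
move=> w v wv; have wu : cyl w (xget point (cyl w)) by apply: xgetPex; exists v.
rewrite /word_log; move: (xget _ _) wu => u wu.
case: w wv wu => [|k w] wv wu.
  by rewrite /LG !big_ord0 subrr normr0 !addr_ge0.
have h1 := dP _ _ _ _ wv wu.
have h2 : `|ln (g (iter (size w).+1 S v)) - ln (g (iter (size w).+1 S u))| <= d.
  have : cyl [:: last k w] (iter (size w) S v) /\ cyl [:: last k w] (iter (size w) S u).
    move: wv wu; rewrite lastI -cats1 !cyl_cat size_belast => -[_ h] [_ h'].
    by split.
  move=> [hv hu]; have := dP _ _ _ _ hv hu.
  rewrite /LG !big_ord_recr !big_ord0 /= add0r; apply: le_trans.
  by rewrite le_eqVlt; apply/orP; left; apply/eqP; congr Num.norm; ring.
have h3 : `|ln (g v)| <= B by apply: (BP k); case: wv.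
have h4 : `|ln (g u)| <= B by apply: (BP k); case: wu.
move: h1 h2 h3 h4; rewrite ![LG (size w).+2 _]log_cocycleSr.
set a := LG _ v; set b := LG _ u; rewrite /= -/a -/b; rewrite !ler_norml; lra.
Qed.

Lemma log_cocycle_bound B w v : (forall k v, (J k)° v -> `|ln (g v)| <= B) ->
  cyl w v -> `|LG (size w) v| <= B * (size w)%:R.
Proof.
move=> BP; elim: w v => [|k w IHw] v /=; first by rewrite /LG big_ord0 normr0 mulr0.
move=> [kv wv]; rewrite -[(size w).+1]add1n log_cocycleD natrD mulrDr mulr1.
apply: le_trans (ler_normD _ _) _; apply: lerD; last exact: IHw.
by rewrite /LG big_ord1; exact: BP kv.
Qed.

Lemma Markov_quasi_Bernoulli : exists C K B c q,
  quasi_Bernoulli pm word_log C K B c q.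
Proof.
have [C C1 CP] := cyl_mass_cat mM.
have [K K0 KP] := word_log_approx.
have [B B0 BP] := log_g_bound.
have [q qP] := cyl_connect mM.
have C0 : 0 < C by rewrite (lt_le_trans ltr01).
(* There are finitely many words of length [q], so their positive masses are bounded below; words of
   mass 0 contribute [0^-1 = 0]. The two divisions by [C] in the connecting constant below come from
   two uses of the lower comparison. *)
pose E := \sum_(x : q.-tuple 'I_N) (pm x)^-1.
have E0 : 0 <= E by rewrite sumr_ge0// => x _; rewrite invr_ge0 cyl_mass_ge0.
have pmE (x : seq 'I_N) : size x = q -> 0 < pm x -> (1 + E)^-1 <= pm x.
  move=> /eqP xq x0; rewrite invf_ple ?posrE//; last by lra.
  apply: le_trans (_ : E <= _); last by lra.
  rewrite /E (bigD1 (Tuple xq))//= lerDl sumr_ge0// => i _.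
  by rewrite invr_ge0 cyl_mass_ge0.
exists C, (K + K + K), B, ((1 + E)^-1 / C / C), q; split.
- exact: cyl_mass_ge0.
- by rewrite /cyl_mass lebesgueT_setT.
- exact: cyl_mass_marginal.
- by move=> w u; have [] := CP w u.
- by rewrite !divr_gt0// invr_gt0; lra.
- move=> w u w0 u0.
  have [x xq wxu] := qP w u (cyl_mass_nonempty w0) (cyl_mass_nonempty u0).
  exists x => //.
  have xu : cyl (x ++ u) !=set0.
    by have [v] := wxu; rewrite cyl_cat => -[_ xuv]; exists (iter (size w) S v).
  have x0 : 0 < pm x.
    by have [v] := xu; rewrite cyl_cat => -[xv _]; exact: (cyl_mass_gt0 mM xv).
  have h1 := (CP w (x ++ u)).2 wxu; have h2 := (CP x u).2 xu.
  have h3 := pmE x xq x0.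
  have -> : (1 + E)^-1 / C / C * (pm w * pm u) =
      pm w * (((1 + E)^-1 * pm u) / C) / C by ring.
  rewrite ler_pdivrMr// [leRHS]mulrC; apply: le_trans h1.
  rewrite ler_pM2l// ler_pdivrMr// [leRHS]mulrC; apply: le_trans h2.
  by rewrite ler_pM2r.
- move=> w u /cyl_mass_nonempty[v wuv].
  have h1 := KP _ _ wuv; move: wuv; rewrite cyl_cat => -[wv uv].
  have h2 := KP _ _ wv; have h3 := KP _ _ uv.
  rewrite size_cat log_cocycleD in h1.
  by move: h1 h2 h3; rewrite !ler_norml; lra.
- move=> w /cyl_mass_nonempty[v wv]; apply: log_cocycle_bound => //.
  by apply: xgetPex; exists v.
Qed.

End cocycle.

(** * Pressure and positive drift *)
Section pressure.
Variables (R : realType) (N : nat) (S : T1 R -> T1 R) (J : 'I_N -> set (T1 R)).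
Variable g : T1 R -> R.
Hypotheses (mM : mixing_Markov_map S J) (g0 : forall v, 0 < g v)
  (gd : bounded_distortion S g).
Local Notation cyl := (cyl S J).
Local Notation pm := (cyl_mass S J).
Local Notation LG := (log_cocycle S g).
Local Notation G := (word_log S J g).
Local Notation P := (partition_sum pm G).

Lemma prod_powR_log_cocycle s n v :
  \prod_(i < n) g (iter i S v) `^ (- s) = expR (- (s * LG n v)).
Proof.
rewrite /LG mulr_sumr -sumrN expR_sum; apply: eq_bigr => i _.
by rewrite /powR gt_eqF// mulNr.
Qed.

(** Every candidate in the supremum over a non-empty cylinder is within the factor [A] of the weight
    of the word; empty cylinders are skipped on one side and weigh 0 on the other. Lengths start at
    1 because the derivative comparison does. *)
Lemma pressure_sum_bounds s : 0 <= s -> exists2 A : R, 0 < A & forall n,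
  A^-1 * P s n.+1 <= pressure_sum S J g s n.+1 <= A * P s n.+1.
Proof.
move=> s0; have [D D0 DP] := cyl_mass_deriv mM.
have [K K0 KP] := word_log_approx mM g0 gd.
pose A := D * expR (s * K); have A0 : 0 < A by rewrite mulr_gt0 ?expR_gt0.
exists A => // n; rewrite /pressure_sum /partition_sum !mulr_sumr.
have term (w : n.+1.-tuple 'I_N) : let T := expR (- (s * G w)) * pm w in
    A^-1 * T <= (if `[< open_cylinder S J w !=set0 >] then
      sup [set (\prod_(i < n.+1) g (iter i S v) `^ (- s)) /
        `|circ_deriv (iter n.+1 S) v| | v in open_cylinder S J w] else 0) <= A * T.
  move=> T; rewrite open_cylinder_cyl; case: asboolP => [[v0 wv0]|nw]; last first.
    have -> : T = 0; last by rewrite !mulr0 lexx.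
    rewrite /T (_ : pm w = 0) ?mulr0//; apply/eqP.
    rewrite eq_le cyl_mass_ge0 andbT leNgt; apply/negP => /cyl_mass_nonempty.
    exact: nw.
  have XP v : cyl w v -> A^-1 * T <= (\prod_(i < n.+1) g (iter i S v) `^ (- s)) /
        `|circ_deriv (iter n.+1 S) v| <= A * T.
    rewrite prod_powR_log_cocycle => wv.
    have GL : `|LG n.+1 v - G w| <= K.
      by have := KP _ _ wv; rewrite size_tuple.
    have : D^-1 <= pm w * `|circ_deriv (iter n.+1 S) v| <= D.
      move: wv; case/tupleP: w {T GL wv0} => k w /= wv.
      by have := DP _ _ _ wv; rewrite size_tuple.
    rewrite /T; set d := `|_|; have w0 : 0 < pm w by exact: (cyl_mass_gt0 mM wv).
    move=> /andP[d1 d2].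
    have d0 : 0 < d.
      by rewrite -(pmulr_rgt0 _ w0); apply: lt_le_trans d1; rewrite invr_gt0.
    have e1 : expR (- (s * G w)) <= expR (s * K) * expR (- (s * LG n.+1 v)).
      rewrite -expRD ler_expR -!mulrN -mulrDr ler_wpM2l//.
      by move: GL; rewrite ler_norml; lra.
    have e2 : expR (- (s * LG n.+1 v)) <= expR (s * K) * expR (- (s * G w)).
      rewrite -expRD ler_expR -!mulrN -mulrDr ler_wpM2l//.
      by move: GL; rewrite ler_norml; lra.
    apply/andP; split.
      rewrite ler_pdivlMr// -!mulrA ler_pdivrMl// /A.
      have -> : D * expR (s * K) * expR (- (s * LG n.+1 v)) =
        (expR (s * K) * expR (- (s * LG n.+1 v))) * D by ring.
      by rewrite ler_pM ?expR_ge0// mulr_ge0 ?ltW.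
    rewrite ler_pdivrMr//.
    have -> : A * (expR (- (s * G w)) * pm w) * d =
      (expR (s * K) * expR (- (s * G w))) * (D * (pm w * d)) by rewrite /A; ring.
    rewrite -[leLHS]mulr1 ler_pM ?expR_ge0//.
    by rewrite -ler_pdivrMl// mulr1.
  apply/andP; split.
    apply: le_trans (andP (XP _ wv0)).1 _; apply: ub_le_sup; last by exists v0.
    by exists (A * T) => _ [v wv <-]; have /andP[] := XP _ wv.
  apply: ge_sup; first by eexists; exists v0.
  by move=> _ [v wv <-]; have /andP[] := XP _ wv.
rewrite [X in _ <= X <= _]big_mkcond/=; apply/andP; split; apply: ler_sum => w _.
  by have /andP[] := term w.
by have /andP[] := term w.
Qed.

(** The growth rate of [P s n] is the pressure, which vanishes; the uniform error of
    quasi-additivity then bounds [ln (P s n)] itself. *)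
Lemma partition_sum_bounds s : 0 <= s -> pressure S J g s = 0 ->
  exists c1 C1 : R, [/\ 0 < c1, 0 < C1 & forall n, c1 <= P s n <= C1].
Proof.
move=> s0 ps0.
have [C [K [B [c [q qb]]]]] := Markov_quasi_Bernoulli mM g0 gd.
have [Q QP] := ln_partition_sum_quasi_additive qb s0.
have [l [lcvg lQ]] := quasi_additive_cvg QP.
have [A A0 AP] := pressure_sum_bounds s0.
have P0 n : 0 < P s n by exact: (partition_sum_gt0 qb).
have AV0 : 0 < A^-1 by rewrite invr_gt0.
have lnP n : `|ln (pressure_sum S J g s n.+1) - ln (P s n.+1)| <= `|ln A|.
  have /andP[h1 h2] := AP n.
  have ps : 0 < pressure_sum S J g s n.+1 by apply: lt_le_trans h1; rewrite mulr_gt0.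
  have {h1} : ln (A^-1 * P s n.+1) <= ln (pressure_sum S J g s n.+1).
    by rewrite ler_ln ?posrE ?mulr_gt0.
  have {h2} : ln (pressure_sum S J g s n.+1) <= ln (A * P s n.+1).
    by rewrite ler_ln ?posrE ?mulr_gt0.
  rewrite !lnM ?posrE// lnV ?posrE// ler_norml.
  have := ler_norm (ln A); have := ler_norm (- ln A); rewrite normrN; lra.
have l0 : l = 0.
  rewrite -ps0 /pressure; symmetry; apply: cvg_lim => //.
  rewrite -(cvg_shiftS (fun n => n%:R^-1 * ln (pressure_sum S J g s n))) /=.
  have -> : (fun n => n.+1%:R^-1 * ln (pressure_sum S J g s n.+1)) =
    (fun n => n.+1%:R^-1 * ln (P s n.+1)) \+ (fun n => n.+1%:R^-1 *
      (ln (pressure_sum S J g s n.+1) - ln (P s n.+1))).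
    by apply/funext => n /=; ring.
  rewrite -[l]addr0; apply: cvgD.
    by move: lcvg; rewrite -(cvg_shiftS (fun n => n%:R^-1 * ln (P s n))).
  have zero : n.+1%:R^-1 * `|ln A| @[n --> \oo] --> (0 : R).
    by rewrite -[0](mul0r `|ln A|); apply: cvgMl; exact: cvg_harmonic.
  apply/cvgr0Pnorm_le => e e0; move/cvgr0Pnorm_le : zero => /(_ _ e0).
  apply: filterS => n; apply: le_trans; rewrite !normrM ler_wpM2l// normr_id.
  exact: lnP.
have {}lQ n : `|ln (P s n)| <= Q by have := lQ n; rewrite l0 mulr0 subr0.
exists (expR (- Q)), (expR Q); split; rewrite ?expR_gt0// => n.
rewrite -[P s n]lnK ?posrE// !ler_expR.
by have := lQ n; rewrite ler_norml.
Qed.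

End pressure.

(* Katznelson-Weiss: cut the orbit into blocks along which the average of [f] is
   at most [eta], the exceptional times being visits to [A]. *)
Lemma stopping_time_sum (R : realType) (T : Type) (S : T -> T) (f : T -> R)
    (A : set T) (B eta : R) M : 0 <= eta -> (forall v, `|f v| <= B) ->
  (forall v, ~ A v -> exists2 i, (0 < i <= M)%N &
    \sum_(k < i) f (iter k S v) <= eta * i%:R) ->
  forall L v, \sum_(k < L) f (iter k S v) <=
    eta * L%:R + B * (\sum_(k < L) \1_A (iter k S v)) + B * M%:R.
Proof.
move=> eta0 fB stop L v.
have B0 : 0 <= B by apply: le_trans (fB v).
have fle u : f u <= B by apply: le_trans (fB u); exact: ler_norm.
have [n] := ubnP L; elim: n L v => // n IHn L v Ln.
have ind0 m u : 0 <= B * (\sum_(k < m) \1_A (iter k S u)) :> R.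
  by rewrite mulr_ge0// sumr_ge0.
have sumD m i u (F : T -> R) : \sum_(k < i + m) F (iter k S u) =
    \sum_(k < i) F (iter k S u) + \sum_(k < m) F (iter k S (iter i S u)).
  rewrite big_split_ord/=; congr (_ + _); apply: eq_bigr => k _.
  by rewrite addnC iterD.
(* Only the last, incomplete piece of orbit pays [B * M]. *)
have [LM|ML] := leqP L M.
  apply: ler_wpDl; first by rewrite addr_ge0 ?ind0// mulr_ge0.
  apply: (@le_trans _ _ (\sum_(k < L) B)); first by apply: ler_sum => k _.
  by rewrite sumr_const card_ord -[B *+ L]mulr_natr ler_wpM2l// ler_nat.
have [Av|nAv] := pselect (A v).
  case: L Ln ML => // L Ln ML; rewrite -[L.+1]add1n !sumD !big_ord1 /=.
  rewrite indicE mem_set//= natrD.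
  have := IHn L (S v) Ln; have := fle v; lra.
have [i /andP[i0 iM] fi] := stop v nAv.
have iL : (i <= L)%N by rewrite (leq_trans iM)// ltnW.
rewrite -(subnKC iL) !sumD natrD.
have : (L - i < n)%N.
  by rewrite (leq_trans _ (Ln : (L <= n)%N))// ltn_subrL i0 (leq_trans i0 iL).
move=> /(IHn _ (iter i S v)); have := ind0 i v; lra.
Qed.

(** * Stopping times under an invariant measure *)

Section drift.
Variables (R : realType) (S : T1 R -> T1 R) (mu : probability (T1 R) R).
Hypotheses (mS : measurable_fun setT S) (muS : invariant_measure S mu).

Lemma measurable_iter i : measurable_fun setT (iter i S).
Proof. by elim: i => [|i IHi]; [exact: measurable_id|exact: (measurableT_comp mS IHi)]. Qed.

Lemma integral_iter i (F : T1 R -> \bar R) : measurable_fun setT F ->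
  (forall v, (0 <= F v)%E) ->
  (\int[mu]_v F (iter i S v) = \int[mu]_v F v)%E.
Proof.
move=> mF F0; elim: i => // i IHi; rewrite -IHi.
have mFi : measurable_fun setT (fun v => F (iter i S v)).
  by apply: (measurableT_comp mF); exact: measurable_iter.
have := ge0_integral_pushforward mS mu measurableT mFi (fun v _ => F0 _).
rewrite preimage_setT => /esym e.
rewrite (_ : (fun v => F (iter i.+1 S v)) = (fun v => F (iter i S v)) \o S); last first.
  by apply/funext => v /=; rewrite -iterS iterSr.
rewrite e; apply: eq_measure_integral => A mA _.
exact: muS.
Qed.

(** The pathwise bound is integrated against the invariant measure and divided by [L]; the boundary
    term [B * M / L] vanishes as [L] grows. *)
Lemma stopping_time_integral (f : T1 R -> R) (A : set (T1 R)) (B eta : R) M :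
  0 <= eta -> measurable_fun setT f -> measurable A ->
  (forall v, `|f v| <= B) ->
  (forall v, ~ A v -> exists2 i, (0 < i <= M)%N &
    \sum_(k < i) f (iter k S v) <= eta * i%:R) ->
  (\int[mu]_v (f v)%:E <= (eta + B * fine (mu A))%:E)%E.
Proof.
move=> eta0 mf mA fB stop.
have B0 : 0 <= B by apply: le_trans (fB (circ 0)).
have muAE : (fine (mu A))%:E = mu A by rewrite fineK// fin_num_measure.
have cstE r : (\int[mu]_v r%:E = r%:E)%E.
  transitivity (r%:E * mu setT)%E; first exact: (integral_cst mu measurableT r%:E).
  by rewrite probability_setT mule1.
have BA : (\int[mu]_v (B * \1_A v)%:E = (B * fine (mu A))%:E)%E.
  have := @integralZl_indic _ _ R mu setT measurableT (fun=> A) B _ mA.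
  move=> /= ->; last by move=> /lt_geF; rewrite B0.
  have -> : (\int[mu]_v (\1_A v)%:E = mu A)%E by rewrite integral_indic// setIT.
  by rewrite EFinM muAE.
(* Adding [B] makes the integrand nonnegative, so that sums and integrals can be exchanged
   freely. *)
pose F v : \bar R := (f v + B)%:E.
have F0 v : (0 <= F v)%E.
  by rewrite lee_fin; have := fB v; rewrite ler_norml; lra.
have mF : measurable_fun setT F.
  by apply/measurable_EFinP; apply: measurable_funD.
have intf : mu.-integrable setT (EFin \o f).
  apply: measurable_bounded_integrable => //; first by rewrite fin_num_fun_lty.
  by exists B; split => [|x Bx v _]; [exact: num_real|rewrite /= (le_trans (fB v))// ltW].
have intB : mu.-integrable setT (EFin \o cst B) by exact: finite_measure_integrable_cst.
have FE : (\int[mu]_v F v = \int[mu]_v (f v)%:E + B%:E)%E.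
  transitivity (\int[mu]_v ((EFin \o f) v + (EFin \o cst B) v))%E.
    by apply: eq_integral => v _; rewrite /F /= EFinD.
  rewrite integralD_EFin//; congr (_ + _)%E.
  exact: cstE.
have Ffin : (\int[mu]_v F v \is a fin_num)%E.
  by rewrite FE fin_numD/= andbT; exact: integrable_fin_num.
have main L : (L%:R%:E * \int[mu]_v F v <=
    (L%:R * (eta + B) + B * M%:R + B * L%:R * fine (mu A))%:E)%E.
  pose H v : \bar R := \sum_(k < L) (B * \1_A (iter k S v))%:E.
  have mI k : measurable_fun setT (fun v => (B * \1_A (iter k S v))%:E).
    apply/measurable_EFinP; apply: measurable_funM => //.
    by apply: measurableT_comp; [exact: measurable_indic|exact: measurable_iter].
  have I0 k v : (0 <= (B * \1_A (iter k S v))%:E)%E by rewrite lee_fin mulr_ge0.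
  have mFk k : measurable_fun setT (fun v => F (iter k S v)).
    by apply: (measurableT_comp mF); exact: measurable_iter.
  have -> : (L%:R%:E * \int[mu]_v F v = \int[mu]_v \sum_(k < L) F (iter k S v))%E.
    rewrite ge0_integral_sum//.
    under eq_bigr do rewrite integral_iter//.
    by rewrite -(fineK Ffin) sumEFin sumr_const card_ord -EFinM mulr_natl.
  have -> : ((L%:R * (eta + B) + B * M%:R + B * L%:R * fine (mu A))%:E =
    \int[mu]_v ((L%:R * (eta + B) + B * M%:R)%:E + H v))%E.
    rewrite ge0_integralD//.
    - rewrite cstE EFinD; congr (_ + _)%E.
      rewrite ge0_integral_sum//.
      under eq_bigr => k _.
        rewrite (integral_iter k (F := fun v => (B * \1_A v)%:E))//; first last.
        + by move=> v; rewrite lee_fin mulr_ge0.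
        + by apply/measurable_EFinP; apply: measurable_funM => //; exact: measurable_indic.
        rewrite BA.
        over.
      by rewrite sumEFin sumr_const card_ord -[in RHS]mulr_natr mulrAC.
    - by move=> v _; rewrite lee_fin addr_ge0 ?mulr_ge0 ?addr_ge0.
    - by move=> v _; rewrite sume_ge0.
    - by apply: emeasurable_sum.
  apply: ge0_le_integral => //.
  - by move=> v _; rewrite sume_ge0.
  - by apply: emeasurable_sum.
  - by apply: emeasurable_funD => //; apply: emeasurable_sum.
  move=> v _; rewrite /F /H !sumEFin -EFinD lee_fin big_split/= sumr_const card_ord.
  have := stopping_time_sum eta0 fB stop L v.
  rewrite mulr_sumr -[B *+ L]mulr_natr; lra.
move: main; rewrite -(fineK Ffin) => main.
have {}main L : L%:R * fine (\int[mu]_v F v) <=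
    L%:R * (eta + B) + B * M%:R + B * L%:R * fine (mu A).
  by have := main L; rewrite -EFinM lee_fin.
have : fine (\int[mu]_v F v) <= eta + B + B * fine (mu A).
  apply/ler_addgt0Pr => e e0; pose L := (Num.truncn (B * M%:R / e)).+1.
  have Le : B * M%:R <= e * L%:R.
    by rewrite [leRHS]mulrC -ler_pdivrMr// ltW// truncnS_gt.
  have L0 : 0 < L%:R :> R by [].
  by rewrite -(ler_pM2l L0); have := main L; lra.
rewrite -lee_fin fineK// FE.
rewrite -(fineK (integrable_fin_num measurableT intf)) -!EFinD !lee_fin; lra.
Qed.

End drift.

(** * Positivity of the exponent excludes tightness *)

Section positive_exponent.
Variables (R : realType) (N : nat) (S : T1 R -> T1 R) (J : 'I_N -> set (T1 R)).
Variable g : T1 R -> R.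
Hypotheses (mM : mixing_Markov_map S J) (g0 : forall v, 0 < g v)
  (gd : bounded_distortion S g) (mg : measurable_fun setT g).
Variable mu : probability (T1 R) R.
Hypotheses (muS : invariant_measure S mu) (mu_ac : mu `<< lebesgueT)
  (gmu : (0 < \int[mu]_v (ln (g v))%:E)%E).
Local Notation cyl := (cyl S J).
Local Notation pm := (cyl_mass S J).
Local Notation LG := (log_cocycle S g).
Local Notation G := (word_log S J g).

Lemma cyl_visit w v i : cyl w v -> (i < size w)%N ->
  exists k, (J k)° (iter i S v).
Proof.
elim: w v i => // k w IHw v [|i] /= [kv wv] iw; first by exists k.
by have [l lP] := IHw _ _ wv iw; exists l; rewrite -iterS iterSr.
Qed.

Lemma cyl_take w v i : cyl w v -> cyl (take i w) v.
Proof. by rewrite -{1}(cat_take_drop i w) cyl_cat => -[]. Qed.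

Lemma mu_null A : measurable A -> lebesgueT A = 0%E -> mu A = 0%E.
Proof.
move=> mA A0; have nA : lebesgueT.-null_set A.
  move=> D mD DA; apply/eqP; rewrite eq_le measure_ge0 andbT -A0.
  by apply: le_measure; rewrite ?inE.
exact: (mu_ac nA mA).
Qed.

Lemma mu_finite A : finite_set A -> mu A = 0%E.
Proof.
by move=> fA; apply: mu_null; [exact: measurable_T1_finite|exact: lebesgueT_finite].
Qed.

Let E1 : set (T1 R) := \bigcup_(k in [set: 'I_N]) (J k)°.
(** The bound on [ln g] is known only on the open branches; this truncation is bounded everywhere
    and equal to [ln g] almost everywhere for [mu]. *)
Let f v : R := ln (g v) * \1_E1 v.

Let mE1 : measurable E1.
Proof.
by apply: measurable_open_T1; apply: bigcup_open => k _; exact: open_interior.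
Qed.

Let mf : measurable_fun setT f.
Proof.
apply: measurable_funM; last exact: measurable_indic.
exact: (measurableT_comp (@measurable_ln R)).
Qed.

Let fE v : E1 v -> f v = ln (g v).
Proof. by move=> Ev; rewrite /f indicE mem_set// mulr1. Qed.

Let int_f : (0 < \int[mu]_v (f v)%:E)%E.
Proof.
rewrite (_ : (\int[mu]_v (f v)%:E)%E = (\int[mu]_v (ln (g v))%:E)%E)//.
apply: ae_eq_integral => //.
- exact/measurable_EFinP.
- by apply/measurable_EFinP; exact: (measurableT_comp (@measurable_ln R)).
exists (~` E1); split.
- exact: measurableC.
- by apply: mu_finite; exact: (endpoints_finite mM).
- by move=> v /= nv Ev; apply: nv => _; rewrite fE.
Qed.

Let bad K eta M := words_set S J [::] M (positive_drift G K eta M).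

Let bad_nonincreasing K eta n m : (n <= m)%N -> bad K eta m `<=` bad K eta n.
Proof.
move=> nm v [w /= wd wv].
have tn : size (take n w) == n by rewrite size_takel// size_tuple.
exists (Tuple tn) => /=; last exact: cyl_take.
apply/allP => i; rewrite mem_iota add1n ltnS => /andP[i1 i_n].
have := allP wd i; rewrite mem_iota add1n ltnS i1 (leq_trans i_n nm) => /(_ isT).
by rewrite take_takel.
Qed.

(** Domination speaks of null sets only. The nested bad sets decrease to a Lebesgue null set, which
    is then null for [mu], and continuity from above makes some bad set small for [mu]. *)
Lemma bad_rare K eta (x d del : R) : 0 < d ->
  (forall n, d <= word_prob pm n (fun w => G w <= x)) ->
  0 < eta -> 0 < del -> exists M, (mu (bad K eta M) <= del%:E)%E.
Proof.
move=> d0 dP eta0 del0.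
have [C [K' [B [c [q qb]]]]] := Markov_quasi_Bernoulli mM g0 gd.
have mb M : measurable (bad K eta M) by exact: (measurable_words_set mM).
have mcap : measurable (\bigcap_M bad K eta M) by exact: bigcapT_measurable.
have mcap0 : lebesgueT (\bigcap_M bad K eta M) = 0%E.
  apply/eqP; rewrite eq_le measure_ge0 andbT.
  apply/lee_addgt0Pr => e e0; rewrite add0e.
  have [M MP] := positive_drift_rare qb K d0 dP eta0 e0.
  apply: (@le_trans _ _ (lebesgueT (bad K eta M))).
    by apply: le_measure; rewrite ?inE//; exact: bigcap_inf.
  by rewrite /bad (lebesgueT_words_set mM) lee_fin.
have cv := @nonincreasing_cvg_mu _ _ _ mu (bad K eta) _ mb mcap _.
have : (mu \o bad K eta) x @[x --> \oo] --> mu (\bigcap_n bad K eta n).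
  apply: cv; first by rewrite -ge0_fin_numE ?fin_num_measure.
  by move=> n m nm; apply/subsetPset; exact: bad_nonincreasing.
rewrite (mu_null mcap mcap0) => /fine_cvgP[_ /cvgr0Pnorm_le/(_ _ del0)[M _ MP]].
exists M; have := MP M (leqnn M); rewrite /= => h.
rewrite -(fineK (fin_num_measure mu _ (mb M))) lee_fin.
exact: le_trans (ler_norm _) h.
Qed.

(** Tightness would make persistent drift rare for [mu]; elsewhere a bounded stopping time has
    average at most [eta]. The integral would then be at most [gam / 4 + gam / 4], below its lower
    bound [gam]. *)
Lemma word_log_not_tight (x d : R) : 0 < d ->
  ~ (forall n, d <= word_prob pm n (fun w => G w <= x)).
Proof.
move=> d0 dP.
have [K K0 KP] := word_log_approx mM g0 gd.
have [B B0 BP] := log_g_bound mM g0 gd.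
have fB v : `|f v| <= B.
  rewrite /f indicE; case: (boolP (v \in E1)) => [/set_mem[k _ kv]|_] /=.
    by rewrite mulr1; exact: BP kv.
  by rewrite mulr0 normr0.
have ex_real (y : \bar R) : (0 < y)%E -> exists2 r : R, 0 < r & (r%:E <= y)%E.
  by case: y => [r| |] // r0; [exists r|exists 1; rewrite ?leey].
have [gam gam0 gamP] := ex_real _ int_f.
pose eta := gam / 4; have eta0 : 0 < eta by rewrite divr_gt0.
have del0 : 0 < gam / (4 * (B + 1)) by rewrite divr_gt0//; lra.
have [M MP] := bad_rare K d0 dP eta0 del0.
pose U : set (T1 R) := [set v | ~ exists2 w, size w = M & cyl w v].
have fU : finite_set U by exact: (uncovered_finite mM).
have mU : measurable U by exact: measurable_T1_finite.
have mb : measurable (bad K eta M) by exact: (measurable_words_set mM).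
(* Points of [U] have no word of length [M], so they join the exceptional set. *)
pose A := bad K eta M `|` U.
have mA : measurable A by exact: measurableU.
have muA : fine (mu A) <= gam / (4 * (B + 1)).
  rewrite -lee_fin fineK ?fin_num_measure//.
  apply: (@le_trans _ _ (mu (bad K eta M) + mu U)%E); first exact: measureU2.
  by rewrite (mu_finite fU) adde0.
have stop v : ~ A v -> exists2 i, (0 < i <= M)%N &
    \sum_(k < i) f (iter k S v) <= eta * i%:R.
  move=> /not_orP[nb /contrapT[w wM wv]].
  have wM' : size w == M by apply/eqP.
  have : ~~ positive_drift G K eta M w.
    by apply/negP => wd; apply: nb; exists (Tuple wM').
  rewrite -has_predC => /hasP[i]; rewrite mem_iota add1n ltnS => /andP[i1 iM] /=.
  rewrite -leNgt => Gi; exists i; first by rewrite i1.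
  have -> : \sum_(k < i) f (iter k S v) = LG i v.
    apply: eq_bigr => k _; rewrite fE//.
    have [|l lP] := cyl_visit (i := k) wv; last by exists l.
    by rewrite wM (leq_trans (ltn_ord k)).
  have := KP _ _ (cyl_take i wv); rewrite size_takel ?wM// ler_norml; lra.
have := stopping_time_integral (measurable_S mM) muS (ltW eta0) mf mA fB stop.
move=> /(le_trans gamP); rewrite lee_fin /eta => h.
have B1 : 0 < B + 1 by lra.
have : B * fine (mu A) <= gam / 4.
  apply: le_trans (ler_wpM2l B0 muA) _.
  rewrite invfM mulrA mulrA mulrC ler_pdivrMl//; nra.
lra.
Qed.

End positive_exponent.

(** * Tails of the invariant graph *)
(* Monotonicity of the integral without measurability, so that the measurability
   of [phi_infty] is never needed. *)
Lemma ge0_le_integral_nonmeasurable d (T : measurableType d) (R : realType)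
    (mu : {measure set T -> \bar R}) (f1 f2 : T -> \bar R) :
  (forall x, (0 <= f1 x)%E) -> (forall x, (f1 x <= f2 x)%E) ->
  (\int[mu]_x f1 x <= \int[mu]_x f2 x)%E.
Proof.
move=> f10 f12; have f20 x : (0 <= f2 x)%E by exact: le_trans (f12 x).
rewrite !ge0_integralTE//; apply: ge_ereal_sup => _ [k kf <-].
by apply: ereal_sup_ubound; exists k => // x; exact: le_trans (f12 x).
Qed.

Lemma lebesgueT_setC (R : realType) (A : set (T1 R)) : measurable A ->
  fine (lebesgueT (~` A)) = 1 - fine (lebesgueT A).
Proof.
move=> mA; have mAC : measurable (~` A) by exact: measurableC.
have e : lebesgueT (~` A `|` A) = (lebesgueT (~` A) + lebesgueT A)%E.
  by apply: measureU => //; exact: setICl.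
rewrite setvU lebesgueT_setT in e.
rewrite -(fineK (lebesgueT_fin_num mA)) -(fineK (lebesgueT_fin_num mAC)) in e.
by move: e; rewrite -EFinD => -[->]; rewrite addrK.
Qed.

Section Xi_bounds.
Variables (R : realType) (phi : T1 R -> R) (eps : R).
Hypotheses (phi0 : forall v, 0 <= phi v) (eps0 : 0 < eps).
Local Notation X := (eps^-1 * \int[lebesgueT]_t Num.min (phi t) eps)%R.

Let int_indic (c : R) (A : set (T1 R)) : 0 <= c -> measurable A ->
  (\int[lebesgueT]_v (c * \1_A v)%:E = (c * fine (lebesgueT A))%:E)%E.
Proof.
move=> c0 mA.
have := @integralZl_indic _ _ R lebesgueT setT measurableT (fun=> A) c _ mA.
move=> /= ->; last by move=> /lt_geF; rewrite c0.
have -> : (\int[lebesgueT]_v (\1_A v)%:E = lebesgueT A)%E.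
  by rewrite integral_indic// setIT.
by rewrite EFinM fineK// lebesgueT_fin_num.
Qed.

Let min0 v : (0 <= (Num.min (phi v) eps)%:E)%E.
Proof. by rewrite lee_fin le_min phi0 ltW. Qed.

Let int_min_fin : (\int[lebesgueT]_v (Num.min (phi v) eps)%:E)%E \is a fin_num.
Proof.
rewrite ge0_fin_numE ?integral_ge0//.
apply: (@le_lt_trans _ _ (\int[lebesgueT]_v (eps * \1_setT v)%:E)%E).
  apply: ge0_le_integral_nonmeasurable => // v.
  by rewrite lee_fin indicT mulr1 ge_min lexx orbT.
by rewrite int_indic ?ltry// ltW.
Qed.

Lemma Xi_deficit_le (A : set (T1 R)) : measurable A ->
  (forall v, ~ A v -> eps <= phi v) -> 1 - X <= fine (lebesgueT A).
Proof.
move=> mA Aphi; have mAC : measurable (~` A) by exact: measurableC.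
have AC := lebesgueT_setC mA.
suff : eps * (1 - fine (lebesgueT A)) <= \int[lebesgueT]_t Num.min (phi t) eps.
  rewrite -(ler_pM2l (_ : 0 < eps^-1)) ?invr_gt0// mulKf ?gt_eqF//; lra.
rewrite -lee_fin -AC -(int_indic (ltW eps0) mAC) /Rintegral fineK//.
apply: ge0_le_integral_nonmeasurable => v.
  by rewrite lee_fin mulr_ge0 ?(ltW eps0).
rewrite lee_fin le_min indicE; case: (boolP (v \in ~` A)) => /=.
  by move=> /set_mem nA; rewrite mulr1 lexx andbT; exact: Aphi.
by rewrite mulr0 phi0 (ltW eps0).
Qed.

(** The level is halved because [phi v <= eps] alone would leave no deficit. *)
Lemma Xi_deficit_ge (A : set (T1 R)) : measurable A ->
  (forall v, A v -> phi v <= eps / 2) -> fine (lebesgueT A) / 2 <= 1 - X.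
Proof.
move=> mA Aphi; have mAC : measurable (~` A) by exact: measurableC.
have AC := lebesgueT_setC mA.
have e2 : 0 <= eps / 2 by rewrite divr_ge0 ?ltW.
suff : \int[lebesgueT]_t Num.min (phi t) eps <=
    eps / 2 * fine (lebesgueT A) + eps * (1 - fine (lebesgueT A)).
  move=> h; have eV : 0 <= eps^-1 by rewrite invr_ge0 ltW.
  have {h} := ler_wpM2l eV h; move: (fine (lebesgueT A)) => m.
  have -> : eps^-1 * (eps / 2 * m + eps * (1 - m)) = 1 - m / 2.
    by field; rewrite gt_eqF.
  by move=> h; rewrite lerBrDr addrC -lerBrDr.
rewrite -lee_fin /Rintegral fineK// EFinD -AC -(int_indic (ltW eps0) mAC)
  -(int_indic e2 mA).
rewrite -ge0_integralD//; first last.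
- by apply/measurable_EFinP; apply: measurable_funM => //; exact: measurable_indic.
- by move=> v _; rewrite lee_fin mulr_ge0 ?(ltW eps0).
- by apply/measurable_EFinP; apply: measurable_funM => //; exact: measurable_indic.
- by move=> v _; rewrite lee_fin mulr_ge0.
apply: ge0_le_integral_nonmeasurable => // v.
rewrite -EFinD lee_fin ge_min !indicE in_setC; case: (boolP (v \in A)) => /=.
  by move=> /set_mem /Aphi h; rewrite mulr1 mulr0 addr0 h.
by move=> _; rewrite mulr0 mulr1 add0r lexx orbT.
Qed.

End Xi_bounds.

Section tails.
Variables (R : realType) (N : nat) (S : T1 R -> T1 R) (J : 'I_N -> set (T1 R)).
Variables (g : T1 R -> R) (a : R) (h : R -> R).
Hypotheses (a0 : 0 < a) (ah : fibre_function a h).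
Hypotheses (mM : mixing_Markov_map S J) (g0 : forall v, 0 < g v)
  (gd : bounded_distortion S g) (ga : forall v, g v * h a <= a).
Local Notation cyl := (cyl S J).
Local Notation pm := (cyl_mass S J).
Local Notation LG := (log_cocycle S g).
Local Notation G := (word_log S J g).
Local Notation P := (partition_sum pm G).
Local Notation phi := (phi_infty S g a h).

Lemma phi_infty_upper_tail t eta C2 : 0 < t -> 0 < eta ->
  (forall n, P t n <= C2 * expR (- (eta * n%:R))) ->
  exists2 C : R, 0 < C & forall eps, 0 < eps -> exists A : set (T1 R),
    [/\ measurable A, fine (lebesgueT A) <= C * eps `^ t &
      forall v, ~ A v -> eps <= phi v].
Proof.
move=> t0 eta0 Pt.
have [C [K' [B' [c [q qb]]]]] := Markov_quasi_Bernoulli mM g0 gd.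
have [K K0 KP] := word_log_approx mM g0 gd.
have [B B0 BP] := log_g_bound mM g0 gd.
have C20 : 0 < C2.
  have := lt_le_trans (partition_sum_gt0 qb t 0) (Pt 0%N).
  by rewrite mulr0 oppr0 expR0 mulr1.
pose th := eta / (2 * t); have th0 : 0 < th by rewrite divr_gt0 ?mulr_gt0.
have [A A0 AP] := phi_infty_ge a0 ah S g0 ga th0.
pose C3 := expR (t * (K + B)) * A `^ t * C2.
have C30 : 0 < C3 by rewrite !mulr_gt0 ?expR_gt0 ?powR_gt0.
pose r := expR (- (eta / 2)).
have r0 : 0 < r by exact: expR_gt0.
have r1 : r < 1 by rewrite /r expR_lt1 oppr_lt0 divr_gt0.
exists (C3 * (1 - r)^-1); first by rewrite mulr_gt0// invr_gt0 subr_gt0.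
move=> eps eps0.
(* If [G] exceeds [x k] on a word of length [k.+1], then [g_k >= eps * A * exp (th * k)] on its
   cylinder: [K] covers the choice of the point and [B] the factor at time 0. *)
pose x k := K + B + ln (eps * A) + th * k%:R.
pose U n : set (T1 R) := [set v | ~ exists2 w, size w = n & cyl w v].
have fU n : finite_set (U n) by exact: (uncovered_finite mM).
have mU n : measurable (U n) by exact: measurable_T1_finite.
pose W k := words_set S J [::] k.+1 (fun w => G w <= x k).
have mW k : measurable (W k) by exact: (measurable_words_set mM).
have epsA : 0 < eps * A by rewrite mulr_gt0.
have Wle k : (lebesgueT (W k `|` U k.+1) <= (geometric (C3 * eps `^ t) r k)%:E)%E.
  apply: (@le_trans _ _ (lebesgueT (W k) + lebesgueT (U k.+1))%E).
    exact: measureU2.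
  rewrite (lebesgueT_finite (fU _)) adde0 (lebesgueT_words_set mM) lee_fin.
  apply: le_trans (word_prob_chernoff qb _ _ (ltW t0)) _.
  apply: le_trans (ler_wpM2l (expR_ge0 _) (Pt _)) _.
  have -> : geometric (C3 * eps `^ t) r k =
      expR (t * (K + B) + t * ln (eps * A) - eta / 2 * k%:R) * C2.
    rewrite /geometric /= /C3 !expRD.
    have -> : expR (t * ln (eps * A)) = A `^ t * eps `^ t.
      by rewrite -powRM ?(ltW eps0) ?(ltW A0)// [A * eps]mulrC /powR gt_eqF.
    by rewrite -mulNr -expRM_natr /r expRM_natr; ring.
  rewrite mulrCA mulrC ler_pM2r// -expRD ler_expR.
  rewrite /x -natr1 /th.
  have -> : t * (K + B + ln (eps * A) + eta / (2 * t) * k%:R) =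
    t * (K + B) + t * ln (eps * A) + eta / 2 * k%:R.
    by field; rewrite gt_eqF.
  lra.
have mWU k : measurable (W k `|` U k.+1) by exact: measurableU.
have mcup : measurable (\bigcup_k (W k `|` U k.+1)) by exact: bigcup_measurable.
exists (\bigcup_k (W k `|` U k.+1)); split => //.
- rewrite -lee_fin fineK; last exact: lebesgueT_fin_num.
  have := @measure_sigma_subadditive _ _ _ lebesgueT _ (fun k => W k `|` U k.+1)
    mWU mcup (@subset_refl _ _).
  move=> /le_trans; apply.
  apply: lime_le; first by apply: is_cvg_nneseries => k _ _; exact: measure_ge0.
  apply: nearW => n.
  apply: le_trans (lee_sum _ (fun k _ => Wle k)) _.
  rewrite sumEFin lee_fin [C3 / _ * _]mulrAC.
  have Ce0 : 0 <= C3 * eps `^ t by rewrite mulr_ge0 ?powR_ge0 ?(ltW C30).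
  have nr1 : `|r| < 1 by rewrite gtr0_norm.
  exact: (geometric_le_lim n Ce0 r0 nr1).
- move=> v nv; apply: AP => // k k0.
  have [nW nU] : ~ W k v /\ ~ U k.+1 v.
    by split=> h'; apply: nv; exists k => //; [left|right].
  move/contrapT: nU => [w wk wv].
  have Gw : x k < G w.
    rewrite ltNge; apply/negP => Gw; apply: nW; have /eqP wk' := wk.
    by exists (Tuple wk').
  have hL := KP _ _ wv; rewrite wk in hL.
  have hg : `|ln (g v)| <= B.
    by case: w wk wv {Gw hL} => // i w _ [iv _]; exact: BP iv.
  rewrite birkhoff_prod_exp// -[eps * A]lnK ?posrE// -expRD ler_expR.
  by move: hL hg Gw; rewrite !ler_norml /x; lra.
Qed.

Lemma phi_infty_lower_tail sig d : 0 < d -> 0 < sig ->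
  (forall x : R, 0 <= x -> exists n,
    d * expR (- (sig * x)) <= word_prob pm n (fun w => G w <= - x)) ->
  exists2 c : R, 0 < c & forall eps, 0 < eps -> eps <= a -> exists A : set (T1 R),
    [/\ measurable A, c * eps `^ sig <= fine (lebesgueT A) &
      forall v, A v -> phi v <= eps].
Proof.
move=> d0 sig0 dP.
have [K K0 KP] := word_log_approx mM g0 gd.
have [B B0 BP] := log_g_bound mM g0 gd.
have phiG w v : cyl w v -> phi v <= a * expR (G w + K + B).
  case: w => [|k w] wv.
    apply: le_trans (phi_infty_le a0 ah S g0 ga 0 v) _ => /=.
    rewrite ler_peMr ?(ltW a0)// -[leLHS]expR0 ler_expR.
    by rewrite /word_log /log_cocycle big_ord0; lra.
  apply: le_trans (phi_infty_le a0 ah S g0 ga (size w) v) _.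
  apply: le_trans (fibre_iter_le a0 ah S g0 ga (size w) v) _.
  rewrite ler_pM2l// birkhoff_prod_exp// ler_expR.
  have h1 := KP _ _ wv; have h2 : `|ln (g v)| <= B by case: wv => kv _; exact: BP kv.
  by move: h1 h2; rewrite !ler_norml /=; lra.
exists (d * expR (- (sig * (K + B + ln a)))); first by rewrite mulr_gt0 ?expR_gt0.
move=> eps eps0 epsa.
have lnea : ln eps <= ln a by rewrite ler_ln ?posrE.
(* At this level the bound [a * expR (G w + K + B)] is at most [eps]; it is nonnegative because
   [eps <= a]. *)
have x0 : 0 <= K + B + (ln a - ln eps) by lra.
have [n nP] := dP _ x0.
exists (words_set S J [::] n (fun w => G w <= - (K + B + (ln a - ln eps)))); split.
- exact: (measurable_words_set mM).
- rewrite (lebesgueT_words_set mM) /=; apply: le_trans nP.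
  rewrite /powR gt_eqF// -mulrA -expRD ler_pM2l// ler_expR; lra.
- move=> v [w /= Gw wv]; apply: le_trans (phiG _ _ wv) _.
  apply: (@le_trans _ _ (a * expR (ln eps - ln a))).
    by rewrite ler_pM2l// ler_expR; lra.
  by rewrite expRD expRN !lnK ?posrE// mulrCA mulfV ?mulr1// gt_eqF.
Qed.

End tails.

(** * Logarithmic rates from power bounds *)

Lemma ln_ratio_cvg (R : realType) (u : R -> R) (s : R) : 0 < s ->
  (forall t, 0 < t -> t < s -> exists2 C : R, 0 < C &
    \forall e \near 0^'+, u e <= C * e `^ t) ->
  (forall t, s < t -> exists2 c : R, 0 < c &
    \forall e \near 0^'+, c * e `^ t <= u e) ->
  ln (u e) / ln e @[e --> 0^'+] --> s.
Proof.
move=> s0 up low; apply/cvgrPdist_le => del del0.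
(* The exponent has to be within [del / 2] of [s] and yet positive; the other half of [del] absorbs
   the constants [C] and [c] once [- ln e] exceeds [M]. *)
pose t := Num.max (s / 2) (s - del / 2).
have t0 : 0 < t by rewrite lt_max divr_gt0.
have ts : t < s by rewrite gt_max; apply/andP; split; lra.
have td : s - del / 2 <= t by rewrite le_max lexx orbT.
have [C C0 Cup] := up t t0 ts.
have sd : s < s + del / 2 by rewrite ltrDl divr_gt0.
have [c c0 clow] := low _ sd.
pose M := (`|ln C| + `|ln c| + 1) * 2 / del.
have M0 : 0 < M by rewrite divr_gt0// mulr_gt0// ltr_wpDl// addr_ge0.
near=> e.
have e0 : 0 < e by near: e; exact: nbhs_right_gt.
have eM : e < expR (- M) by near: e; apply: nbhs_right_lt; exact: expR_gt0.
have lne : ln e < - M by rewrite -[ltRHS]expRK ltr_ln ?posrE ?expR_gt0.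
have h1 : u e <= C * e `^ t by near: e.
have h2 : c * e `^ (s + del / 2) <= u e by near: e.
have u0 : 0 < u e by apply: lt_le_trans h2; rewrite mulr_gt0 ?powR_gt0.
have {}h1 : ln (u e) <= ln C + t * ln e.
  rewrite -ln_powR -lnM ?posrE ?powR_gt0// ler_ln ?posrE//.
  by rewrite mulr_gt0 ?powR_gt0.
have {}h2 : ln c + (s + del / 2) * ln e <= ln (u e).
  rewrite -ln_powR -lnM ?posrE ?powR_gt0// ler_ln ?posrE//.
  by rewrite mulr_gt0 ?powR_gt0.
have le0 : ln e < 0 by lra.
have n0 : 0 < - ln e by lra.
have MC : `|ln C| + `|ln c| <= del / 2 * - ln e.
  have : (`|ln C| + `|ln c| + 1) = del / 2 * M by rewrite /M; field; rewrite gt_eqF.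
  have := ler_wpM2l (ltW (divr_gt0 del0 (ltr0n R 2))) (ltW lne); lra.
have -> : ln (u e) / ln e = - ln (u e) / - ln e by rewrite invrN mulrNN.
rewrite ler_distlC; apply/andP; split.
  rewrite ler_pdivlMr//.
  have := ler_wpM2r (ltW n0) td; have := ler_norm (ln C); have := normr_ge0 (ln c); nra.
rewrite ler_pdivrMr//.
have := ler_norm (- ln c); rewrite normrN; have := normr_ge0 (ln C); nra.
Unshelve. all: by end_near. Qed.

(** Near 0 the function stays between [1/2] and 1, so its logarithm is bounded while [ln e]
    diverges. *)
Lemma ln_ratio_cvg0 (R : realType) (u : R -> R) (C t : R) : 0 < C -> 0 < t ->
  (\forall e \near 0^'+, 1 - C * e `^ t <= u e <= 1) ->
  ln (u e) / ln e @[e --> 0^'+] --> 0.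
Proof.
move=> C0 t0 uP; apply/cvgr0Pnorm_le => del del0.
have C20 : 0 < (2 * C)^-1 by rewrite invr_gt0 mulr_gt0.
have [x0 x00 x0P] := expR_decay t0 C20.
have ln20 : 0 < ln 2 :> R by rewrite ln_gt0// ltr1n.
pose M := Num.max x0 (ln 2 / del).
have Mx0 : x0 <= M by rewrite le_max lexx.
have Mdel : ln 2 <= del * M.
  by rewrite mulrC -ler_pdivrMr// le_max lexx orbT.
have M0 : 0 < M by rewrite lt_max [X in _ || X]divr_gt0 ?orbT.
near=> e.
have e0 : 0 < e by near: e; exact: nbhs_right_gt.
have eM : e < expR (- M) by near: e; apply: nbhs_right_lt; exact: expR_gt0.
have lne : ln e < - M by rewrite -[ltRHS]expRK ltr_ln ?posrE ?expR_gt0.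
have /andP[u1 u2] : 1 - C * e `^ t <= u e <= 1 by near: e.
have et : C * e `^ t <= 2^-1.
  rewrite -ler_pdivlMl// -invfM mulrC; apply: le_trans (x0P M Mx0).
  by rewrite /powR gt_eqF// ler_expR -mulrN ler_wpM2l// ltW.
have u12 : 2^-1 <= u e by lra.
have u0 : 0 < u e by lra.
have lu1 : ln (u e) <= 0 by rewrite -ln1 ler_ln ?posrE.
have lu2 : - ln 2 <= ln (u e) by rewrite -lnV ?posrE// ler_ln ?posrE ?invr_gt0.
rewrite normrM normfV [X in _ / X]ltr0_norm; last by lra.
rewrite ler_pdivrMr; last by lra.
rewrite ler0_norm//; apply: le_trans (_ : ln 2 <= _); first by lra.
by apply: le_trans Mdel _; rewrite ler_wpM2l ?(ltW del0)//; lra.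
Unshelve. all: by end_near. Qed.

Theorem theorem2 (R : realType) (N : nat) (J : 'I_N -> set (T1 R))
    (S : T1 R -> T1 R) (g : T1 R -> R) (a : R) (h : R -> R)
    (mu_minus mu_ac : probability (T1 R) R) (s : R) :
  0 < a -> fibre_function a h ->
  (forall v, 0 < g v) -> measurable_fun setT g ->
  (forall v, g v * h a <= a) ->
  mixing_Markov_map S J ->
  bounded_distortion S g ->
  invariant_measure S mu_minus ->
  (\int[mu_minus]_v (ln (g v))%:E < 0)%E ->
  invariant_measure S mu_ac -> mu_ac `<< lebesgueT ->
  (0 < \int[mu_ac]_v (ln (g v))%:E)%E ->
  0 < s -> pressure S J g s = 0 ->
  ln (Xi S g a h eps) / ln eps @[eps --> 0^'+] --> 0 /\
  ln (1 - Xi S g a h eps) / ln eps @[eps --> 0^'+] --> s.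
Proof.
move=> a0 ah g0 mg ga mM gd _ _ muS mu_ac_dom gmu s0 ps0.
have [C [K [B [c [q qb]]]]] := Markov_quasi_Bernoulli mM g0 gd.
have [c1 [C1 [c10 _ Ps]]] := partition_sum_bounds mM g0 gd (ltW s0) ps0.
have decay t : 0 < t -> t < s -> exists eta C2 : R, 0 < eta /\
    forall n, partition_sum (cyl_mass S J) (word_log S J g) t n <=
      C2 * expR (- (eta * n%:R)).
  move=> t0 ts.
  have PC1 n : partition_sum (cyl_mass S J) (word_log S J g) s n <= C1.
    by have /andP[] := Ps n.
  have [//|[x [d [d0 dP]]]] := partition_sum_decay_or_tight qb t0 ts PC1.
  by have := word_log_not_tight mM g0 gd mg muS mu_ac_dom gmu d0 dP.
have phi0 v : 0 <= phi_infty S g a h v by exact: phi_infty_ge0.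
have upper t : 0 < t -> t < s -> exists2 C : R, 0 < C &
    forall eps, 0 < eps -> 1 - Xi S g a h eps <= C * eps `^ t.
  move=> t0 ts; have [eta [C2 [eta0 Pt]]] := decay t t0 ts.
  have [D D0 DP] := phi_infty_upper_tail a0 ah mM g0 gd ga t0 eta0 Pt.
  exists D => // eps eps0; have [A [mA Aeps Aphi]] := DP _ eps0.
  exact: le_trans (Xi_deficit_le phi0 eps0 mA Aphi) Aeps.
(* The lower deficit estimate for the empty set is exactly this sign condition. *)
have deficit_ge0 eps : 0 < eps -> 0 <= 1 - Xi S g a h eps.
  move=> eps0; have := Xi_deficit_ge phi0 eps0 (@measurable0 _ (T1 R)).
  by rewrite measure0 mul0r; apply.
have s2 : 0 < s / 2 by rewrite divr_gt0.
have s2s : s / 2 < s by lra.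
split.
  have [D D0 DP] := upper _ s2 s2s.
  apply: (ln_ratio_cvg0 D0 s2); near=> eps.
  have eps0 : 0 < eps by near: eps; exact: nbhs_right_gt.
  have := DP _ eps0; have := deficit_ge0 _ eps0 => h1 h2.
  by apply/andP; split; lra.
apply: (@ln_ratio_cvg _ (fun eps => 1 - Xi S g a h eps)) => // t.
  move=> t0 ts; have [D D0 DP] := upper t t0 ts; exists D => //.
  near=> eps; apply: DP; near: eps; exact: nbhs_right_gt.
move=> st; have [eta [C2 [eta0 Pt]]] := decay _ s2 s2s.
have C20 : 0 < C2.
  have := lt_le_trans (partition_sum_gt0 qb (s / 2) 0) (Pt 0%N).
  by rewrite mulr0 oppr0 expR0 mulr1.
have Pt0 (e : R) : 0 < e -> exists n,
    partition_sum (cyl_mass S J) (word_log S J g) (s / 2) n <= e.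
  move=> e0; have [x _ xP] := expR_decay eta0 (divr_gt0 e0 C20).
  exists (Num.truncn x).+1; apply: le_trans (Pt _) _.
  by rewrite mulrC -ler_pdivlMr// xP// ltW// truncnS_gt.
have Pc1 n : c1 <= partition_sum (cyl_mass S J) (word_log S J g) s n.
  by have /andP[] := Ps n.
have [d d0 dP] := word_prob_lower_tail qb s2s s0 st c10 Pc1 Pt0.
have t0 : 0 < t by lra.
have [b b0 bP] := phi_infty_lower_tail a0 ah mM g0 gd ga d0 t0 dP.
exists (b * 2^-1 `^ t / 2).
  by rewrite !mulr_gt0 ?powR_gt0 ?invr_gt0.
near=> eps.
have eps0 : 0 < eps by near: eps; exact: nbhs_right_gt.
have epsa : eps < a by near: eps; apply: nbhs_right_lt.
have e2 : 0 < eps / 2 by rewrite divr_gt0.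
(* The tail is taken at level [eps / 2], as the deficit estimate requires; this accounts for the
   factor [2^-1] to the power [t] in the constant, and the final [/ 2] comes from the deficit
   estimate itself. *)
have [|A [mA Aeps Aphi]] := bP _ e2; first by lra.
apply: le_trans (Xi_deficit_ge phi0 eps0 mA Aphi).
rewrite mulrAC ler_pM2r ?invr_gt0//; apply: le_trans Aeps.
by rewrite powRM ?invr_ge0 ?(ltW eps0)// mulrA mulrAC.
Unshelve. all: by end_near. Qed.
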